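(* One has $$\lim_{x\to\infty}\frac{\log(x/A(x))}{\sqrt{\log x}\,\log\log x}=\frac1{2\sqrt{\log 2}}.$$ Equivalently, $$A(x)=x\exp\!\left(-\left(\frac1{2\sqrt{\log 2}}+o(1)\right)\sqrt{\log x}\,\log\log x\right)\qquad(x\to\infty).$$
   Context: All logarithms are natural. Let $\mathbb N=\{1,2,3,\ldots\}$. Let $\mathcal A\subseteq\mathbb N$ be the set of all positive integers $n$ satisfying the Sylow divisor condition: for every prime $p\mid n$ there is a divisor $d\mid n$ with $d>1$ and $d\equiv1\pmod p$. In particular $1\in\mathcal A$ vacuously. For real $x$, $A(x):=\#\{n\le x:n\in\mathcal A\}$. *)

(* Defs.v *)
From HB Require Import structures.
From mathcomp Require Import all_boot all_order all_algebra.
From mathcomp Require Import finmap.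
From mathcomp Require Import all_classical all_reals all_analysis.
Import Order.TTheory GRing.Theory Num.Theory.
Import numFieldNormedType.Exports.

Set Implicit Arguments.
Unset Strict Implicit.
Unset Printing Implicit Defensive.

Local Open Scope classical_set_scope.
Local Open Scope ring_scope.

Definition sylow_set : set nat :=
  [set n | (0 < n)%N /\
    forall p : nat, prime p -> (p %| n)%N ->
      exists d : nat, [/\ (d %| n)%N, (1 < d)%N & (d = 1 %[mod p])%N]].

Definition sylow_upto (R : realType) (x : R) : set nat :=
  [set n | sylow_set n /\ n%:R <= x].

(* [fset_set] is the empty set on infinite arguments; this lemma rules out
   that junk value below. *)
Lemma finite_sylow_upto (R : realType) (x : R) : finite_set (sylow_upto x).
Proof.
apply: (sub_finite_set _ (finite_II (Num.truncn x).+1)) => n [_ nx] /=.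
rewrite ltnS -(natrK n (R := R)).
exact: le_truncn.
Qed.

Definition sylow_count (R : realType) (x : R) : nat :=
  #|` fset_set (sylow_upto x)|%fset.

(* Main.v *)
Require Import Defs.
From mathcomp Require Import all_boot all_order all_algebra.
From mathcomp Require Import finmap.
From mathcomp Require Import all_classical all_reals all_analysis.
From mathcomp Require Import zify ring lra.
Import Order.TTheory GRing.Theory Num.Theory.
Import numFieldNormedType.Exports.
Set Implicit Arguments.
Unset Strict Implicit.
Unset Printing Implicit Defensive.
Local Open Scope ring_scope.

(** Let [s = sqrt (ln x)], [lam = ln (ln x)] and [a = sqrt (ln 2)].  A product of [k] primes
    of size about [expR (s ^ 2 / k)] has about [2 ^ k] divisors, and one expects it to be a
    Sylow number once these outnumber the residues modulo its primes: each prime [p] needs one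
    of the divisors to fall into the class of [1] modulo [p].  Hence [k] must be about [s / a].
    Such products have density about [1 / k`!], that is
    [expR (- (s / a) * (lam / 2))], which is the claim.

    Upper bound.  Numbers are counted with the weight [1 / n], which is multiplicative and
    loses nothing at this scale.  Let [T = expR ((1 - eps) * a * s)].  Numbers [n = n1 * n2]
    with [tau n1 * tau n2 >= T] are rare, by high moments of the divisor function [tau]
    ([tau_moment], [hmass_tau_split]); this produces the main term.  Any other number has
    fewer than [log_2 T] distinct primes, so the primes
    up to [y = expR (a * s)] cannot make up its size: up to a square it contains many primes
    above [y] ([le_few_large_primes]).  Each such prime [p] of a Sylow number has a witness,
    a divisor [d > 1] with [p %| d - 1].  Either many of the witnesses are small; then one can
    strip off some of the large primes one after the other, each being one of the few
    primes dividing [d - 1] for one of the fewer than [T] divisors [d] of what is left, and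
    every step costs a factor of about [T / y] ([hmass_chain]).  Or many of them are large, and
    those can be cut into two large halves compatibly with one factorisation of the number
    ([entangled_of_large_witnesses]).  Modulo [p] one half determines the other, so by
    Cauchy-Schwarz the two halves may be replaced by two independent copies of one half that
    agree modulo [p]; but few primes divide the difference of two given numbers
    ([hmass_entangled]).

    Lower bound.  Draw [k] primes at random from blocks, [k] being slightly larger than
    [s / a]; then at least half of the products are Sylow numbers ([half_sylow]).  The large
    sieve shows that for all but few moduli [p] the product of four of the primes is close to
    uniform modulo [p] in mean square ([sum_chi2]), so the product of eight is at most
    about [1 / p] likely to hit any given nonzero residue ([product_prob_le]).  This controls
    the second moment of the number of subsets whose product lies in a given class, so on
    average only few classes are missed by all subset products ([mean_missed]), and one more
    independent product of eight primes turns a hit of its inverse class into a hit of [1]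
    ([mean_fails]).  A product comes from few tuples ([fibre_prodon]), and the primes in
    a block are numerous by Chebyshev's bound, so that many Sylow numbers arise
    ([sylow_count_ge]).

    The remaining work is to choose the parameters ([sylow_count_upper],
    [sylow_count_lower]). *)

(** * Logarithmic mass and moments of the divisor function *)

(** The form of all the union bounds below: each index [i] on the left is charged to some
    index [j] on the right that determines it. *)
Lemma ler_sum_cover (R : realFieldType) (I J : eqType) (r : seq I) (s : seq J)
    (P : pred I) (Q : pred J) (F : I -> R) (G : J -> R) (h : J -> I) :
  uniq r -> (forall j, j \in s -> Q j -> 0 <= G j) ->
  (forall i, i \in r -> P i ->
     exists j, [/\ j \in s, Q j, h j = i & F i <= G j]) ->
  \sum_(i <- r | P i) F i <= \sum_(j <- s | Q j) G j.
Proof.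
move=> ur G0 cov.
have step : \sum_(i <- r | P i) F i <=
    \sum_(i <- r) \sum_(j <- s | Q j && (h j == i)) G j.
  rewrite big_mkcond /= !big_seq; apply: ler_sum => i ir.
  have nn : 0 <= \sum_(j <- s | Q j && (h j == i)) G j.
    by rewrite big_seq_cond; apply: sumr_ge0 => j /and3P[js Qj _]; exact: G0.
  case: ifP => // Pi; have [j [js Qj hj FG]] := cov _ ir Pi.
  apply: (le_trans FG); rewrite (big_rem j) //= Qj hj eqxx /= lerDl.
  rewrite big_seq_cond; apply: sumr_ge0 => j' /and3P[js' Qj' _].
  by apply: G0 => //; exact: mem_rem js'.
apply: (le_trans step).
rewrite (exchange_big_dep Q) /=; last by move=> i j _ /andP[].
rewrite big_seq_cond [leRHS]big_seq_cond.
apply: ler_sum => j /andP[js Qj].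
rewrite (eq_bigl (pred1 (h j))); last by move=> i; rewrite Qj /= eq_sym.
rewrite big_const_seq (count_uniq_mem _ ur).
by case: (h j \in r); rewrite /= ?addr0 ?G0.
Qed.

(** Each term is at most [2 / v - 2 / (v + 1)], and these telescope. *)
Lemma sum_inv_sqr_tail (R : realFieldType) (V M : nat) : (0 < V)%N ->
  \sum_(V <= v < M) (v%:R ^- 2 : R) <= 2 / V%:R.
Proof.
move=> V0; have [VM|MV] := leqP V M; last first.
  by rewrite big_geq ?(ltnW MV) // divr_ge0 ?ler0n.
have : \sum_(V <= v < M) (v%:R ^- 2 : R) <= 2 / V%:R - 2 / M%:R.
  elim: M VM => [|M IH] VM; first by rewrite leqn0 in VM; move: V0; rewrite (eqP VM).
  move: VM; rewrite leq_eqVlt => /orP[/eqP<-|]; first by rewrite big_geq // subrr.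
  rewrite ltnS => VM; rewrite big_nat_recr //=.
  have M0 : (0 < M)%N by exact: leq_trans V0 VM.
  have M0R : 0 < M%:R :> R by rewrite ltr0n.
  have M1R : 1 <= M%:R :> R by rewrite ler1n.
  have step : (M%:R ^- 2 : R) <= 2 / M%:R - 2 / M.+1%:R.
    rewrite -[M.+1%:R]natr1 -subr_ge0.
    have -> : 2 / M%:R - 2 / (M%:R + 1) - M%:R ^- 2 =
       (M%:R - 1) / (M%:R ^+ 2 * (M%:R + 1)) :> R by field; lra.
    by rewrite divr_ge0 ?mulr_ge0 ?exprn_ge0; lra.
  by apply: (le_trans (lerD (IH VM) step)); rewrite addrA subrK.
have : 0 <= 2 / M%:R :> R by rewrite divr_ge0 ?ler0n.
lra.
Qed.

Definition tau (n : nat) : nat := size (divisors n).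

Definition hmass (R : realFieldType) (N : nat) (P : pred nat) : R :=
  \sum_(1 <= n < N.+1 | P n) n%:R^-1.

Definition harm (R : realFieldType) (N : nat) : R := hmass R N xpredT.

Lemma harm_ge0 (R : realFieldType) N : 0 <= harm R N.
Proof. by rewrite /harm /hmass; apply: sumr_ge0 => n _; rewrite invr_ge0 ler0n. Qed.

Lemma mem_pos_iota (N n : nat) : (n \in index_iota 1 N.+1) = (0 < n <= N)%N.
Proof. by rewrite mem_index_iota ltnS. Qed.

(** Every [n] counted on the left is at most [N], so it weighs at least [1 / N]. *)
Lemma count_le_hmass (R : realFieldType) (N : nat) (P : pred nat) :
  (\sum_(1 <= n < N.+1 | P n) 1)%N%:R <= N%:R * hmass R N P.
Proof.
rewrite /hmass mulr_sumr natr_sum big_seq_cond [leRHS]big_seq_cond.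
apply: ler_sum => n /andP[]; rewrite mem_pos_iota => /andP[n0 nN] _.
by rewrite ler_pdivlMr ?ltr0n // mul1r ler_nat.
Qed.

Lemma hmassU (R : realFieldType) (N : nat) (P Q : pred nat) :
  hmass R N (predU P Q) <= hmass R N P + hmass R N Q.
Proof.
rewrite /hmass big_mkcond [X in _ <= X + _]big_mkcond [X in _ <= _ + X]big_mkcond.
rewrite -big_split /=; apply: ler_sum => n _.
have : 0 <= n%:R^-1 :> R by rewrite invr_ge0 ler0n.
by case: (P n); case: (Q n) => /=; lra.
Qed.

Lemma tau_gt0 n : (0 < n)%N -> (0 < tau n)%N.
Proof.
by move=> n0; rewrite /tau; have := divisors_id n0; case: (divisors n).
Qed.

Lemma dvdn_tau (m n : nat) : (0 < n)%N -> (m %| n)%N -> (tau m <= tau n)%N.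
Proof.
move=> n0 mn; have m0 := dvdn_gt0 n0 mn.
apply: uniq_leq_size; first exact: divisors_uniq.
move=> d; rewrite -!dvdn_divisors // => dm; exact: dvdn_trans mn.
Qed.

(** Split a divisor [d] of [a * b] as [gcdn d a] times a divisor of [b]. *)
Lemma tauM (a b : nat) : (0 < a)%N -> (0 < b)%N -> (tau (a * b) <= tau a * tau b)%N.
Proof.
move=> a0 b0; have ab0 : (0 < a * b)%N by rewrite muln_gt0 a0.
rewrite /tau -(size_map (fun d => (gcdn d a, d %/ gcdn d a)%N)) -(size_allpairs pair).
apply: uniq_leq_size.
  rewrite map_inj_in_uniq ?divisors_uniq // => d d' _ _ [eg eq].
  by rewrite -(divnK (dvdn_gcdl d a)) eq eg divnK // dvdn_gcdl.
move=> _ /mapP[d + ->]; rewrite -dvdn_divisors // => dab.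
have d0 : (0 < d)%N by exact: dvdn_gt0 dab.
apply/allpairsP; exists (gcdn d a, d %/ gcdn d a)%N; split => //=.
  by rewrite -dvdn_divisors // dvdn_gcdr.
rewrite -dvdn_divisors //.
have g0 : (0 < gcdn d a)%N by rewrite gcdn_gt0 d0.
have cop : coprime (d %/ gcdn d a) (a %/ gcdn d a).
  by rewrite /coprime -(eqn_pmul2r g0) muln_gcdl !divnK ?dvdn_gcdl ?dvdn_gcdr ?mul1n.
rewrite -(Gauss_dvdr _ cop) -(dvdn_pmul2r g0) divnK ?dvdn_gcdl //.
by rewrite mulnAC divnK ?dvdn_gcdr.
Qed.

Lemma tau_prime (p : nat) : prime p -> tau p = 2%N.
Proof.
move=> pp; have p0 := prime_gt0 pp; apply/eqP; rewrite eqn_leq; apply/andP; split.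
  have -> : 2%N = size [:: 1; p]%N by [].
  apply: uniq_leq_size; first exact: divisors_uniq.
  by move=> d; rewrite -dvdn_divisors // !inE => dp; case/primeP: pp => _ /(_ _ dp).
have -> : 2%N = size [:: 1; p]%N by [].
apply: uniq_leq_size; first by rewrite /= inE andbT neq_ltn prime_gt1.
by move=> d; rewrite !inE -dvdn_divisors // => /orP[]/eqP->.
Qed.

(** Writing [tau n] as the number of factorisations [n = a * b] and using submultiplicativity
    of [tau] bounds each moment by the square of the previous one. *)
Lemma tau_moment (R : realFieldType) (N j : nat) :
  \sum_(1 <= n < N.+1) ((tau n)%:R ^+ j / n%:R : R) <= harm R N ^+ (2 ^ j).
Proof.
elim: j => [|j IH].
  rewrite expn0 expr1 /harm /hmass; apply: ler_sum => n _.
  by rewrite expr0 mul1r.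
have nn : 0 <= \sum_(1 <= n < N.+1) ((tau n)%:R ^+ j / n%:R : R).
  by apply: sumr_ge0 => n _; rewrite divr_ge0 ?exprn_ge0 ?ler0n.
rewrite expnSr exprM; apply: le_trans (lerXn2r 2 nn (le_trans nn IH) IH).
rewrite expr2 big_distrlr /=.
have -> : \sum_(1 <= n < N.+1) ((tau n)%:R ^+ j.+1 / n%:R : R) =
   \sum_(nd <- [seq (n, d) | n <- index_iota 1 N.+1, d <- divisors n])
     (tau nd.1)%:R ^+ j / nd.1%:R.
  rewrite big_allpairs_dep; apply: eq_bigr => n _ /=.
  by rewrite big_const_seq count_predT iter_addr addr0 exprS -[RHS]mulr_natl mulrA.
rewrite -(big_allpairs (F := fun ab : nat * nat =>
  (tau ab.1)%:R ^+ j / ab.1%:R * ((tau ab.2)%:R ^+ j / ab.2%:R))).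
apply: (@ler_sum_cover _ _ _ _ _ _ _ _ _ (fun ab => (ab.1 * ab.2, ab.1)%N)).
- apply: allpairs_uniq_dep; first exact: iota_uniq.
    by move=> n _; exact: divisors_uniq.
  by move=> [a b] [c d] _ _ [-> ->].
- by move=> ab _ _; rewrite !mulr_ge0 ?invr_ge0 ?exprn_ge0 ?ler0n.
move=> _ /allpairsPdep[n [d [nN dn ->]]] _; exists (d, n %/ d)%N => /=.
move: nN; rewrite mem_pos_iota => /andP[n0 nN].
move: dn; rewrite -dvdn_divisors // => dn.
have d0 := dvdn_gt0 n0 dn.
have e0 : (0 < n %/ d)%N by rewrite divn_gt0 // dvdn_leq.
split => //; last 2 first.
- by rewrite mulnC divnK.
- rewrite mulrACA -exprMn -invfM -natrM -natrM [(d * (n %/ d))%N]mulnC divnK //.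
  rewrite ler_wpM2r ?invr_ge0 ?ler0n // lerXn2r ?nnegrE ?ler0n // ler_nat.
  by rewrite -{1}(divnK dn) mulnC tauM.
apply/allpairsP; exists (d, n %/ d)%N; split => //=.
  by rewrite mem_pos_iota d0 (leq_trans (dvdn_leq n0 dn)).
by rewrite mem_pos_iota e0 (leq_trans (leq_div _ _)).
Qed.

Definition tau_split (T : nat) : pred nat :=
  [pred n | [exists a : 'I_n.+1, [&& (a %| n)%N & (T <= tau a * tau (n %/ a))%N]]].

(** Markov's inequality for the [j]-th moment, applied to both factors at once. *)
Lemma hmass_tau_split (R : realFieldType) (N T j : nat) :
  hmass R N (tau_split T) * T%:R ^+ j <= harm R N ^+ (2 ^ j) * harm R N ^+ (2 ^ j).
Proof.
set S : R := \sum_(1 <= n < N.+1) ((tau n)%:R ^+ j / n%:R : R).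
have nn : 0 <= S.
  by apply: sumr_ge0 => n _; rewrite divr_ge0 ?exprn_ge0 ?ler0n.
have SS : S * S <= harm R N ^+ (2 ^ j) * harm R N ^+ (2 ^ j).
  by rewrite ler_pM // /S tau_moment.
apply: le_trans SS; rewrite /S /hmass big_distrlr mulr_suml /=.
rewrite -(big_allpairs (F := fun ab : nat * nat =>
  (tau ab.1)%:R ^+ j / ab.1%:R * ((tau ab.2)%:R ^+ j / ab.2%:R))).
apply: (@ler_sum_cover _ _ _ _ _ _ _ _ _ (fun ab => ab.1 * ab.2)%N).
- exact: iota_uniq.
- by move=> ab _ _; rewrite !mulr_ge0 ?invr_ge0 ?exprn_ge0 ?ler0n.
move=> n + /existsP[a /andP[an Ta]]; rewrite mem_pos_iota => /andP[n0 nN].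
have a0 := dvdn_gt0 n0 an.
have e0 : (0 < n %/ a)%N by rewrite divn_gt0 // dvdn_leq.
exists (val a, n %/ a)%N; split => //=.
- apply/allpairsP; exists (val a, n %/ a)%N; split => //=.
    by rewrite mem_pos_iota a0 (leq_trans (dvdn_leq n0 an)).
  by rewrite mem_pos_iota e0 (leq_trans (leq_div _ _)).
- by rewrite mulnC divnK.
rewrite mulrACA -exprMn -invfM -natrM -natrM [(a * (n %/ a))%N]mulnC divnK //.
rewrite mulrC ler_wpM2r ?invr_ge0 ?ler0n // lerXn2r ?nnegrE ?ler0n // ler_nat //.
Qed.

(** * Numbers with few divisors owe their size to large primes *)

Lemma coprime_bigprod (I : Type) (s : seq I) (F : I -> nat) (m : nat) :
  all (fun i => coprime (F i) m) s -> coprime (\prod_(i <- s) F i) m.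
Proof.
elim: s => [|i s IH] /=; first by rewrite big_nil coprime1n.
by case/andP=> im sm; rewrite big_cons coprimeMl im IH.
Qed.

Lemma prime_coprime_neq (p q : nat) : prime p -> prime q -> p != q -> coprime p q.
Proof. by move=> pp pq pNq; rewrite prime_coprime // dvdn_prime2. Qed.

Lemma prod_primes_dvd (s : seq nat) (n : nat) :
  uniq s -> all prime s -> all (fun p => p %| n)%N s -> (\prod_(p <- s) p %| n)%N.
Proof.
elim: s => [|p s IH] /=; first by rewrite big_nil dvd1n.
case/andP=> ps us /andP[pp ap] /andP[pn an].
rewrite big_cons Gauss_dvd ?pn ?IH // coprime_sym.
apply: coprime_bigprod; apply/allP => q qs.
apply: prime_coprime_neq => //; first exact: (allP ap).
by apply: contraNneq ps => <-.
Qed.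

(** For distinct primes these are different divisors of their product, which bounds
    the number of divisors from below. *)
Fixpoint subset_products (s : seq nat) : seq nat :=
  if s is p :: s' then
    subset_products s' ++ map (muln p) (subset_products s')
  else [:: 1%N].

Lemma subset_products_dvd (s : seq nat) d :
  d \in subset_products s -> (d %| \prod_(p <- s) p)%N.
Proof.
elim: s d => [|p s IH] d /=; first by rewrite inE big_nil => /eqP->.
rewrite mem_cat big_cons => /orP[/IH ds|/mapP[e /IH es ->]].
  by rewrite dvdn_mull.
by rewrite dvdn_mul.
Qed.

Lemma subset_products_uniq (s : seq nat) :
  uniq s -> all prime s -> uniq (subset_products s).
Proof.
elim: s => [//|p s IH] /= /andP[ps us] /andP[pp ap].
have IHs := IH us ap.
rewrite cat_uniq IHs map_inj_uniq ?IHs ?andbT; last first.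
  by move=> a b /eqP; rewrite eqn_pmul2l ?prime_gt0 // => /eqP.
apply/hasPn => _ /mapP[e _ ->]; apply/negP => /subset_products_dvd ds.
have : (p %| \prod_(q <- s) q)%N by apply: dvdn_trans ds; rewrite dvdn_mulr.
apply/negP; rewrite -prime_coprime // coprime_sym; apply: coprime_bigprod.
apply/allP => q qs; apply: prime_coprime_neq => //; first exact: (allP ap).
by apply: contraNneq ps => <-.
Qed.

Lemma size_subset_products s : size (subset_products s) = (2 ^ size s)%N.
Proof.
by elim: s => //= p s IH; rewrite size_cat size_map IH addnn -mul2n expnS.
Qed.

Lemma exp_omega_tau (n : nat) : (0 < n)%N -> (2 ^ size (primes n) <= tau n)%N.
Proof.
move=> n0; rewrite -size_subset_products; apply: uniq_leq_size.
  apply: subset_products_uniq; first exact: primes_uniq.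
  by apply/allP => p; rewrite mem_primes => /and3P[].
move=> d /subset_products_dvd dP; rewrite -dvdn_divisors //.
apply: (dvdn_trans dP); apply: prod_primes_dvd; first exact: primes_uniq.
  by apply/allP => p; rewrite mem_primes => /and3P[].
by apply/allP => p; rewrite mem_primes => /and3P[].
Qed.

Lemma tau_le (n : nat) : (0 < n)%N -> (tau n <= n)%N.
Proof.
move=> n0; rewrite -{2}(size_iota 1 n); apply: uniq_leq_size; first exact: divisors_uniq.
move=> d; rewrite -dvdn_divisors // mem_iota => dn.
by rewrite (dvdn_gt0 n0 dn) /= add1n ltnS dvdn_leq.
Qed.

Lemma omega_log (n N : nat) : (0 < n <= N)%N -> (size (primes n) <= trunc_log 2 N)%N.
Proof.
case/andP=> n0 nN; apply: trunc_log_max => //.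
by apply: leq_trans nN; apply: leq_trans (tau_le n0); exact: exp_omega_tau.
Qed.

(** Take for [v] the product of the [p ^ (e %/ 2)] over the prime powers [p ^ e] exactly
    dividing [n]. *)
Lemma le_sqr_rad (n : nat) : (0 < n)%N ->
  exists v, [/\ (0 < v)%N, (v ^ 2 %| n)%N & (n <= v ^ 2 * \prod_(p <- primes n) p)%N].
Proof.
move=> n0; pose v := (\prod_(p <- primes n) p ^ (logn p n)./2)%N.
have nE : n = (\prod_(p <- primes n) p ^ logn p n)%N.
  by rewrite {1}(prod_prime_decomp n0) prime_decompE big_map.
have vE : (v ^ 2 = \prod_(p <- primes n) p ^ ((logn p n)./2).*2)%N.
  rewrite /v -mulnn -big_split /=; apply: eq_bigr => p _.
  by rewrite -expnD addnn.
exists v; split.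
- rewrite /v big_seq; apply: prodn_cond_gt0 => p; rewrite mem_primes => /and3P[pp _ _].
  by rewrite expn_gt0 prime_gt0.
- rewrite vE [X in (_ %| X)%N]nE; apply: (big_ind2 (fun a b => a %| b)%N) => // [a b c d|p _]; first exact: dvdn_mul.
  apply: dvdn_exp2l.
  by rewrite -{2}(odd_double_half (logn p n)) leq_addl.
rewrite vE [X in (X <= _)%N]nE -big_split /= big_seq [leqRHS]big_seq.
apply: (big_ind2 leq) => // [a b c d|p]; first exact: leq_mul.
rewrite mem_primes => /and3P[pp _ _]; rewrite -expnSr leq_pexp2l ?prime_gt0 //.
by rewrite -{1}(odd_double_half (logn p n)); case: odd => //; rewrite ?add0n leqW.
Qed.

(** Up to a factor [V ^ 2] the number is at most the product of its distinct primes: those up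
    to [y] contribute at most [y] each, the others at most [z]. *)
Lemma le_few_large_primes (n V y z : nat) : (0 < n)%N -> (0 < y)%N -> (0 < z)%N ->
  (forall v, (v ^ 2 %| n)%N -> (v < V)%N) ->
  (forall p, prime p -> (p %| n)%N -> (p <= z)%N) ->
  (n <= V ^ 2 * (y ^ size (primes n) * z ^ count (fun p => y < p) (primes n)))%N.
Proof.
move=> n0 y0 z0 sq pz; have [v [v0 vn nv]] := le_sqr_rad n0.
apply: (leq_trans nv); apply: leq_mul.
  by rewrite leq_exp2r // ltnW // sq.
have : all (fun p => p <= z)%N (primes n).
  by apply/allP => p; rewrite mem_primes => /and3P[pp _ pn]; exact: pz.
elim: (primes n) => [|p s IH] /=; first by rewrite big_nil.
case/andP=> ppz /IH{}IH; rewrite big_cons.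
case: ltnP => yp; rewrite ?add1n ?add0n !expnS.
  apply: (leq_trans (leq_mul ppz IH)).
  by rewrite mulnCA -[leqRHS]mulnA leq_pmull.
by rewrite -mulnA; apply: leq_mul.
Qed.

(** * Square divisors and huge primes are rare *)

Definition square_part (V : nat) : pred nat :=
  [pred n | [exists v : 'I_n.+1, (V <= v)%N && (v ^ 2 %| n)%N]].

Lemma hmass_square_part (R : realFieldType) (N V : nat) : (0 < V)%N ->
  hmass R N (square_part V) <= 2 / V%:R * harm R N.
Proof.
move=> V0; apply: le_trans (_ : (\sum_(V <= v < N.+1) (v%:R ^- 2 : R)) * harm R N <= _).
  rewrite /harm /hmass big_distrlr /=.
  rewrite -(big_allpairs (F := fun ab : nat * nat => ab.1%:R ^- 2 * ab.2%:R^-1)).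
  apply: (@ler_sum_cover _ _ _ _ _ _ _ _ _ (fun ab => ab.1 ^ 2 * ab.2)%N).
  - exact: iota_uniq.
  - by move=> ab _ _; rewrite mulr_ge0 ?invr_ge0 ?exprn_ge0 ?ler0n.
  move=> n + /existsP[v /andP[Vv vn]]; rewrite mem_pos_iota => /andP[n0 nN].
  have v20 := dvdn_gt0 n0 vn.
  exists (val v, n %/ v ^ 2)%N; split => //=.
  - apply/allpairsP; exists (val v, n %/ v ^ 2)%N; split => //=.
      rewrite mem_index_iota Vv ltnS; apply: leq_trans nN.
      by rewrite -ltnS ltn_ord.
    rewrite mem_pos_iota divn_gt0 // dvdn_leq //=.
    exact: leq_trans (leq_div _ _) nN.
  - by rewrite mulnC divnK.
  - by rewrite -natrX -invfM -natrM mulnC divnK.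
by rewrite ler_wpM2r ?harm_ge0 // sum_inv_sqr_tail.
Qed.

(** The divisor that the Sylow condition asks for at [p]; the congruence is written as
    [p %| d.-1] because the prime is often recovered from [d]. *)
Definition witness (p d n : nat) : bool := [&& (1 < d)%N, (d %| n)%N & (p %| d.-1)%N].

Lemma witness_coprime (p d n : nat) : witness p d n -> coprime p d.
Proof.
case/and3P=> d1 _ /dvdnP[k kE]; have d0 := ltnW d1.
by rewrite -(prednK d0) kE -addn1 /coprime gcdnMDl gcdn1.
Qed.

Definition huge_prime (z : nat) : pred nat :=
  [pred n | [exists p : 'I_n.+1, [exists d : 'I_n.+1,
     [&& (z < p)%N, (p %| n)%N & witness p d n]]]].

(** With [d = p * j + 1] the number is a multiple of [p * d], which exceeds [p ^ 2 * j]. *)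
Lemma hmass_huge_prime (R : realFieldType) (N z : nat) :
  hmass R N (huge_prime z) <= 2 / z.+1%:R * harm R N ^+ 2.
Proof.
apply: le_trans (_ : (\sum_(z.+1 <= p < N.+1) (p%:R ^- 2 : R)) * harm R N ^+ 2 <= _); last first.
  by rewrite ler_wpM2r ?exprn_ge0 ?harm_ge0 // sum_inv_sqr_tail.
rewrite expr2 /harm /hmass [X in _ * X]big_distrlr /=.
rewrite -(big_allpairs (F := fun ab : nat * nat => ab.1%:R^-1 * ab.2%:R^-1)).
rewrite big_distrlr /=.
rewrite -(big_allpairs (F := fun pj : nat * (nat * nat) =>
  pj.1%:R ^- 2 * (pj.2.1%:R^-1 * pj.2.2%:R^-1))).
apply: (@ler_sum_cover _ _ _ _ _ _ _ _ _
  (fun pj => pj.1 * (pj.1 * pj.2.1).+1 * pj.2.2)%N).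
- exact: iota_uniq.
- by move=> ab _ _; rewrite !mulr_ge0 ?invr_ge0 ?exprn_ge0 ?ler0n.
move=> n + /existsP[p /existsP[d /and3P[zp pn w]]].
rewrite mem_pos_iota => /andP[n0 nN].
have p0 := dvdn_gt0 n0 pn.
have cop := witness_coprime w.
case/and3P: w => d1 dn /dvdnP[j jE].
have d0 := ltnW d1.
have dE : (p * j).+1 = d by rewrite mulnC -jE prednK.
have pdn : (p * d %| n)%N by rewrite Gauss_dvd ?pn.
have pd0 := dvdn_gt0 n0 pdn.
have nE : (p * d * (n %/ (p * d)) = n)%N by rewrite mulnC divnK.
have j0 : (0 < j)%N by rewrite lt0n; apply: contraTneq d1 => j0; rewrite -dE j0 muln0.
have jN : (j <= N)%N.
  apply: leq_trans nN; apply: leq_trans (dvdn_leq n0 dn).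
  by rewrite -dE ltnW // ltnS leq_pmull.
exists (val p, (j, n %/ (p * d)))%N; rewrite /= dE nE; split => //=.
- apply/allpairsP; exists (val p, (j, n %/ (p * d)))%N; split => //=.
    rewrite mem_index_iota zp /= ltnS; apply: leq_trans nN.
    by rewrite -ltnS ltn_ord.
  apply/allpairsP; exists (j, n %/ (p * d))%N; split => //=.
    by rewrite mem_pos_iota j0.
  rewrite mem_pos_iota divn_gt0 // dvdn_leq //=.
  exact: leq_trans (leq_div _ _) nN.
have q0 : (0 < n %/ (p * d))%N by rewrite divn_gt0 // dvdn_leq.
move: nE q0; set q := (n %/ (p * d))%N => nE q0.
have G0 : (0 < p ^ 2 * (j * q))%N by rewrite !muln_gt0 p0 j0 q0.
have le1 : (p ^ 2 * (j * q) <= n)%N.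
  rewrite -[leqRHS]nE -mulnn -!mulnA leq_mul // mulnA leq_mul //.
  by rewrite -dE ltnW.
have -> : p%:R ^- 2 * (j%:R^-1 * q%:R^-1) = ((p ^ 2 * (j * q))%N%:R : R)^-1.
  by rewrite !natrM expr2 !invfM.
by rewrite lef_pV2 ?posrE ?ltr0n // ler_nat.
Qed.

(** * Chains of small witnesses *)

(** The prime [p] stripped off first is the one added last when the number is
    built up: it is then one of the few prime factors of [d.-1] for a divisor [d] of the part
    already built, so there are few choices for it. *)
Fixpoint chain (y T L : nat) (n : nat) : bool :=
  if L is L'.+1 then
    [exists p : 'I_n.+1, [exists d : 'I_n.+1,
      [&& prime p, (y < p)%N, (p %| n)%N, witness p d (n %/ p),
          (tau (n %/ p) <= T)%N & chain y T L' (n %/ p)]]]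
  else true.

(** A chained number is [m * p] with [p] among the large prime factors of the [d.-1], [d %| m]:
    at most [T * trunc_log 2 N] choices given [m], each weighing less than [1 / (m * y)]. *)
Lemma hmass_chainS (R : realFieldType) (N y T L : nat) : (0 < y)%N ->
  hmass R N (chain y T L.+1) <=
  hmass R N (chain y T L) * (T%:R * (trunc_log 2 N)%:R / y%:R).
Proof.
move=> y0; set l := trunc_log 2 N.
pose inner m := [seq (d, p) | d <- divisors m, p <- [seq p <- primes d.-1 | (y < p)%N]].
(* A term [(m, (d, p))] stands for the number [m * p]. *)
apply: le_trans (_ : \sum_(j <- [seq (m, x) | m <- index_iota 1 N.+1, x <- inner m]
     | chain y T L j.1 && (tau j.1 <= T)%N) (j.1%:R^-1 / y%:R : R) <= _).
  apply: (@ler_sum_cover _ _ _ _ _ _ _ _ _ (fun j => j.1 * j.2.2)%N).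
  - exact: iota_uniq.
  - by move=> ab _ _; rewrite divr_ge0 ?invr_ge0 ?ler0n.
  move=> n + /existsP[p /existsP[d /and5P[pp yp pn w /andP[tT ch]]]].
  rewrite mem_pos_iota => /andP[n0 nN].
  have p0 := prime_gt0 pp.
  have np0 : (0 < n %/ p)%N by rewrite divn_gt0 // dvdn_leq.
  exists (n %/ p, (val d, val p))%N => /=; split; rewrite ?tT ?divnK ?andbT //.
    apply/allpairsPdep; exists (n %/ p)%N, (val d, val p); split => //.
      by rewrite mem_pos_iota np0 (leq_trans (leq_div _ _)).
    case/and3P: w => d1 dn pd.
    apply/allpairsPdep; exists (val d), (val p); split => //.
      by rewrite -dvdn_divisors.
    by rewrite mem_filter yp mem_primes pp pd -subn1 subn_gt0 d1.
  rewrite -invfM lef_pV2 ?posrE ?mulr_gt0 ?ltr0n // -natrM ler_nat.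
  by rewrite -[leqRHS](divnK pn) leq_mul // ltnW.
rewrite big_mkcond big_allpairs_dep /= /hmass mulr_suml [leRHS]big_mkcond /=.
rewrite big_seq [leRHS]big_seq; apply: ler_sum => m; rewrite mem_pos_iota => /andP[m0 mN].
case ch: (chain y T L m) => /=; last by rewrite big1.
rewrite -big_mkcond /=; case: (leqP (tau m) T) => tT; last first.
  rewrite big_pred0; last by move=> i; rewrite ?ch.
  by rewrite mulr_ge0 ?invr_ge0 ?divr_ge0 ?mulr_ge0 ?ler0n.
rewrite (eq_bigl predT); last by move=> i; rewrite ?tT.
rewrite big_const_seq count_predT iter_addr addr0 -[leLHS]mulr_natl.
rewrite mulrCA ler_wpM2l ?invr_ge0 ?ler0n //.
rewrite ler_wpM2r ?invr_ge0 ?ler0n // -natrM ler_nat.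
apply: (@leq_trans (tau m * l)); last by rewrite leq_mul2r tT orbT.
rewrite /inner size_allpairs_dep /tau.
have : all (fun d => (0 < d <= N)%N) (divisors m).
  apply/allP => d; rewrite -dvdn_divisors // => dm.
  by rewrite (dvdn_gt0 m0 dm) (leq_trans (dvdn_leq m0 dm)).
elim: (divisors m) => //= d s IH /andP[/andP[d0 dN] /IH]; rewrite mulSn.
apply: leq_add; rewrite size_filter (leq_trans (count_size _ _)) //.
case: d d0 dN => [//|[|d]] _ dN //=.
by apply: omega_log; rewrite /= (ltnW dN).
Qed.

Lemma hmass_chain (R : realFieldType) (N y T L : nat) : (0 < y)%N ->
  hmass R N (chain y T L) <= harm R N * (T%:R * (trunc_log 2 N)%:R / y%:R) ^+ L.
Proof.
move=> y0; elim: L => [|L IH]; first by rewrite expr0 mulr1.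
apply: (le_trans (hmass_chainS R N T L y0)).
by rewrite exprSr [leRHS]mulrA ler_wpM2r // divr_ge0 ?mulr_ge0 ?ler0n.
Qed.

(** Keep the head of the list and discard the at most [D] elements it is related to. *)
Lemma greedy_independent (T : eqType) (E : rel T) (D L : nat) (s : seq T) :
  (forall u, u \in s -> (count (E u) s <= D)%N) -> (D.+1 * L <= size s)%N ->
  exists q, [/\ subseq q s, size q = L & pairwise (fun u v => ~~ E u v) q].
Proof.
elim: L s => [|L IH] s degD sL; first by exists [::]; rewrite sub0seq.
case: s degD sL => [|u s] degD sL; first by rewrite mulnS in sL.
pose s' := [seq v <- s | ~~ E u v].
have subs : subseq s' (u :: s) by apply: subseq_trans (subseq_cons _ _); exact: filter_subseq.
have [||q [qs qL pq]] := IH s'.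
- move=> v vs; apply: leq_trans (degD v (mem_subseq subs vs)).
  exact: leq_count_subseq.
- have := count_predC (E u) s; have := degD u (mem_head _ _).
  rewrite /s' size_filter /= => dD cC.
  have -> : count (fun v => ~~ E u v) s = count (predC (E u)) s by [].
  rewrite mulnS /= in sL; lia.
exists (u :: q); split => /=; last 1 first.
- rewrite pq andbT; apply/allP => v vq.
  by have := mem_subseq qs vq; rewrite mem_filter => /andP[].
- by rewrite eqxx (subseq_trans qs) // filter_subseq.
by rewrite qL.
Qed.

(** A witness [d] of [u] that is coprime to the primes stripped off before survives as a
    divisor of the quotient.  It is coprime to [u] itself automatically. *)
Lemma chain_of_independent (y T n : nat) (dd : nat -> nat) (q : seq nat) :
  (0 < n)%N -> (tau n <= T)%N -> uniq q ->
  (forall u, u \in q -> [/\ prime u, (y < u)%N, (u %| n)%N & witness u (dd u) n]) ->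
  pairwise (fun u v => ~~ (v %| dd u)%N) q -> chain y T (size q) n.
Proof.
elim/last_ind: q n => [//|q u IH] n n0 nT; rewrite rcons_uniq => /andP[uq uniq_q] H.
rewrite pairwise_rcons => /andP[aq pq]; rewrite size_rcons /=.
have [|pu yu un wu] := H u; first by rewrite mem_rcons mem_head.
have u0 := prime_gt0 pu.
have nu0 : (0 < n %/ u)%N by rewrite divn_gt0 // dvdn_leq.
have unn : (n %/ u %| n)%N by rewrite -{2}(divnK un) dvdn_mulr.
have div v : coprime (dd v) u -> witness v (dd v) n -> witness v (dd v) (n %/ u).
  move=> cop /and3P[d1 dn vd]; rewrite /witness d1 vd andbT /=.
  by rewrite -(Gauss_dvdl _ cop) divnK.
have wu' : witness u (dd u) (n %/ u).
  by apply: div => //; rewrite coprime_sym; exact: witness_coprime wu.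
have dun : (dd u < n.+1)%N.
  by case/and3P: wu => _ dn _; rewrite ltnS dvdn_leq.
have unS : (u < n.+1)%N by rewrite ltnS dvdn_leq.
apply/existsP; exists (Ordinal unS); apply/existsP; exists (Ordinal dun) => /=.
rewrite pu yu un wu' (leq_trans (dvdn_tau n0 unn) nT) /=.
apply: IH => //; first exact: leq_trans (dvdn_tau n0 unn) nT.
move=> v vq; have [|pv yv vn wv] := H v; first by rewrite mem_rcons inE vq orbT.
split => //.
  have vu : coprime v u.
    by apply: prime_coprime_neq => //; apply: contraNneq uq => <-.
  by rewrite -(Gauss_dvdl _ vu) divnK.
apply: div => //; rewrite coprime_sym prime_coprime //.
by move/allP: aq => /(_ v vq).
Qed.

(** The product of the primes counted is a divisor of [d] larger than [y] to their number. *)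
Lemma count_large_divisors (y D Z d : nat) (s : seq nat) :
  (1 < y)%N -> (0 < d <= Z)%N -> (Z < y ^ D.+1)%N -> uniq s ->
  all (fun p => prime p && (y < p)%N) s -> (count (fun p => p %| d)%N s <= D)%N.
Proof.
move=> y1 /andP[d0 dZ] ZD us ps; rewrite -ltnS -(ltn_exp2l _ _ y1).
apply: leq_ltn_trans ZD; apply: leq_trans dZ.
apply: (@leq_trans (\prod_(p <- [seq p <- s | (p %| d)%N]) p)%N).
  rewrite -size_filter; have : all (fun p => y < p)%N [seq p <- s | (p %| d)%N].
    by apply/allP => p; rewrite mem_filter => /andP[_ /(allP ps)/andP[]].
  elim: [seq p <- s | (p %| d)%N] => [|p q IH] /=; first by rewrite big_nil.
  by case/andP=> yp /IH IHq; rewrite big_cons expnS leq_mul // ltnW.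
apply: dvdn_leq => //; apply: prod_primes_dvd; first exact: filter_uniq.
  by apply/allP => p; rewrite mem_filter => /andP[_ /(allP ps)/andP[]].
by apply/allP => p; rewrite mem_filter => /andP[].
Qed.

(** * Entangled witnesses *)

(** Cauchy-Schwarz over the classes of [key]: a partial matching between classes of masses
    [N c] and [N c'] contributes [N c * N c'], at most the mean of [N c ^+ 2] and [N c' ^+ 2]. *)
Lemma matched_classes_le (R : realFieldType) (A K : finType) (key : A -> K)
    (w : A -> R) (B : rel A) :
  (forall a, 0 <= w a) ->
  (forall a b a' b', B a b -> B a' b' -> key a = key a' -> key b = key b') ->
  (forall a b a' b', B a b -> B a' b' -> key b = key b' -> key a = key a') ->
  \sum_a \sum_(b | B a b) w a * w b <= \sum_a \sum_(b | key a == key b) w a * w b.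
Proof.
move=> w0 Bl Br.
pose N c := \sum_(a | key a == c) w a.
have N0 c : 0 <= N c by apply: sumr_ge0 => a _.
pose P c c' := [exists a, [exists b, [&& B a b, key a == c & key b == c']]].
have Pl c c' c'' : P c c' -> P c c'' -> c' = c''.
  move=> /existsP[a /existsP[b /and3P[ab /eqP ac /eqP bc]]].
  move=> /existsP[a' /existsP[b' /and3P[ab' /eqP ac' /eqP bc']]].
  by rewrite -bc -bc'; apply: (Bl a b a' b') => //; rewrite ac ac'.
have Pr c c' c'' : P c' c -> P c'' c -> c' = c''.
  move=> /existsP[a /existsP[b /and3P[ab /eqP ac /eqP bc]]].
  move=> /existsP[a' /existsP[b' /and3P[ab' /eqP ac' /eqP bc']]].
  by rewrite -ac -ac'; apply: (Br a b a' b') => //; rewrite bc bc'.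
have unique_le (Q : pred K) (x : R) : 0 <= x ->
    (forall c c', Q c -> Q c' -> c = c') -> \sum_(c | Q c) x <= x.
  move=> x0 uQ; case: (pickP Q) => [c Qc|Q0]; last by rewrite big_pred0.
  rewrite (big_pred1 c) // => c' /=; apply/idP/eqP => [Qc'|->//].
  exact: uQ.
have -> : \sum_a \sum_(b | key a == key b) w a * w b = \sum_c N c ^+ 2.
  rewrite (partition_big key xpredT) //=; apply: eq_bigr => c _.
  rewrite expr2 {1}/N mulr_suml; apply: eq_bigr => a /eqP ac.
  by rewrite /N mulr_sumr; apply: eq_bigl => b; rewrite ac eq_sym.
have step1 : \sum_a \sum_(b | B a b) w a * w b <= \sum_c \sum_(c' | P c c') N c * N c'.
  rewrite (partition_big key xpredT) //=; apply: ler_sum => c _.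
  have -> : \sum_(c' | P c c') N c * N c' =
      \sum_(a | key a == c) \sum_(c' | P c c') w a * N c'.
    by rewrite exchange_big /=; apply: eq_bigr => c' _; rewrite mulr_suml.
  apply: ler_sum => a /eqP ac.
  rewrite (partition_big key (P c)) /=; last first.
    by move=> b ab; apply/existsP; exists a; apply/existsP; exists b; rewrite ab ac !eqxx.
  apply: ler_sum => c' _; rewrite /N mulr_sumr.
  rewrite [leRHS]big_mkcond [leLHS]big_mkcond; apply: ler_sum => b _.
  by case: (B a b) => //=; case: ifP => // _; rewrite mulr_ge0.
apply: (le_trans step1).
apply: le_trans (_ : \sum_c \sum_(c' | P c c') (N c ^+ 2 / 2 + N c' ^+ 2 / 2) <= _).
  apply: ler_sum => c _; apply: ler_sum => c' _.
  have := sqr_ge0 (N c - N c'); rewrite -subr_ge0 => h; nra.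
under eq_bigr do rewrite big_split /=.
rewrite big_split /= [X in _ + X](exchange_big_dep xpredT) //= -big_split /=.
apply: ler_sum => c _.
have n2 : 0 <= N c ^+ 2 / 2 by rewrite divr_ge0 ?sqr_ge0.
have := unique_le (P c) _ n2 (Pl c).
have := unique_le (fun c' => P c' c) _ n2 (Pr c).
by move=> h1 h2; lra.
Qed.

(** [p i] is a large prime whose witness is [e i * f i * g i], cut along the factorisation of
    [n] into [\prod_i p i], [n1] and [n2]. *)
Definition entangled (y E T L n : nat) : Prop :=
  exists (p e f g : 'I_L -> nat) (n1 n2 : nat),
    [/\ n = (\prod_i p i * (n1 * n2))%N,
        (tau n1 * tau n2 <= T)%N,
        forall i, [/\ prime (p i), (y < p i)%N, (e i %| n1)%N, (f i %| n2)%N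
                    & (g i %| \prod_j p j)%N]
      & forall i, [/\ (E <= e i)%N, (E <= f i)%N
                    & (e i * f i * g i = 1 %[mod p i])%N]].

Lemma sum_multiples_inv (R : realFieldType) (N a : nat) : (0 < a)%N ->
  \sum_(1 <= n < N.+1 | (a %| n)%N) (n%:R^-1 : R) <= harm R N / a%:R.
Proof.
move=> a0; rewrite /harm /hmass mulr_suml.
apply: (@ler_sum_cover _ _ _ _ _ _ _ _ _ (fun m => a * m)%N).
- exact: iota_uniq.
- by move=> m _ _; rewrite divr_ge0 ?invr_ge0 ?ler0n.
move=> n; rewrite mem_pos_iota => /andP[n0 nN] an; exists (n %/ a)%N.
rewrite mem_pos_iota divn_gt0 // dvdn_leq //= (leq_trans (leq_div _ _)) //.
split => //; first by rewrite mulnC divnK.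
by rewrite -invfM -natrM divnK.
Qed.

(** The moduli are among the at most [log_2 N] prime factors of [b - a]. *)
Lemma sum_inv_primes_congr (R : realFieldType) (N y a b : nat) :
  (0 < y)%N -> (a <= N)%N -> (b <= N)%N -> a != b ->
  \sum_(q < N.+1 | [&& prime q, (y < q)%N & (a == b %[mod q])%N]) (q%:R^-1 : R)
    <= (trunc_log 2 N)%:R / y%:R.
Proof.
move=> y0; wlog ab : a b / (a < b)%N => [hw aN bN ab|aN bN _].
  have := ab; rewrite neq_ltn => /orP[|] lab; first exact: hw.
  by under eq_bigl do rewrite [(_ == _ %[mod _])%N]eq_sym; apply: hw => //; rewrite eq_sym.
have d0 : (0 < b - a)%N by rewrite subn_gt0.
apply: le_trans (_ : \sum_(q <- primes (b - a)) (y%:R^-1 : R) <= _); last first.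
  rewrite big_const_seq count_predT iter_addr addr0 -[leLHS]mulr_natl.
  rewrite ler_wpM2r ?invr_ge0 ?ler0n // ler_nat omega_log //.
  by rewrite d0 (leq_trans (leq_subr _ _)).
rewrite -(big_mkord (fun q => [&& prime q, (y < q)%N & (a == b %[mod q])%N])
           (fun q => q%:R^-1 : R)).
apply: (@ler_sum_cover _ _ _ _ _ _ _ _ _ id); first exact: iota_uniq.
  by move=> q _ _; rewrite invr_ge0 ler0n.
move=> q _ /and3P[pq yq abq]; exists q; split => //.
  by rewrite mem_primes pq d0 -eqn_mod_dvd ?(ltnW ab) // eq_sym.
have q0 : (0 < q)%N by exact: ltn_trans y0 yq.
by rewrite lef_pV2 ?posrE ?ltr0n // ler_nat ltnW.
Qed.

Lemma sum_inv_primes_le (R : realFieldType) (N : nat) (P : pred nat) :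
  \sum_(q < N.+1 | prime q && P q) (q%:R^-1 : R) <= harm R N.
Proof.
rewrite -(big_mkord (fun q => prime q && P q) (fun q => q%:R^-1 : R)) /harm /hmass.
apply: (@ler_sum_cover _ _ _ _ _ _ _ _ _ id); first exact: iota_uniq.
  by move=> q _ _; rewrite invr_ge0 ler0n.
move=> q; rewrite mem_index_iota => qN /andP[/prime_gt0 q0 _]; exists q; split => //.
by rewrite mem_index_iota q0.
Qed.

Lemma sum_pos_ord (R : realFieldType) (N : nat) (P : pred nat) (F : nat -> R) :
  \sum_(1 <= n < N.+1 | P n) F n = \sum_(n < N.+1 | (0 < n)%N && P n) F n.
Proof.
by rewrite -(big_mkord (fun n => (0 < n)%N && P n)) [RHS]big_ltn_cond //= [in RHS]big_nat_cond
  [in LHS]big_nat_cond; apply: eq_bigl => n; case: n => //= n; rewrite andbA.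
Qed.

Lemma card_family_const (L : nat) (T : finType) (D : pred T) :
  #|family (fun _ : 'I_L => D)| = (#|D| ^ L)%N.
Proof. by rewrite -[in RHS](card_ord L); exact: card_ffun_on. Qed.

(** Stands for one of the two cofactors [n1], [n2] of an entangled number, together with its
    parts of the witnesses. *)
Definition marked (N L : nat) : finType := ('I_N.+1 * {ffun 'I_L -> 'I_N.+1})%type.

Definition marked_ok (N E L : nat) (a : marked N L) : bool :=
  (0 < a.1)%N && [forall i, (a.2 i %| a.1)%N && (E <= a.2 i)%N].

(** The factor [tau ^- L] makes up for the number of ways to mark [L] divisors. *)
Definition marked_weight (R : realFieldType) (N E L : nat) (a : marked N L) : R :=
  if marked_ok E a then (a.1%:R * (tau a.1)%:R ^+ L)^-1 else 0.

Lemma marked_weight_ge0 (R : realFieldType) (N E L : nat) (a : marked N L) :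
  0 <= marked_weight R E a.
Proof.
by rewrite /marked_weight; case: ifP => // _; rewrite invr_ge0 mulr_ge0 ?exprn_ge0 ?ler0n.
Qed.

Lemma sum_marked_weight (R : realFieldType) (N E L : nat) (P : pred nat) :
  \sum_(a : marked N L | P a.1) marked_weight R E a
    <= \sum_(1 <= n < N.+1 | P n) n%:R^-1.
Proof.
rewrite sum_pos_ord.
have -> : \sum_(a : marked N L | P a.1) marked_weight R E a =
    \sum_(n < N.+1 | P n) \sum_(e : {ffun 'I_L -> 'I_N.+1}) marked_weight R E (n, e).
  by rewrite pair_big_dep; apply: eq_big => [[n e]|[n e]] //=; rewrite andbT.
rewrite [leLHS]big_mkcond [leRHS]big_mkcond; apply: ler_sum => n _.
case: (P n); last by rewrite andbF.
rewrite andbT; case: posnP => [n0|n0].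
  by rewrite big1 // => e _; rewrite /marked_weight /marked_ok /= n0.
have t0 : 0 < n%:R * (tau n)%:R ^+ L :> R.
  by rewrite mulr_gt0 ?exprn_gt0 ?ltr0n // tau_gt0.
pose D := fun _ : 'I_L => [pred a : 'I_N.+1 | (a %| n)%N].
apply: le_trans (_ : \sum_(e in family D) (n%:R * (tau n)%:R ^+ L)^-1 <= _).
  rewrite [leRHS]big_mkcond; apply: ler_sum => e _.
  rewrite /marked_weight; case: ifP => [|_]; last by case: ifP => // _; rewrite invr_ge0 ltW.
  move=> /andP[_ /forallP ok]; rewrite ifT //.
  by apply/familyP => i; rewrite inE; case/andP: (ok i).
rewrite sumr_const card_family_const.
have cD : (#|[pred a : 'I_N.+1 | (a %| n)%N]| <= tau n)%N.
  rewrite cardE -(size_map val); apply: uniq_leq_size.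
    by rewrite map_inj_uniq ?enum_uniq //; exact: val_inj.
  by move=> _ /mapP[a + ->]; rewrite mem_enum inE -dvdn_divisors.
rewrite -[leLHS]mulr_natr invfM -mulrA ler_piMr ?invr_ge0 ?ler0n //.
rewrite mulrC ler_pdivrMr ?mul1r ?exprn_gt0 ?ltr0n ?tau_gt0 //.
by rewrite natrX lerXn2r ?nnegrE ?ler0n // ler_nat.
Qed.

(** Both [f] and [f'] are inverse to [e * g] modulo [m]. *)
Lemma modn_inverse_unique (m e f e' f' g : nat) :
  (e * f * g = 1 %[mod m])%N -> (e' * f' * g = 1 %[mod m])%N -> (e = e' %[mod m])%N ->
  (f = f' %[mod m])%N.
Proof.
move=> h1 h2 ee.
rewrite -[in LHS](muln1 f) -modnMmr -h2 modnMmr.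
rewrite -[in RHS](mul1n f') -[RHS]modnMml -h1 modnMml.
rewrite -mulnA -[in RHS]mulnA mulnC -!mulnA -modnMml -ee modnMml; congr (_ %% _)%N; lia.
Qed.

Lemma tau_prod_primes (L : nat) (p : 'I_L -> nat) :
  (forall i, prime (p i)) -> (tau (\prod_i p i) <= 2 ^ L)%N.
Proof.
move=> pp; rewrite -[X in (2 ^ X)%N](card_ord L) -sum1_card.
have : (0 < \prod_i p i)%N && (tau (\prod_i p i) <= 2 ^ (\sum_(i < L) 1))%N; last by case/andP.
elim/big_rec2: _ => // i a b _ /andP[b0 tb]; rewrite muln_gt0 b0 prime_gt0 //=.
rewrite expnS; apply: leq_trans (tauM _ b0) _; first exact: prime_gt0.
by rewrite tau_prime // leq_mul2l tb.
Qed.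

Lemma sum_marked_weight_eq (R : realFieldType) (N E L c : nat) (i : 'I_L) : (0 < c)%N ->
  \sum_(a : marked N L | a.2 i == c :> nat) marked_weight R E a <= harm R N / c%:R.
Proof.
move=> c0; apply: le_trans (sum_multiples_inv R N c0).
apply: le_trans (sum_marked_weight R N E L (fun n => c %| n)%N).
rewrite [leLHS]big_mkcond [leRHS]big_mkcond; apply: ler_sum => a _.
case: eqP => [ac|_]; last by case: ifP => // _; exact: marked_weight_ge0.
case: ifP => // /negP nd; rewrite /marked_weight; case: ifP => // /andP[_ /forallP /(_ i)].
by rewrite ac => /andP[/nd].
Qed.

(** Marks are at least [E], so two marked numbers rarely agree in a coordinate, which costs
    the second term; when they differ everywhere, each coordinate contributes at most [u]. *)
Lemma sum_marked_pairs (R : realFieldType) (N E L : nat) (u : R)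
    (rho : 'I_N.+1 -> 'I_N.+1 -> R) :
  (0 < E)%N -> 0 <= u -> (forall a b, 0 <= rho a b <= harm R N) ->
  (forall a b, a != b -> rho a b <= u) ->
  \sum_(a : marked N L) \sum_(b : marked N L)
     marked_weight R E a * marked_weight R E b * \prod_i rho (a.2 i) (b.2 i)
   <= harm R N ^+ 2 * (u ^+ L + L%:R * (2 / E%:R) * harm R N ^+ L).
Proof.
move=> E0 u0 rhoH rhou; set H := harm R N; set w := @marked_weight R N E L.
have H0 : 0 <= H := harm_ge0 R N.
have w0 a : 0 <= w a := marked_weight_ge0 R E a.
have sw : \sum_a w a <= H := sum_marked_weight R N E L xpredT.
have prodle (a b : marked N L) : \prod_i rho (a.2 i) (b.2 i) <=
    u ^+ L + (\sum_(i < L) (a.2 i == b.2 i)%:R) * H ^+ L.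
  have s0 : 0 <= (\sum_(i < L) (a.2 i == b.2 i)%:R) * H ^+ L.
    by rewrite mulr_ge0 ?exprn_ge0 // sumr_ge0.
  case: (boolP [exists i, a.2 i == b.2 i]) => [/existsP[i ei]|/existsPn ne].
    have le1 : 1 <= \sum_(i < L) ((a.2 i == b.2 i)%:R : R).
      by rewrite (bigD1 i) //= ei lerDl sumr_ge0.
    have : \prod_i rho (a.2 i) (b.2 i) <= H ^+ L.
      rewrite -[X in H ^+ X](card_ord L) -prodr_const; apply: ler_prod => j _.
      exact: rhoH.
    move=> h; apply: (le_trans h); apply: le_trans (_ : (\sum_(i < L) ((a.2 i == b.2 i)%:R : R)) * H ^+ L <= _).
      by rewrite ler_peMl ?exprn_ge0.
    by rewrite lerDr exprn_ge0.
  apply: le_trans (_ : u ^+ L <= _); last by rewrite lerDl.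
  rewrite -[X in u ^+ X](card_ord L) -prodr_const; apply: ler_prod => j _.
  by have /andP[-> _] := rhoH (a.2 j) (b.2 j); rewrite rhou.
apply: le_trans (_ : \sum_(a : marked N L) \sum_(b : marked N L) (w a * w b * u ^+ L +
   \sum_(i < L) w a * w b * (a.2 i == b.2 i)%:R * H ^+ L) <= _).
  apply: ler_sum => a _; apply: ler_sum => b _.
  apply: le_trans (ler_wpM2l _ (prodle a b)) _; first by rewrite mulr_ge0.
  rewrite mulrDr lerD2l mulrA mulr_sumr mulr_suml.
  by apply: ler_sum => i _.
have -> : \sum_(a : marked N L) \sum_(b : marked N L) (w a * w b * u ^+ L +
   \sum_(i < L) w a * w b * (a.2 i == b.2 i)%:R * H ^+ L) =
   (\sum_a w a) * (\sum_a w a) * u ^+ L +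
   \sum_(i < L) (\sum_(a : marked N L) \sum_(b : marked N L | a.2 i == b.2 i) w a * w b) * H ^+ L.
  under eq_bigr do rewrite big_split /=.
  rewrite big_split /=; congr (_ + _).
    rewrite big_distrlr /= mulr_suml; apply: eq_bigr => a _.
    by rewrite mulr_suml.
  under eq_bigr do rewrite exchange_big /=.
  rewrite exchange_big /=; apply: eq_bigr => i _.
  rewrite mulr_suml; apply: eq_bigr => a _.
  rewrite mulr_suml [RHS]big_mkcond; apply: eq_bigr => b _.
  by case: eqP => _; rewrite ?mulr1 // !mulr0 mul0r.
rewrite mulrDr; apply: lerD.
  rewrite ler_wpM2r ?exprn_ge0 // expr2 ler_pM // sumr_ge0 //.
have key (i : 'I_L) : \sum_(a : marked N L) \sum_(b : marked N L | a.2 i == b.2 i) w a * w b <= H ^+ 2 * (2 / E%:R).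
  have -> : \sum_(a : marked N L) \sum_(b : marked N L | a.2 i == b.2 i) w a * w b =
     \sum_(c < N.+1) (\sum_(a : marked N L | a.2 i == c) w a) ^+ 2.
    rewrite (partition_big (fun a : marked N L => a.2 i) xpredT) //=.
    apply: eq_bigr => c _; rewrite expr2 mulr_suml; apply: eq_bigr => a /eqP ac.
    by rewrite mulr_sumr; apply: eq_bigl => b; rewrite ac eq_sym.
  apply: le_trans (_ : \sum_(c < N.+1 | (E <= c)%N) H ^+ 2 * c%:R ^- 2 <= _).
    rewrite [leRHS]big_mkcond; apply: ler_sum => c _.
    case: leqP => Ec.
      have c0 : (0 < c)%N by exact: leq_trans Ec.
      rewrite -exprVn -exprMn lerXn2r ?nnegrE ?sumr_ge0 ?divr_ge0 ?ler0n //.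
      have := sum_marked_weight_eq R N E i c0.
      by rewrite (eq_bigl (fun a : marked N L => a.2 i == c)).
    rewrite big1 ?expr0n // => a /eqP ac.
    rewrite /w /marked_weight; case: ifP => // /andP[_ /forallP /(_ i)].
    by rewrite ac => /andP[_]; rewrite leqNgt Ec.
  rewrite -mulr_sumr ler_wpM2l ?sqr_ge0 //.
  rewrite -(big_mkord (fun c => E <= c)%N (fun c => c%:R ^- 2 : R)).
  apply: le_trans (sum_inv_sqr_tail R N.+1 E0).
  apply: (@ler_sum_cover _ _ _ _ _ _ _ _ _ id); first exact: iota_uniq.
    by move=> c _ _; rewrite invr_ge0 exprn_ge0 ?ler0n.
  by move=> c; rewrite mem_index_iota => cN Ec; exists c; split; rewrite // mem_index_iota Ec.
apply: le_trans (_ : \sum_(i < L) H ^+ 2 * (2 / E%:R) * H ^+ L <= _).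
  by apply: ler_sum => i _; rewrite ler_wpM2r ?exprn_ge0.
rewrite sumr_const card_ord -[leLHS]mulr_natl le_eqVlt; apply/orP; left; apply/eqP; ring.
Qed.

Lemma leq_expl (a b L : nat) : (a <= b)%N -> (a ^ L <= b ^ L)%N.
Proof. by case: L => // L ab; rewrite leq_exp2r. Qed.

(** Sum over the data [(p, g, (n1, e), (n2, f))].  For fixed [p] and [g] the congruences match
    the residues of [e] with those of [f], so the two marked halves can be replaced by two
    copies of one half with equal residues; then the sum over [p] is restricted to common prime
    divisors of differences.  The weight [(tau n1 * tau n2) ^- L] hidden in the marked numbers
    is compensated by [T ^+ L], and [2 ^+ (L * L)] bounds the number of choices of [g]. *)
Lemma hmass_entangled (R : realFieldType) (N y E T L : nat) : (0 < y)%N -> (0 < E)%N ->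
  hmass R N (fun n => `[< entangled y E T L n >]) <=
  T%:R ^+ L * 2 ^+ (L * L) * (harm R N ^+ 2 *
    (((trunc_log 2 N)%:R / y%:R) ^+ L + L%:R * (2 / E%:R) * harm R N ^+ L)).
Proof.
move=> y0 E0; set H := harm R N; set l := trunc_log 2 N.
pose V : finType := {ffun 'I_L -> 'I_N.+1}.
pose w := @marked_weight R N E L.
have w0 a : 0 <= w a := marked_weight_ge0 R E a.
pose primes_ok (p : V) := [forall i, prime (p i) && (y < p i)%N].
pose gs_ok (p g : V) := [forall i, g i %| \prod_j (p j : nat)]%N.
pose B (p g : V) (a b : marked N L) := [&& marked_ok E a, marked_ok E b &
  [forall i, a.2 i * b.2 i * g i == 1 %[mod p i]]]%N.
pose ip (p : V) : R := \prod_i (p i)%:R^-1.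
have ip0 p : 0 <= ip p by apply: prodr_ge0 => i _; rewrite invr_ge0 ler0n.
pose Q (j : V * V * (marked N L * marked N L)) :=
  [&& primes_ok j.1.1, gs_ok j.1.1 j.1.2 & B j.1.1 j.1.2 j.2.1 j.2.2].
pose G (j : V * V * (marked N L * marked N L)) : R :=
  T%:R ^+ L * ip j.1.1 * (w j.2.1 * w j.2.2).
apply: le_trans (_ : \sum_(j | Q j) G j <= _).
  apply: (@ler_sum_cover _ _ _ _ _ _ _ _ _
    (fun j : V * V * (marked N L * marked N L) =>
       \prod_i (j.1.1 i : nat) * (j.2.1.1 * j.2.2.1))%N).
  - exact: iota_uniq.
  - by move=> j _ _; rewrite !mulr_ge0 ?exprn_ge0 ?ler0n.
  move=> n; rewrite mem_pos_iota => /andP[n0 nN] /asboolP.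
  move=> [p [e [f [g [n1 [n2 [nE tT Hp Hc]]]]]]].
  have le_n d : (d %| n)%N -> (d < N.+1)%N.
    by move=> dn; rewrite ltnS (leq_trans (dvdn_leq n0 dn)).
  have Pn : (\prod_i p i %| n)%N by rewrite nE dvdn_mulr.
  have n1n : (n1 %| n)%N by rewrite nE dvdn_mull // dvdn_mulr.
  have n2n : (n2 %| n)%N by rewrite nE dvdn_mull // dvdn_mull.
  have pP i : (p i %| \prod_j p j)%N by rewrite (bigD1 i) //= dvdn_mulr.
  have pN i := le_n _ (dvdn_trans (pP i) Pn).
  have eN i : (e i < N.+1)%N.
    by apply: le_n; case: (Hp i) => _ _ en _ _; exact: dvdn_trans n1n.
  have fN i : (f i < N.+1)%N.
    by apply: le_n; case: (Hp i) => _ _ _ fn _; exact: dvdn_trans n2n.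
  have gN i : (g i < N.+1)%N.
    by apply: le_n; case: (Hp i) => _ _ _ _ gn; exact: dvdn_trans Pn.
  pose ff (F : 'I_L -> nat) : V := [ffun i => inord (F i)].
  have ffE (F : 'I_L -> nat) : (forall i, F i < N.+1)%N -> forall i, ff F i = F i :> nat.
    by move=> FN i; rewrite ffunE inordK.
  have ffP : (\prod_i (ff p i : nat) = \prod_i p i)%N.
    by apply: eq_bigr => i _; rewrite ffE.
  have n1E : (inord n1 : 'I_N.+1) = n1 :> nat by rewrite inordK ?le_n.
  have n2E : (inord n2 : 'I_N.+1) = n2 :> nat by rewrite inordK ?le_n.
  have n10 := dvdn_gt0 n0 n1n; have n20 := dvdn_gt0 n0 n2n.
  have P0 := dvdn_gt0 n0 Pn.
  have ok1 : @marked_ok N E L (inord n1, ff e).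
    rewrite /marked_ok /= n1E n10 /=; apply/forallP => i; rewrite ffE //.
    by case: (Hp i) => _ _ -> _ _; case: (Hc i).
  have ok2 : @marked_ok N E L (inord n2, ff f).
    rewrite /marked_ok /= n2E n20 /=; apply/forallP => i; rewrite ffE //.
    by case: (Hp i) => _ _ _ -> _; case: (Hc i).
  exists (ff p, ff g, ((inord n1, ff e), (inord n2, ff f))); split.
  - exact: mem_index_enum.
  - rewrite /Q /B /= ok1 ok2 /=; apply/and3P; split.
    + by apply/forallP => i; rewrite ffE //; case: (Hp i) => -> ->.
    + by apply/forallP => i; rewrite ffP ffE //; case: (Hp i).
    + by apply/forallP => i; rewrite !ffE //; case: (Hc i) => _ _ ->.
  - by rewrite /= ffP n1E n2E.
  rewrite /G /w /marked_weight /= ok1 ok2 n1E n2E /ip.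
  have -> : \prod_i (ff p i)%:R^-1 = ((\prod_i p i)%N%:R : R)^-1.
    by rewrite prodfV -ffP natr_prod.
  rewrite {1}nE natrM natrM !invfM.
  set P' := (\prod_i p i)%N%:R^-1; set t1 := (tau n1)%:R; set t2 := (tau n2)%:R.
  have t10 : 0 < t1 :> R by rewrite ltr0n tau_gt0.
  have t20 : 0 < t2 :> R by rewrite ltr0n tau_gt0.
  have -> : T%:R ^+ L * P' * (n1%:R^-1 * (t1 ^+ L)^-1 * (n2%:R^-1 * (t2 ^+ L)^-1)) =
     P' * (n1%:R^-1 * n2%:R^-1) * (T%:R / (t1 * t2)) ^+ L :> R.
    by rewrite !exprMn exprVn exprMn invfM; ring.
  rewrite ler_peMr // ?mulr_ge0 ?invr_ge0 ?ler0n // exprn_ege1 //.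
  by rewrite ler_pdivlMr ?mulr_gt0 // mul1r -natrM ler_nat.
have -> : \sum_(j | Q j) G j = \sum_(p | primes_ok p) \sum_(g | gs_ok p g)
    T%:R ^+ L * ip p * \sum_a \sum_(b | B p g a b) w a * w b.
  rewrite pair_big_dep /=.
  under [RHS]eq_bigr do rewrite pair_big_dep /= mulr_sumr.
  by rewrite pair_big_dep /=; apply: eq_big => [[[p g] [a b]]|[[p g] [a b]] _] //=;
    rewrite /Q /= andbA.
(* Two marked numbers have the same key when their marks agree modulo each [p i]. *)
pose key (p : V) (a : marked N L) : V := [ffun i => inord (a.2 i %% p i)].
have keyE p a b : key p a = key p b -> forall i, (a.2 i = b.2 i %[mod p i])%N.
  move=> /ffunP kab i; have := kab i; rewrite !ffunE => /(congr1 val) /=.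
  have small (x : 'I_N.+1) (m : nat) : (x %% m < N.+1)%N.
    exact: leq_ltn_trans (leq_mod _ _) (ltn_ord x).
  by rewrite !inordK.
have keyI (p : V) (a b : marked N L) : (forall i, a.2 i = b.2 i %[mod p i])%N -> key p a = key p b.
  by move=> h; apply/ffunP => i; rewrite !ffunE h.
apply: le_trans (_ : \sum_(p | primes_ok p) \sum_(g | gs_ok p g)
    T%:R ^+ L * ip p * \sum_a \sum_(b | key p a == key p b) w a * w b <= _).
  apply: ler_sum => p _; apply: ler_sum => g _.
  rewrite ler_wpM2l ?mulr_ge0 ?exprn_ge0 ?ler0n //.
  apply: matched_classes_le => // a b a' b' /and3P[_ _ /forallP ab] /and3P[_ _ /forallP ab'].
    move=> /keyE k; apply: keyI => i.
    exact: (modn_inverse_unique (eqP (ab i)) (eqP (ab' i)) (k i)).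
  move=> /keyE k; apply: keyI => i.
  apply: (@modn_inverse_unique _ (b.2 i) (a.2 i) (b'.2 i) (a'.2 i) (g i)) => //.
    by rewrite [(b.2 i * _)%N]mulnC; exact/eqP.
  by rewrite [(b'.2 i * _)%N]mulnC; exact/eqP.
apply: le_trans (_ : \sum_(p | primes_ok p) T%:R ^+ L * 2 ^+ (L * L) *
   (ip p * \sum_a \sum_(b | key p a == key p b) w a * w b) <= _).
  apply: ler_sum => p /forallP pok; rewrite sumr_const -[leLHS]mulr_natr.
  set S := \sum_a _.
  have S0 : 0 <= S.
    by apply: sumr_ge0 => a _; apply: sumr_ge0 => b _; rewrite mulr_ge0.
  rewrite [leLHS](_ : _ = T%:R ^+ L * (#|gs_ok p|%:R * (ip p * S))); last by ring.
  rewrite -[leRHS]mulrA ler_wpM2l ?exprn_ge0 ?ler0n // ler_wpM2r ?mulr_ge0 //.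
  rewrite -natrX ler_nat.
  pose D := fun _ : 'I_L => [pred c : 'I_N.+1 | (c %| \prod_j (p j : nat))%N].
  have -> : #|gs_ok p| = #|family D|.
    by apply: eq_card => g; apply/forallP/familyP => h i; have := h i.
  rewrite card_family_const.
  rewrite expnM; apply: leq_expl.
  have pp i : prime (p i) by case/andP: (pok i).
  apply: leq_trans (tau_prod_primes pp).
  rewrite cardE -(size_map val); apply: uniq_leq_size.
    by rewrite map_inj_uniq ?enum_uniq //; exact: val_inj.
  move=> _ /mapP[a + ->]; rewrite mem_enum => aP; rewrite -dvdn_divisors //.
  by apply: prodn_cond_gt0 => i _; exact: prime_gt0.
rewrite -mulr_sumr ler_wpM2l ?mulr_ge0 ?exprn_ge0 ?ler0n //.
(* Summing over [p] first, the condition on the keys factors over the coordinates. *)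
pose rho (a b : 'I_N.+1) : R :=
  \sum_(q < N.+1 | [&& prime q, (y < q)%N & (a == b %[mod q])%N]) q%:R^-1.
have -> : \sum_(p | primes_ok p) ip p * (\sum_a \sum_(b | key p a == key p b) w a * w b) =
   \sum_(a : marked N L) \sum_(b : marked N L) w a * w b * \prod_i rho (a.2 i) (b.2 i).
  have prodE (a b : marked N L) : \prod_i rho (a.2 i) (b.2 i) =
      \sum_(p | primes_ok p && (key p a == key p b)) ip p.
    rewrite /rho; under eq_bigr do rewrite big_mkcond /=.
    rewrite bigA_distr_bigA [RHS]big_mkcond /=; apply: eq_bigr => p _.
    case: ifP => [/andP[/forallP pok /eqP/keyE kab]|nok].
      by apply: eq_bigr => i _; have /andP[-> ->] := pok i; rewrite kab eqxx.
    apply/eqP; rewrite prodf_seq_eq0; apply/hasP.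
    have : [exists i, ~~ [&& prime (p i), (y < p i)%N & (a.2 i == b.2 i %[mod p i])%N]].
      apply: contraFT nok; rewrite negb_exists => /forallP h.
      apply/andP; split; first by apply/forallP => i; have := h i; rewrite negbK => /and3P[-> ->].
      by apply/eqP/keyI => i; have := h i; rewrite negbK => /and3P[_ _ /eqP].
    by case/existsP => i /negbTE ni; exists i; rewrite ?mem_index_enum //= ni.
  under eq_bigr do rewrite mulr_sumr.
  rewrite exchange_big /=; apply: eq_bigr => a _.
  under eq_bigr do rewrite mulr_sumr.
  rewrite (exchange_big_dep xpredT) //=; apply: eq_bigr => b _.
  rewrite prodE mulr_sumr; apply: eq_big => // p _.
  by rewrite mulrC.
apply: sum_marked_pairs => //.
- move=> a b; apply/andP; split; first by apply: sumr_ge0 => q _; rewrite invr_ge0 ler0n.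
  exact: (sum_inv_primes_le R N (fun q => (y < q)%N && (a == b %[mod q])%N)).
- by move=> a b ab; apply: sum_inv_primes_congr => //; rewrite -ltnS ltn_ord.
Qed.

(** * Sylow numbers are chained, entangled or otherwise exceptional *)

(** Remove prime factors, all at most [z], one at a time until the interval is reached. *)
Lemma divisor_between (z E d : nat) : (0 < E)%N -> (0 < z)%N ->
  (forall p, prime p -> (p %| d)%N -> (p <= z)%N) -> (E <= d)%N ->
  exists e, [/\ (e %| d)%N, (E <= e)%N & (e <= z * E)%N].
Proof.
move=> E0 z0; have [m] := ubnP d; elim: m d => // m IH d dm pz Ed.
have d0 : (0 < d)%N by exact: leq_trans Ed.
case: (leqP d (z * E)) => [dz|zd]; first by exists d.
have d1 : (1 < d)%N by apply: leq_ltn_trans zd; rewrite muln_gt0 z0.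
have pd := pdiv_dvd d; have pp := pdiv_prime d1; set p := pdiv d in pd pp.
have pz' := pz _ pp pd.
have [|||e [ed Ee ez]] := IH (d %/ p)%N.
- by apply: (@leq_trans d); rewrite ?ltn_Pdiv ?prime_gt1 ?(ltnW d1) // -ltnS.
- move=> q pq qd; apply: pz => //; apply: (dvdn_trans qd).
  by rewrite -{2}(divnK pd) dvdn_mulr.
- rewrite leq_divRL ?prime_gt0 //; apply: leq_trans (ltnW zd).
  by rewrite mulnC leq_mul2r pz' orbT.
exists e; split => //; apply: (dvdn_trans ed).
by rewrite -{2}(divnK pd) dvdn_mulr.
Qed.

Lemma biglcm_le (L : nat) (F : 'I_L -> nat) (M : nat) :
  (forall i, 0 < F i <= M)%N ->
  (0 < \big[lcmn/1%N]_i F i)%N && (\big[lcmn/1%N]_i F i <= M ^ L)%N.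
Proof.
move=> FM; rewrite -[X in (M ^ X)%N](card_ord L) -sum1_card.
elim/big_rec2: _ => // i a b _ /andP[b0 ab]; have /andP[F0 FMi] := FM i.
rewrite lcmn_gt0 F0 b0 expnS; apply: leq_trans (leq_mul FMi ab).
by apply: dvdn_leq; rewrite ?muln_gt0 ?F0 // dvdn_lcm dvdn_mulr // dvdn_mull.
Qed.

(** Take for [n1] the lcm of mid-sized divisors of the witnesses, after removing the part
    of each witness that divides the product of the [p i].  The lcm contains a divisor at least
    [E] of each witness, but is too small to absorb all of it. *)
Lemma entangled_of_large_witnesses (n y z E T L : nat) (p d : 'I_L -> nat) :
  (0 < n)%N -> (0 < E)%N -> (0 < z)%N ->
  (forall q, prime q -> (q %| n)%N -> (q <= z)%N) ->
  (forall a, (a %| n)%N -> (tau a * tau (n %/ a) <= T)%N) ->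
  injective p ->
  (forall i, [/\ prime (p i), (y < p i)%N, (p i %| n)%N & witness (p i) (d i) n]) ->
  (forall i, z ^ L * (E * (z * E) ^ L) < d i)%N ->
  entangled y E T L n.
Proof.
move=> n0 E0 z0 nz nT injp Hp dbig.
set P := (\prod_i p i)%N.
have Pn : (P %| n)%N.
  rewrite /P -(big_map p xpredT (fun x => x)) /=.
  apply: prod_primes_dvd; first by rewrite map_inj_uniq ?index_enum_uniq.
    by apply/allP => _ /mapP[i _ ->]; case: (Hp i).
  by apply/allP => _ /mapP[i _ ->]; case: (Hp i).
have P0 := dvdn_gt0 n0 Pn.
have PzL : (P <= z ^ L)%N.
  rewrite -[X in (z ^ X)%N](card_ord L) -prod_nat_const; apply: leq_prod => i _.
  by case: (Hp i) => pp _ pn _; exact: nz.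
pose n' := (n %/ P)%N.
have nE : (n = P * n')%N by rewrite mulnC divnK.
have n'0 : (0 < n')%N by rewrite divn_gt0 // dvdn_leq.
pose g i := gcdn (d i) P; pose d' i := (d i %/ g i)%N.
have dn i : (d i %| n)%N by case: (Hp i) => _ _ _ /and3P[].
have d0 i : (0 < d i)%N := dvdn_gt0 n0 (dn i).
have g0 i : (0 < g i)%N by rewrite gcdn_gt0 d0.
have gd i : (g i %| d i)%N := dvdn_gcdl _ _.
have d'n i : (d' i %| n')%N.
  have cop : coprime (d' i) (P %/ g i).
    rewrite /coprime -(eqn_pmul2r (g0 i)) muln_gcdl mul1n.
    by rewrite /d' !divnK ?dvdn_gcdr ?dvdn_gcdl.
  rewrite -(Gauss_dvdr _ cop) -(dvdn_pmul2r (g0 i)) /d' divnK ?dvdn_gcdl //.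
  by rewrite mulnAC divnK ?dvdn_gcdr // -nE.
have d'big i : (E * (z * E) ^ L <= d' i)%N.
  rewrite leq_divRL //; apply: leq_trans (ltnW (dbig i)).
  rewrite mulnC leq_mul2r; apply/orP; right; apply: leq_trans PzL.
  by rewrite dvdn_leq // dvdn_gcdr.
have zE0 : (0 < z * E)%N by rewrite muln_gt0 z0.
have mid i : exists e, [/\ (e %| d' i)%N, (E <= e)%N & (e <= z * E)%N].
  apply: divisor_between => //.
    move=> q pq qd; apply: nz => //; apply: (dvdn_trans qd).
    by apply: (dvdn_trans (d'n i)); rewrite nE dvdn_mull.
  by apply: leq_trans (d'big i); rewrite leq_pmulr // expn_gt0 zE0.
have [m mP] := boolp.choice mid.
pose u := \big[lcmn/1%N]_i m i.
have m0 i : (0 < m i <= z * E)%N by case: (mP i) => _ Em ->; rewrite (leq_trans E0).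
have /andP[u0 uL] := biglcm_le m0.
have mu i : (m i %| u)%N by rewrite /u (bigD1 i) //= dvdn_lcml.
have un : (u %| n')%N.
  rewrite /u; apply: (big_ind (fun x => x %| n')%N) => [|a b an bn|i _]; first exact: dvd1n.
    by rewrite dvdn_lcm an.
  by case: (mP i) => md _ _; exact: dvdn_trans md (d'n i).
have e0 i : (0 < gcdn (d' i) u)%N by rewrite gcdn_gt0 u0 orbT.
exists p, (fun i => gcdn (d' i) u), (fun i => d' i %/ gcdn (d' i) u)%N, g, u, (n' %/ u)%N.
split.
- by rewrite [(u * _)%N]mulnC divnK.
- have unn : (u %| n)%N by rewrite nE dvdn_mull.
  apply: leq_trans (nT u unn); rewrite leq_mul2l; apply/orP; right; apply: dvdn_tau.
    by rewrite divn_gt0 // dvdn_leq // nE dvdn_mull.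
  by rewrite nE -muln_divA // dvdn_mull.
- move=> i; case: (Hp i) => -> -> _ _; split => //.
  + exact: dvdn_gcdr.
  + have cop : coprime (d' i %/ gcdn (d' i) u) (u %/ gcdn (d' i) u).
      rewrite /coprime -(eqn_pmul2r (e0 i)) muln_gcdl mul1n.
      by rewrite !divnK ?dvdn_gcdr ?dvdn_gcdl.
    rewrite -(Gauss_dvdr _ cop) -(dvdn_pmul2r (e0 i)) divnK ?dvdn_gcdl //.
    by rewrite mulnAC divnK ?dvdn_gcdr // mulnC divnK.
  + exact: dvdn_gcdr.
move=> i; have [md Em mz] := mP i; split.
- by apply: (leq_trans Em); apply: dvdn_leq => //; rewrite dvdn_gcd md mu.
- rewrite leq_divRL //; apply: leq_trans (d'big i).
  rewrite leq_mul2l; apply/orP; right; apply: leq_trans uL.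
  by apply: dvdn_leq => //; exact: dvdn_gcdr.
rewrite [(gcdn _ _ * _)%N]mulnC divnK ?dvdn_gcdl // /d' divnK //.
case: (Hp i) => _ _ _ /and3P[d1 _ pd]; apply/eqP.
by rewrite eqn_mod_dvd ?subn1 // ltnW.
Qed.

Lemma sylow_witness (n p : nat) : sylow_set n -> prime p -> (p %| n)%N ->
  exists d, witness p d n.
Proof.
move=> [n0 H] pp pn; have [d [dn d1 dp]] := H p pp pn.
by exists d; rewrite /witness d1 dn /= -subn1 -eqn_mod_dvd ?(ltnW d1) //; apply/eqP.
Qed.

(** The small witnesses have at most [D] prime factors above [y] each, so [D.+1 * L] primes
    with small witnesses contain [L] that form a chain; otherwise [L] witnesses are large. *)
Lemma sylow_chain_or_entangled (n y z E T L D : nat) :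
  sylow_set n -> (1 < y)%N -> (0 < E)%N -> (0 < z)%N ->
  (forall q, prime q -> (q %| n)%N -> (q <= z)%N) ->
  (forall a, (a %| n)%N -> (tau a * tau (n %/ a) <= T)%N) ->
  (z ^ L * (E * (z * E) ^ L) < y ^ D.+1)%N ->
  (D.+2 * L <= count (fun p => y < p)%N (primes n))%N ->
  chain y T L n \/ entangled y E T L n.
Proof.
move=> Sn y1 E0 z0 nz nT ZD many; set Z := (z ^ L * _)%N in ZD.
have n0 : (0 < n)%N by case: Sn.
pose s := [seq p <- primes n | (y < p)%N].
have sP p : p \in s -> [/\ prime p, (y < p)%N & (p %| n)%N].
  by rewrite mem_filter mem_primes => /andP[-> /and3P[-> _ ->]].
have us : uniq s by rewrite filter_uniq // primes_uniq.
have : forall p, exists d, p \in s -> witness p d n.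
  move=> p; case: (boolP (p \in s)) => [/sP[pp _ pn]|_]; last by exists 0%N.
  by have [d w] := sylow_witness Sn pp pn; exists d.
case/boolp.choice => dd ddP.
have tT : (tau n <= T)%N.
  by have := nT 1%N (dvd1n n); rewrite divn1 /tau /= mul1n.
pose big := [seq p <- s | (Z < dd p)%N].
have bigs p : p \in big -> p \in s /\ (Z < dd p)%N by rewrite mem_filter => /andP[-> ->].
(* At least [L] large witnesses give entanglement; otherwise the small ones suffice. *)
case: (leqP L (size big)) => [Lb|bL]; [right|left].
  have sz (i : 'I_L) : (i < size big)%N by exact: leq_trans (ltn_ord i) Lb.
  have mem (i : 'I_L) : nth 0%N big i \in big by exact: mem_nth.
  apply: (@entangled_of_large_witnesses n y z E T L (fun i => nth 0%N big i)
     (fun i => dd (nth 0%N big i))) => //.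
  - move=> i j /eqP; rewrite nth_uniq ?filter_uniq ?primes_uniq // => /eqP; exact: val_inj.
  - by move=> i; have [is_s _] := bigs _ (mem i); case: (sP _ is_s) => -> -> ->; rewrite ddP.
  - by move=> i; have [_] := bigs _ (mem i).
pose small := [seq p <- s | (dd p <= Z)%N].
have szs : (size big + size small = size s)%N.
  rewrite [size big]size_filter [size small]size_filter.
  rewrite -[RHS](count_predC (fun p => Z < dd p)%N); congr (_ + _)%N.
  by apply: eq_count => p /=; rewrite leqNgt.
have many' : (D.+2 * L <= size s)%N by rewrite size_filter.
have smalls p : p \in small -> p \in s /\ (dd p <= Z)%N by rewrite mem_filter => /andP[-> ->].
have [||q [qs qL pq]] := @greedy_independent _ (fun u v => v %| dd u)%N D L small.
- move=> u us'; have [us1 dZ] := smalls _ us'.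
  apply: (count_large_divisors y1 _ ZD); rewrite ?filter_uniq ?primes_uniq //.
    by have /and3P[d1 _ _] := ddP u us1; rewrite dZ (ltnW d1).
  by apply/allP => v /smalls[/sP[-> ->]].
- by rewrite mulSn in many'; lia.
rewrite -qL; apply: (chain_of_independent n0 tT _ _ pq).
  by apply: subseq_uniq qs _; exact: filter_uniq.
by move=> u /(mem_subseq qs)/smalls[uS _]; case: (sP _ uS) => -> -> ->; rewrite ddP.
Qed.

(** If [n] is not in one of the first three families it has few divisors, no large square
    divisor and no prime above [z]; being larger than [M] it then has more than [D.+2 * L]
    primes above [y]. *)
Lemma sylow_classification (n M y z V T E L D : nat) :
  sylow_set n -> (M < n)%N -> (1 < y)%N -> (0 < E)%N -> (0 < z)%N -> (0 < T)%N ->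
  (z ^ L * (E * (z * E) ^ L) < y ^ D.+1)%N ->
  (V ^ 2 * (y ^ trunc_log 2 T * z ^ (D.+2 * L)) <= M)%N ->
  tau_split T n \/
  [\/ square_part V n, huge_prime z n, chain y T L n | entangled y E T L n].
Proof.
move=> Sn Mn y1 E0 z0 T0 ZD VM.
have n0 : (0 < n)%N by case: Sn.
case: (boolP (tau_split T n)) => [|ntau]; first by left.
right; case: (boolP (square_part V n)) => [|nsq]; first by constructor 1.
case: (boolP (huge_prime z n)) => [|nhp]; first by constructor 2.
have nT a : (a %| n)%N -> (tau a * tau (n %/ a) < T)%N.
  move=> an; have aS : (a < n.+1)%N by rewrite ltnS dvdn_leq.
  move: ntau; rewrite /= negb_exists => /forallP /(_ (Ordinal aS)) /=.
  by rewrite an /= -ltnNge.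
have sq v : (v ^ 2 %| n)%N -> (v < V)%N.
  move=> vn; have vS : (v < n.+1)%N.
    rewrite ltnS; apply: leq_trans (dvdn_leq n0 vn).
    by case: v {vn} => // v; rewrite -mulnn leq_pmulr.
  move: nsq; rewrite /= negb_exists => /forallP /(_ (Ordinal vS)) /=.
  by rewrite vn andbT -ltnNge.
have nz q : prime q -> (q %| n)%N -> (q <= z)%N.
  move=> pq qn; rewrite leqNgt; apply/negP => zq.
  have [d w] := sylow_witness Sn pq qn.
  have qS : (q < n.+1)%N by rewrite ltnS dvdn_leq.
  have dS : (d < n.+1)%N by case/and3P: w => _ dn _; rewrite ltnS dvdn_leq.
  case/negP: nhp => /=; apply/existsP; exists (Ordinal qS); apply/existsP; exists (Ordinal dS).
  by rewrite /= zq qn w.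
have tT : (tau n < T)%N by have := nT 1%N (dvd1n n); rewrite divn1 /tau /= mul1n.
have [] // := @sylow_chain_or_entangled n y z E T L D Sn y1 E0 z0 nz.
- by move=> a /nT/ltnW.
- rewrite leqNgt; apply/negP => few.
  have := le_few_large_primes n0 (ltnW y1) z0 sq nz.
  apply/negP; rewrite -ltnNge; apply: leq_ltn_trans Mn; apply: leq_trans VM.
  rewrite leq_mul2l; apply/orP; right; apply: leq_mul.
    rewrite leq_pexp2l ?(ltnW y1) //; apply: trunc_log_max => //.
    exact: leq_trans (exp_omega_tau n0) (ltnW tT).
  by rewrite leq_pexp2l // ltnW.
- by constructor 3.
- by constructor 4.
Qed.

Definition is_sylow : pred nat := [pred n | `[< sylow_set n >]].

Lemma sylow_countE (R : realType) (x : R) : 0 <= x ->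
  sylow_count x = (\sum_(1 <= n < (Num.truncn x).+1 | is_sylow n) 1)%N.
Proof.
move=> x0; rewrite sum1_count -size_filter.
set s := [seq n <- _ | _].
have us : uniq s by rewrite filter_uniq // iota_uniq.
rewrite /sylow_count.
have -> : fset_set (sylow_upto x) = seq_fset tt s.
  apply/fsetP => n; rewrite seq_fsetE in_fset_set; last exact: finite_sylow_upto.
  rewrite mem_filter mem_pos_iota.
  apply/idP/idP => [|/andP[/asboolP Sn /andP[n0 nx]]].
    rewrite inE /= => -[Sn nx]; apply/andP; split; first exact/asboolP.
    by case: Sn => n0 _; rewrite n0 /= truncn_ge_nat.
  by rewrite inE /=; split => //; rewrite -truncn_ge_nat.
by rewrite size_seq_fset undup_id.
Qed.

Lemma count_le_bound (N M : nat) (P : pred nat) :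
  (\sum_(1 <= n < N.+1 | P n && (n <= M)) 1 <= M)%N.
Proof.
rewrite sum1_count -size_filter -[leqRHS](size_iota 1 M).
apply: uniq_leq_size; first by rewrite filter_uniq // iota_uniq.
move=> n; rewrite mem_filter mem_pos_iota mem_iota => /andP[/andP[_ nM] /andP[n0 _]].
by rewrite n0 add1n ltnS.
Qed.

Lemma sylow_count_le (R : realFieldType) (N M y z V T E L D j : nat) :
  (1 < y)%N -> (0 < E)%N -> (0 < z)%N -> (0 < T)%N -> (0 < V)%N ->
  (z ^ L * (E * (z * E) ^ L) < y ^ D.+1)%N ->
  (V ^ 2 * (y ^ trunc_log 2 T * z ^ (D.+2 * L)) <= M)%N ->
  (\sum_(1 <= n < N.+1 | is_sylow n) 1)%N%:R <=
    M%:R + N%:R * (harm R N ^+ (2 ^ j) * harm R N ^+ (2 ^ j) / T%:R ^+ j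
      + 2 / V%:R * harm R N + 2 / z.+1%:R * harm R N ^+ 2
      + harm R N * (T%:R * (trunc_log 2 N)%:R / y%:R) ^+ L
      + T%:R ^+ L * 2 ^+ (L * L) * (harm R N ^+ 2 *
          (((trunc_log 2 N)%:R / y%:R) ^+ L + L%:R * (2 / E%:R) * harm R N ^+ L))) :> R.
Proof.
move=> y1 E0 z0 T0 V0 ZD VM; set H := harm R N.
pose P1 := tau_split T; pose P2 := square_part V; pose P3 := huge_prime z.
pose P4 : pred nat := chain y T L; pose P5 : pred nat := fun n => `[< entangled y E T L n >].
pose P := predU P1 (predU P2 (predU P3 (predU P4 P5))).
apply: le_trans (_ : M%:R + N%:R * hmass R N P <= _).
  rewrite (bigID (fun n => n <= M)%N) /= natrD; apply: lerD.
    by rewrite ler_nat count_le_bound.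
  apply: le_trans (count_le_hmass R N P); rewrite ler_nat.
  rewrite [leqLHS]big_mkcond [leqRHS]big_mkcond; apply: leq_sum => n _.
  case: ifP => // /andP[/asboolP Sn]; rewrite -ltnNge => Mn.
  rewrite ifT //.
  have [h|[h|h|h|h]] := sylow_classification Sn Mn y1 E0 z0 T0 ZD VM.
  - by apply/orP; left.
  - by apply/orP; right; apply/orP; left.
  - by apply/orP; right; apply/orP; right; apply/orP; left.
  - by apply/orP; right; apply/orP; right; apply/orP; right; apply/orP; left.
  - by apply/orP; right; apply/orP; right; apply/orP; right; apply/orP; right; exact/asboolP.
rewrite lerD2l ler_wpM2l ?ler0n //.
have h1 : hmass R N P1 <= H ^+(2 ^ j) * H ^+ (2 ^ j) / T%:R ^+ j.
  by rewrite ler_pdivlMr ?exprn_gt0 ?ltr0n //; exact: hmass_tau_split.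
have h2 := hmass_square_part R N V0.
have h3 := hmass_huge_prime R N z.
have h4 := hmass_chain R N T L (ltnW y1).
have h5 := hmass_entangled R N T L (ltnW y1) E0.
apply: (le_trans (hmassU _ _ _ _)); rewrite -!addrA; apply: lerD h1 _.
apply: (le_trans (hmassU _ _ _ _)); apply: lerD h2 _.
apply: (le_trans (hmassU _ _ _ _)); apply: lerD h3 _.
by apply: (le_trans (hmassU _ _ _ _)); apply: lerD h4 h5.
Qed.

(** * A large sieve inequality *)

Lemma sum_periodic (R : realFieldType) (M q r : nat) (F : nat -> R) :
  (forall n, F (n + M)%N = F n) ->
  \sum_(0 <= n < q * M + r) F n = q%:R * \sum_(0 <= n < M) F n + \sum_(0 <= n < r) F n.
Proof.
move=> per; elim: q => [|q IH]; first by rewrite mul0n add0n mul0r add0r.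
rewrite mulSn -addnA (@big_cat_nat _ _ _ M) ?leq_addr //=.
have -> : \sum_(M <= n < M + (q * M + r)) F n = \sum_(0 <= n < q * M + r) F n.
  by rewrite -{1}(add0n M) big_addn addKn; apply: eq_bigr => n _; exact: per.
rewrite IH.
by rewrite -natr1 mulrDl mul1r addrA [_ + q%:R * _]addrC.
Qed.

(** The map from [n] to its pair of residues is a bijection from one period. *)
Lemma sum_chinese (R : realFieldType) (p q : nat) (F G : nat -> R) :
  (0 < p)%N -> (0 < q)%N -> coprime p q ->
  \sum_(0 <= n < p * q) F (n %% p)%N * G (n %% q)%N =
    (\sum_(0 <= h < p) F h) * (\sum_(0 <= h < q) G h).
Proof.
move=> p0 q0 cop; rewrite big_distrlr /=.
rewrite -(big_allpairs (F := fun ab : nat * nat => F ab.1 * G ab.2)).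
rewrite -(big_map (fun n => (n %% p, n %% q)%N) xpredT (fun ab => F ab.1 * G ab.2)).
apply: perm_big; apply: uniq_perm.
- rewrite map_inj_in_uniq ?iota_uniq // => m n; rewrite !mem_index_iota /= => mN nN [mp mq].
  have : (m == n %[mod p * q])%N by rewrite chinese_remainder // mp mq !eqxx.
  by rewrite !modn_small // => /eqP.
- by apply: allpairs_uniq; rewrite ?iota_uniq // => -[a b] [c d].
move=> [a b]; apply/mapP/allpairsP => [[n _ [-> ->]]|[[a' b'] /= [ap bq [-> ->]]]].
  by exists (n %% p, n %% q)%N; rewrite !mem_index_iota !ltn_mod.
move: ap bq; rewrite !mem_index_iota /= => ap bq.
exists (chinese p q a' b' %% (p * q))%N.
  by rewrite mem_index_iota /= ltn_mod muln_gt0 p0.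
rewrite modn_dvdm ?dvdn_mulr // modn_dvdm ?dvdn_mull //.
by rewrite chinese_modl // chinese_modr // !modn_small.
Qed.

Definition residue_mass (R : realFieldType) (N : nat) (a : nat -> R) (p h : nat) : R :=
  \sum_(0 <= n < N | (n %% p == h)%N) a n.

Definition residue_dev (R : realFieldType) (N : nat) (a : nat -> R) (p h : nat) : R :=
  residue_mass N a p h - (\sum_(0 <= n < N) a n) / p%:R.

Lemma sum_by_residue (R : realFieldType) (N p : nat) (a : nat -> R) (F : nat -> R) :
  (0 < p)%N ->
  \sum_(0 <= h < p) F h * residue_mass N a p h = \sum_(0 <= n < N) F (n %% p)%N * a n.
Proof.
move=> p0; rewrite /residue_mass.
under eq_bigr do rewrite mulr_sumr.
rewrite (exchange_big_dep xpredT) //=; apply: eq_bigr => n _.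
rewrite (big_rem (n %% p)%N) ?mem_index_iota ?ltn_mod //= eqxx big_seq_cond.
rewrite big_pred0 ?addr0 // => h; apply/negbTE/negP => /andP[].
by rewrite mem_rem_uniq ?iota_uniq // inE => /andP[/negP hn _] /eqP nh; apply: hn; rewrite nh.
Qed.

Lemma residue_dev_sum0 (R : realFieldType) (N p : nat) (a : nat -> R) : (0 < p)%N ->
  \sum_(0 <= h < p) residue_dev N a p h = 0.
Proof.
move=> p0; rewrite /residue_dev big_split /=.
have -> : \sum_(0 <= h < p) residue_mass N a p h = \sum_(0 <= n < N) a n.
  have := sum_by_residue N a (fun=> 1) p0.
  rewrite (eq_bigr (residue_mass N a p)) => [->|h _]; last by rewrite mul1r.
  by apply: eq_bigr => n _; rewrite mul1r.
rewrite big_const_nat subn0 iter_addr addr0 -[X in _ + X]mulr_natr mulNr divfK ?subrr //.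
by rewrite pnatr_eq0 -lt0n.
Qed.

Lemma sqr_sum_le (R : realFieldType) (p : nat) (F : nat -> R) :
  (\sum_(0 <= h < p) `|F h|) ^+ 2 <= p%:R * \sum_(0 <= h < p) F h ^+ 2.
Proof.
set S := \sum_(0 <= h < p) F h ^+ 2.
rewrite expr2 big_distrlr /=.
apply: le_trans (_ : \sum_(0 <= i < p) \sum_(0 <= j < p) (F i ^+ 2 + F j ^+ 2) / 2 <= _).
  apply: ler_sum => i _; apply: ler_sum => j _.
  rewrite -(real_normK (num_real (F i))) -(real_normK (num_real (F j))).
  by have := sqr_ge0 (`|F i| - `|F j|); rewrite -subr_ge0 => h; nra.
under eq_bigr do rewrite -mulr_suml big_split /= big_const_nat subn0 iter_addr addr0.
rewrite -mulr_suml big_split /= big_const_nat subn0 iter_addr addr0 sumrMnl -/S.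
rewrite -[S *+ p]mulr_natl; lra.
Qed.

(** Renyi's duality argument.  The deviations for two coprime moduli are nearly orthogonal
    as functions of [n], because each has sum zero over a period; so their correlation only
    comes from one incomplete period. *)
Lemma large_sieve (R : realFieldType) (N Y : nat) (P : seq nat) (a : nat -> R) :
  uniq P -> all prime P -> all (fun p => p <= Y)%N P ->
  \sum_(p <- P) p%:R * \sum_(0 <= h < p) residue_dev N a p h ^+ 2 <=
    (N + Y + size P * Y ^ 2)%N%:R * \sum_(0 <= n < N) a n ^+ 2.
Proof.
move=> uP pP PY; set K : R := (N + Y + size P * Y ^ 2)%N%:R.
pose D p n := residue_dev N a p (n %% p)%N.
pose v p : R := p%:R * \sum_(0 <= h < p) residue_dev N a p h ^+ 2.
pose V := \sum_(p <- P) v p.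
have prP p : p \in P -> (0 < p <= Y)%N.
  by move=> pin; rewrite prime_gt0 ?(allP pP) // (allP PY).
have v0 p : 0 <= v p by rewrite mulr_ge0 ?ler0n // sumr_ge0 // => h _; exact: sqr_ge0.
pose B n := \sum_(p <- P) p%:R * D p n.
have VE : V = \sum_(0 <= n < N) a n * B n.
  rewrite /B; under [RHS]eq_bigr do rewrite mulr_sumr.
  rewrite exchange_big /= /V [LHS]big_seq [RHS]big_seq; apply: eq_bigr => p pin.
  have /andP[p0 _] := prP p pin.
  rewrite /v; transitivity (p%:R * \sum_(0 <= h < p) residue_dev N a p h * residue_mass N a p h).
    congr (_ * _); apply/eqP; rewrite -subr_eq0 -sumrB.
    rewrite (eq_bigr (fun h => residue_dev N a p h * (- (\sum_(0 <= n < N) a n) / p%:R))).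
      by rewrite -mulr_suml residue_dev_sum0 // mul0r.
    by move=> h _; rewrite expr2 -mulrBr; congr (_ * _); rewrite /residue_dev mulNr addrC addKr.
  rewrite sum_by_residue // mulr_sumr; apply: eq_bigr => n _; rewrite /D; ring.
(* The dual inequality, by expanding the square into pairs of moduli. *)
have BB : \sum_(0 <= n < N) B n ^+ 2 <= K * V.
  have -> : \sum_(0 <= n < N) B n ^+ 2 =
     \sum_(p <- P) \sum_(q <- P) p%:R * q%:R * \sum_(0 <= n < N) D p n * D q n.
    rewrite /B; under eq_bigr do rewrite expr2 big_distrlr /=.
    rewrite exchange_big /=; apply: eq_bigr => p _.
    rewrite exchange_big /=; apply: eq_bigr => q _.
    by rewrite mulr_sumr; apply: eq_bigr => n _; ring.
  have diag p : p \in P -> p%:R * p%:R * \sum_(0 <= n < N) D p n * D p n <= (N + Y)%:R * v p.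
    move=> pin; have /andP[p0 pY] := prP p pin.
    have S0 : 0 <= \sum_(0 <= h < p) residue_dev N a p h ^+ 2.
      by apply: sumr_ge0 => h _; exact: sqr_ge0.
    have full : \sum_(0 <= n < p) D p n * D p n = \sum_(0 <= h < p) residue_dev N a p h ^+ 2.
      by rewrite big_nat [RHS]big_nat; apply: eq_bigr => h /andP[_ hp]; rewrite /D modn_small // expr2.
    rewrite {1}(divn_eq N p) sum_periodic; last by move=> n; rewrite /D modnDr.
    rewrite full.
    have part : \sum_(0 <= n < N %% p) D p n * D p n <= \sum_(0 <= h < p) residue_dev N a p h ^+ 2.
      rewrite -full [leRHS](@big_cat_nat _ _ _ (N %% p)) //=; last by rewrite ltnW // ltn_mod.
      by rewrite lerDl sumr_ge0 // => n _; rewrite -expr2 sqr_ge0.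
    apply: le_trans (_ : p%:R * p%:R * (((N %/ p)%:R + 1) * \sum_(0 <= h < p) residue_dev N a p h ^+ 2) <= _).
      by rewrite ler_wpM2l ?mulr_ge0 ?ler0n // mulrDl mul1r lerD2l.
    rewrite /v mulrA [leRHS]mulrA ler_wpM2r // natr1 -!natrM ler_nat.
    have le1 : (p * (N %/ p).+1 <= N + Y)%N.
      by rewrite mulnS addnC leq_add // mulnC leq_trunc_div.
    by rewrite -mulnA [leqRHS]mulnC leq_mul2l le1 orbT.
  have off p q : p \in P -> q \in P -> p != q ->
      p%:R * q%:R * \sum_(0 <= n < N) D p n * D q n <= (Y ^ 2)%:R * (v p / 2 + v q / 2).
    move=> pin qin pq; have /andP[p0 pY] := prP p pin; have /andP[q0 qY] := prP q qin.
    have cop : coprime p q by apply: prime_coprime_neq; rewrite ?(allP pP).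
    have pq0 : (0 < p * q)%N by rewrite muln_gt0 p0.
    rewrite {1}(divn_eq N (p * q)) sum_periodic; last first.
      by move=> n; rewrite /D -modnDmr modnMr addn0 -[((n + _) %% q)%N]modnDmr modnMl addn0.
    rewrite (sum_chinese (residue_dev N a p) (residue_dev N a q)) //.
    rewrite residue_dev_sum0 // mul0r mulr0 add0r.
    have le1 : \sum_(0 <= n < N %% (p * q)) D p n * D q n <=
       (\sum_(0 <= h < p) `|residue_dev N a p h|) * (\sum_(0 <= h < q) `|residue_dev N a q h|).
      rewrite -(sum_chinese (fun h => `|residue_dev N a p h|) (fun h => `|residue_dev N a q h|)) //.
      rewrite [leRHS](@big_cat_nat _ _ _ (N %% (p * q))) //=; last by rewrite ltnW // ltn_mod.
      apply: ler_wpDr; first by apply: sumr_ge0 => n _; rewrite mulr_ge0.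
      by apply: ler_sum => n _; rewrite -normrM ler_norm.
    have le2 : (\sum_(0 <= h < p) `|residue_dev N a p h|) *
        (\sum_(0 <= h < q) `|residue_dev N a q h|) <= v p / 2 + v q / 2.
      have := sqr_sum_le p (residue_dev N a p); have := sqr_sum_le q (residue_dev N a q).
      rewrite -/(v p) -/(v q); set A := \sum_(_ <= _ < _) _; set C := \sum_(_ <= _ < _) _.
      by have := sqr_ge0 (A - C); nra.
    apply: le_trans (ler_wpM2l _ (le_trans le1 le2)) _; first by rewrite mulr_ge0 ?ler0n.
    apply: ler_wpM2r; first by rewrite addr_ge0 // divr_ge0.
    by rewrite -natrM ler_nat -mulnn leq_mul.
  have : \sum_(p <- P) \sum_(q <- P) p%:R * q%:R * \sum_(0 <= n < N) D p n * D q n <=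
     \sum_(p <- P) ((N + Y)%:R * v p + \sum_(q <- P) (Y ^ 2)%:R * (v p / 2 + v q / 2)).
    rewrite big_seq [leRHS]big_seq; apply: ler_sum => p pin.
    rewrite (bigD1_seq p) //=; apply: lerD; first exact: diag.
    rewrite big_seq_cond.
    apply: le_trans (_ : \sum_(q <- P | (q \in P) && (q != p)) (Y ^ 2)%:R * (v p / 2 + v q / 2) <= _).
      by apply: ler_sum => q /andP[qin qp]; apply: off; rewrite // eq_sym.
    rewrite -big_seq_cond big_mkcond; apply: ler_sum => q _; case: ifP => // _.
    by rewrite mulr_ge0 ?ler0n // addr_ge0 // divr_ge0.
  move=> h; apply: (le_trans h).
  rewrite big_split /= -mulr_sumr.
  under [X in _ + X]eq_bigr do rewrite -mulr_sumr big_split /= big_const_seq count_predT iter_addr addr0.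
  rewrite -mulr_sumr big_split /= big_const_seq count_predT iter_addr addr0 sumrMnl.
  rewrite -/V.
  have -> : \sum_(i <- P) v i / 2 = V / 2 by rewrite -mulr_suml.
  rewrite -mulrnDl -splitr -[V *+ _]mulr_natl /K [in leRHS]natrD mulrDl lerD2l.
  by rewrite natrM mulrCA mulrA.
have K0 : 0 <= K by rewrite ler0n.
(* Cauchy-Schwarz for [V = \sum a * B] together with [BB], in additive form. *)
have [K00|K0'] := eqVneq K 0.
  have B0 : \sum_(0 <= n < N) B n ^+ 2 = 0.
    apply/eqP; rewrite eq_le sumr_ge0 ?andbT => [|n _]; last exact: sqr_ge0.
    by move: BB; rewrite K00 mul0r.
  have N0 : N = 0%N by apply/eqP; move/eqP: K00; rewrite /K pnatr_eq0 -addnA addn_eq0 => /andP[].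
  by rewrite -/V VE N0 !big_geq // mulr0.
have Kp : 0 < K by rewrite lt_neqAle eq_sym K0' K0.
clearbody K.
have : V <= \sum_(0 <= n < N) (K * a n ^+ 2 / 2 + B n ^+ 2 / K / 2).
  rewrite VE; apply: ler_sum => n _.
  rewrite -subr_ge0.
  have -> : K * a n ^+ 2 / 2 + B n ^+ 2 / K / 2 - a n * B n = (K * a n - B n) ^+ 2 / K / 2.
    by field.
  by rewrite !divr_ge0 ?sqr_ge0.
rewrite big_split /= -!mulr_suml -mulr_sumr.
have : (\sum_(0 <= n < N) B n ^+ 2) / K <= V by rewrite ler_pdivrMr // mulrC.
rewrite -/V; lra.
Qed.

(** * Random tuples of primes *)

Definition tuples (k B : nat) : finType := {ffun 'I_k -> 'I_B.+1}.

Definition in_box (k B : nat) (Q : 'I_k -> seq nat) : pred (tuples k B) :=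
  fun f => [forall i, (f i : nat) \in Q i].

Definition prodon (k B : nat) (D : {set 'I_k}) (f : tuples k B) : nat :=
  (\prod_(i in D) (f i : nat))%N.

(** Used to average over the coordinates in [D] with the others held fixed. *)
Definition mix (k B : nat) (D : {set 'I_k}) (h f : tuples k B) : tuples k B :=
  [ffun i => if i \in D then h i else f i].

Definition mean (R : realFieldType) (k B : nat) (Q : 'I_k -> seq nat)
    (F : tuples k B -> R) : R :=
  (\sum_(f | in_box Q f) F f) / #|in_box (B := B) Q|%:R.

Lemma card_in_box (k B : nat) (Q : 'I_k -> seq nat) :
  (forall i, uniq (Q i)) -> (forall i, all (fun q => q <= B)%N (Q i)) ->
  #|in_box (B := B) Q| = (\prod_i size (Q i))%N.
Proof.
move=> uQ QB; pose D i := [pred a : 'I_B.+1 | (a : nat) \in Q i].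
have -> : #|in_box (B := B) Q| = #|family D|.
  by apply: eq_card => f; apply/forallP/familyP => h i; have := h i.
rewrite card_family foldrE big_map big_enum /=; apply: eq_bigr => i _.
rewrite cardE -(size_map val); apply/perm_size/uniq_perm.
- by rewrite map_inj_uniq ?enum_uniq //; exact: val_inj.
- exact: uQ.
move=> q; apply/mapP/idP => [[a + ->]|qQ]; first by rewrite mem_enum.
have qB : (q < B.+1)%N by rewrite ltnS (allP (QB i)).
by exists (Ordinal qB); rewrite // mem_enum.
Qed.

Lemma mix_in_box (k B : nat) (Q : 'I_k -> seq nat) (D : {set 'I_k}) (h f : tuples k B) :
  in_box Q h -> in_box Q f -> in_box Q (mix D h f).
Proof.
by move=> /forallP hQ /forallP fQ; apply/forallP => i; rewrite ffunE; case: ifP.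
Qed.

Lemma prodon_mix (k B : nat) (D S : {set 'I_k}) (h f : tuples k B) :
  S \subset D -> prodon S (mix D h f) = prodon S h.
Proof.
by move=> /fintype.subsetP SD; apply: eq_bigr => i /SD iD; rewrite ffunE iD.
Qed.

Lemma prodon_mixC (k B : nat) (D S : {set 'I_k}) (h f : tuples k B) :
  [disjoint S & D] -> prodon S (mix D h f) = prodon S f.
Proof.
by move=> dSD; apply: eq_bigr => i iS; rewrite ffunE (disjointFr dSD iS).
Qed.

Lemma prodonU (k B : nat) (D S : {set 'I_k}) (f : tuples k B) :
  [disjoint D & S] -> prodon (D :|: S) f = (prodon D f * prodon S f)%N.
Proof.
move=> dDS; rewrite /prodon -bigU //=; apply: eq_bigl => i; by rewrite inE.
Qed.

Lemma ler_mean (R : realFieldType) (k B : nat) (Q : 'I_k -> seq nat) (F G : tuples k B -> R) :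
  (forall f, in_box Q f -> F f <= G f) -> mean Q F <= mean Q G.
Proof. by move=> FG; rewrite ler_wpM2r ?invr_ge0 ?ler0n // ler_sum. Qed.

Lemma eq_mean (R : realFieldType) (k B : nat) (Q : 'I_k -> seq nat) (F G : tuples k B -> R) :
  (forall f, in_box Q f -> F f = G f) -> mean Q F = mean Q G.
Proof. by move=> FG; rewrite /mean (eq_bigr G). Qed.

Lemma mean_const (R : realFieldType) (k B : nat) (Q : 'I_k -> seq nat) (c : R) :
  (0 < #|in_box (B := B) Q|)%N -> mean (B := B) Q (fun=> c) = c.
Proof.
by move=> Q0; rewrite /mean sumr_const -[c *+ _]mulr_natr mulfK // pnatr_eq0 -lt0n.
Qed.

Lemma meanD (R : realFieldType) (k B : nat) (Q : 'I_k -> seq nat) (F G : tuples k B -> R) :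
  mean Q (fun f => F f + G f) = mean Q F + mean Q G.
Proof. by rewrite /mean big_split mulrDl. Qed.

Lemma meanMl (R : realFieldType) (k B : nat) (Q : 'I_k -> seq nat) (c : R)
    (F : tuples k B -> R) : mean Q (fun f => c * F f) = c * mean Q F.
Proof. by rewrite /mean -mulr_sumr mulrA. Qed.

Lemma mean_sum (R : realFieldType) (k B : nat) (Q : 'I_k -> seq nat) (I : Type) (s : seq I)
    (P : pred I) (F : I -> tuples k B -> R) :
  mean Q (fun f => \sum_(i <- s | P i) F i f) = \sum_(i <- s | P i) mean Q (F i).
Proof. by rewrite /mean exchange_big mulr_suml. Qed.

Lemma mean_ge0 (R : realFieldType) (k B : nat) (Q : 'I_k -> seq nat) (F : tuples k B -> R) :
  (forall f, in_box Q f -> 0 <= F f) -> 0 <= mean Q F.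
Proof. by move=> F0; rewrite divr_ge0 ?ler0n // sumr_ge0. Qed.

Lemma mean_exchange (R : realFieldType) (k B : nat) (Q : 'I_k -> seq nat)
    (F : tuples k B -> tuples k B -> R) :
  mean Q (fun f => mean Q (F f)) = mean Q (fun h => mean Q (fun f => F f h)).
Proof. by rewrite /mean -!mulr_suml exchange_big. Qed.

(** Drawing the coordinates in [D] afresh does not change the distribution. *)
Lemma mean_mix (R : realFieldType) (k B : nat) (Q : 'I_k -> seq nat) (D : {set 'I_k})
    (F : tuples k B -> R) :
  (0 < #|in_box (B := B) Q|)%N ->
  mean Q (fun f => mean Q (fun h => F (mix D h f))) = mean Q F.
Proof.
move=> Q0; have c0 : #|in_box (B := B) Q|%:R != 0 :> R by rewrite pnatr_eq0 -lt0n.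
rewrite /mean -mulr_suml; congr (_ / _); apply: (mulIf c0); rewrite divfK //.
rewrite pair_big /=.
(* Exchanging the coordinates in [D] between [f] and [h] is an involution. *)
pose s (u : tuples k B * tuples k B) := (mix D u.2 u.1, mix D u.1 u.2).
have sK : involutive s.
  by move=> [f h]; congr (_, _); apply/ffunP => i; rewrite /s /= !ffunE; case: (i \in D).
rewrite (reindex_inj (inv_inj sK)) /=.
rewrite (eq_bigl (fun u => in_box Q u.1 && in_box Q u.2)); last first.
  move=> [f h] /=; apply/andP/andP => -[a b]; last by split; exact: mix_in_box.
  have := mix_in_box D b a; have := mix_in_box D a b.
  have /= := sK (f, h); rewrite /s /= => -[-> ->]; by split.
have E u : mix D (mix D u.1 u.2) (mix D u.2 u.1) = u.1.
  by apply/ffunP => i; rewrite !ffunE; case: (i \in D).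
under eq_bigr do rewrite E.
rewrite -(pair_big (fun f => in_box Q f) (fun h => in_box Q h) (fun f _ => F f)) /=.
rewrite mulr_suml; apply: eq_bigr => f _.
by rewrite sumr_const -[LHS]mulr_natr.
Qed.

(** By unique factorisation the tuple [f] is determined up to the order of its entries, and an
    entry can only move to a position with the same block index. *)
Lemma fibre_prodon (k B m n : nat) (Q : 'I_k -> seq nat) (blk : 'I_k -> nat)
    (D : {set 'I_k}) :
  (forall i, uniq (Q i)) -> (forall i, all (fun q => q <= B)%N (Q i)) ->
  (forall i, all prime (Q i)) ->
  (forall i j q, q \in Q i -> q \in Q j -> blk i = blk j) ->
  (forall i, #|[set j in D | blk j == blk i]| <= m)%N ->
  (#|[pred f : tuples k B | in_box Q f && (prodon D f == n)]| * \prod_(i in D) size (Q i)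
     <= m ^ #|D| * #|in_box (B := B) Q|)%N.
Proof.
move=> uQ QB pQ dQ cD.
case: (pickP [pred f : tuples k B | in_box Q f && (prodon D f == n)]) => [f0|]; last first.
  by move=> e; rewrite (eq_card e) card0 mul0n.
move=> /andP[f0Q /eqP f0n].
pose C i := [pred a : 'I_B.+1 | if i \in D then a \in [seq f0 j | j in [set j in D | blk j == blk i]]
                                else (a : nat) \in Q i].
have sub : (#|[pred f : tuples k B | in_box Q f && (prodon D f == n)]| <= #|family C|)%N.
  apply/subset_leq_card/fintype.subsetP => f /andP[fQ /eqP fn].
  apply/familyP => i; rewrite inE.
  have fi : (f i : nat) \in Q i by have /forallP := fQ.
  case: ifP => // iD.
  have pf : prime (f i) by exact: (allP (pQ i)).
  have : (f i %| prodon D f0)%N by rewrite f0n -fn /prodon (bigD1 i) //= dvdn_mulr.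
  rewrite /prodon Euclid_dvd_prod // big_has_cond => /hasP[j _ /andP[jD dj]].
  have f0j : (f0 j : nat) \in Q j by have /forallP := f0Q.
  have pf0 : prime (f0 j) by exact: (allP (pQ j)).
  have e : f i = f0 j by apply: val_inj; apply/eqP; rewrite -dvdn_prime2.
  rewrite e; apply: fintype.image_f; rewrite inE jD /=.
  by apply/eqP; apply: (dQ j i (f i)) => //; rewrite e.
apply: leq_trans (leq_mul sub (leqnn _)) _.
rewrite (card_in_box uQ QB) card_family foldrE big_map big_enum /=.
rewrite (bigID (mem D)) /= [X in (_ <= _ * X)%N](bigID (mem D)) /=.
have h1 : (\prod_(i in D) #|C i| <= m ^ #|D|)%N.
  rewrite -prod_nat_const; apply: leq_prod => i iD.
  apply: leq_trans (cD i); rewrite /C /=.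
  rewrite (eq_card (B := mem [seq f0 j | j in [set j in D | blk j == blk i]])).
    exact: leq_image_card.
  by move=> a; rewrite !inE iD.
have h2 : (\prod_(i | i \notin D) #|C i| <= \prod_(i | i \notin D) size (Q i))%N.
  apply: leq_prod => i iD; rewrite cardE -(size_map val); apply: uniq_leq_size.
    by rewrite map_inj_uniq ?enum_uniq //; exact: val_inj.
  by move=> _ /mapP[a + ->]; rewrite mem_enum inE (negbTE iD).
by rewrite -mulnA; apply: leq_mul => //; rewrite mulnC leq_mul2l h2 orbT.
Qed.

(** * Equidistribution of products of random primes *)

Lemma Fp_natr_eq (p m n : nat) : prime p ->
  ((m%:R : 'F_p) == n%:R) = (m == n %[mod p])%N.
Proof.
move=> pp; apply/eqP/eqP => [e|e].
  by rewrite -!(val_Fp_nat pp) e.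
by apply: val_inj; rewrite /= !(val_Fp_nat pp).
Qed.

Lemma sum_Fp (R : realFieldType) (p : nat) (F : 'F_p -> R) : prime p ->
  \sum_(g : 'F_p) F g = \sum_(0 <= h < p) F h%:R.
Proof.
move=> pp; rewrite -[X in \sum_(0 <= _ < X) _](Fp_cast pp) big_mkord.
by apply: eq_bigr => g _; rewrite natr_Zp.
Qed.

Lemma sum_indicator (R : realFieldType) (T : finType) (A P : pred T) :
  \sum_(x | A x) ((P x)%:R : R) = #|[pred x | A x && P x]|%:R.
Proof.
rewrite -sum1_card natr_sum [RHS]big_mkcondr /=.
by apply: eq_bigr => x _; case: (P x).
Qed.

Definition residue_prob (R : realFieldType) (k B : nat) (Q : 'I_k -> seq nat)
    (D : {set 'I_k}) (p : nat) (g : 'F_p) : R :=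
  mean (B := B) Q (fun f => ((prodon D f)%:R == g)%:R).

(** The chi-square distance from the uniform distribution on ['F_p]. *)
Definition chi2 (R : realFieldType) (k B : nat) (Q : 'I_k -> seq nat)
    (D : {set 'I_k}) (p : nat) : R :=
  p%:R * \sum_(g : 'F_p) (residue_prob R B Q D g - p%:R^-1) ^+ 2.

(** The large sieve applied to the distribution of the integer [prodon D f]: it has total mass
    one and no atom is large, because an integer has few factorisations. *)
Lemma sum_chi2 (R : realFieldType) (k B N Y : nat) (Q : 'I_k -> seq nat) (D : {set 'I_k}) :
  (0 < #|in_box (B := B) Q|)%N ->
  (forall i, uniq (Q i)) -> (forall i, all (fun q => q <= B)%N (Q i)) ->
  (forall i, all prime (Q i)) ->
  (forall f : tuples k B, in_box Q f -> (prodon D f <= N)%N) ->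
  \sum_(p <- [seq p <- iota 0 Y.+1 | prime p]) chi2 R B Q D p <=
    (N.+1 + Y + Y.+1 * Y ^ 2)%N%:R * ((#|D| ^ #|D|)%N%:R / (\prod_(i in D) size (Q i))%N%:R).
Proof.
move=> Q0 uQ QB pQ DN.
have c0 : 0 < #|in_box (B := B) Q|%:R :> R by rewrite ltr0n.
pose a n : R := mean (B := B) Q (fun f => (prodon D f == n)%:R).
have a0 n : 0 <= a n by apply: mean_ge0 => f _; rewrite ler0n.
have sumP (P : pred nat) : \sum_(0 <= n < N.+1 | P n) a n =
    mean (B := B) Q (fun f => (P (prodon D f))%:R).
  rewrite -mean_sum; apply: eq_mean => f /DN fN.
  rewrite (eq_bigr (fun n => if n == prodon D f then 1 else 0)) => [|n _]; last first.
    by rewrite eq_sym; case: eqP.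
  rewrite -big_mkcondr /= big_mkcond (bigD1_seq (prodon D f)) ?mem_index_iota ?iota_uniq //=.
  rewrite eqxx andbT big1 ?addr0; first by case: (P _).
  by move=> n nf; rewrite (negbTE nf) andbF.
have suma : \sum_(0 <= n < N.+1) a n = 1 by rewrite sumP mean_const.
pose M : R := (#|D| ^ #|D|)%N%:R / (\prod_(i in D) size (Q i))%N%:R.
have sz0 : (0 < \prod_(i in D) size (Q i))%N.
  move: Q0; rewrite (card_in_box uQ QB) (bigID (mem D)) /= muln_gt0.
  by case/andP.
have aM n : a n <= M.
  rewrite /a /mean /M ler_pdivrMr // mulrAC ler_pdivlMr ?ltr0n //.
  rewrite sum_indicator -!natrM ler_nat; apply: (@fibre_prodon k B #|D| n Q (fun=> 0%N) D) => //.
  by move=> i; apply: subset_leq_card; apply/fintype.subsetP => j; rewrite inE => /andP[].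
have sqa : \sum_(0 <= n < N.+1) a n ^+ 2 <= M.
  rewrite -[M]mulr1 -suma mulr_sumr; apply: ler_sum => n _.
  by rewrite expr2 ler_wpM2r.
set Pl := [seq p <- _ | _].
have uPl : uniq Pl by rewrite filter_uniq // iota_uniq.
have pPl : all prime Pl by exact: filter_all.
have YPl : all (fun p => p <= Y)%N Pl.
  by apply/allP => p; rewrite mem_filter mem_iota => /andP[_ /andP[_]].
have := large_sieve N.+1 a uPl pPl YPl.
have -> : \sum_(p <- Pl) p%:R * \sum_(0 <= h < p) residue_dev N.+1 a p h ^+ 2 =
   \sum_(p <- Pl) chi2 R B Q D p.
  rewrite big_seq [RHS]big_seq; apply: eq_bigr => p /(allP pPl) pp.
  rewrite /chi2 sum_Fp //; congr (_ * _); rewrite big_nat [RHS]big_nat.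
  apply: eq_bigr => h /andP[_ hp].
  rewrite /residue_dev suma div1r; congr ((_ - _) ^+ 2).
  rewrite /residue_mass sumP; apply: eq_mean => f _.
  by rewrite Fp_natr_eq // (modn_small hp).
move=> h; apply: (le_trans h); apply: ler_pM => //.
  by apply: sumr_ge0 => n _; exact: sqr_ge0.
rewrite ler_nat leq_add2l leq_mul2r; apply/orP; right.
by rewrite size_filter (leq_trans (count_size _ _)) // size_iota.
Qed.

Lemma residue_prob_ge0 (R : realFieldType) (k B : nat) (Q : 'I_k -> seq nat)
    (D : {set 'I_k}) (p : nat) (g : 'F_p) : 0 <= residue_prob R B Q D g.
Proof. by apply: mean_ge0 => f _; rewrite ler0n. Qed.

Lemma sum_residue_prob (R : realFieldType) (k B : nat) (Q : 'I_k -> seq nat)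
    (D : {set 'I_k}) (p : nat) (G : 'F_p -> R) :
  \sum_(g : 'F_p) residue_prob R B Q D g * G g =
  mean (B := B) Q (fun f => G (prodon D f)%:R).
Proof.
rewrite /residue_prob.
transitivity (\sum_(g : 'F_p) mean (B := B) Q (fun f => G g * ((prodon D f)%:R == g)%:R)).
  by apply: eq_bigr => g _; rewrite meanMl mulrC.
rewrite -mean_sum; apply: eq_mean => f _.
rewrite (bigD1 (prodon D f)%:R) //= eqxx mulr1 big1 ?addr0 // => g gN.
by rewrite eq_sym (negbTE gN) mulr0.
Qed.

(** The law of the product is a multiplicative convolution of two laws, so its deviation
    from [1 / p] at [w] is bounded by Cauchy-Schwarz through the two chi-square distances.  The
    residue zero is left out of the convolution; this costs the term [1 / p]. *)
Lemma product_prob_le (R : realFieldType) (k B p : nat) (Q : 'I_k -> seq nat)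
    (D1 D2 : {set 'I_k}) (eta : R) (w : 'F_p) :
  (0 < #|in_box (B := B) Q|)%N -> prime p -> [disjoint D1 & D2] ->
  chi2 R B Q D1 p <= eta -> chi2 R B Q D2 p <= eta -> w != 0 ->
  residue_prob R B Q (D1 :|: D2) w <= (1 + p%:R^-1 + eta) / p%:R.
Proof.
move=> Q0 pp dD c1 c2 w0.
have p0 : 0 < p%:R :> R by rewrite ltr0n prime_gt0.
pose mu1 := @residue_prob R k B Q D1 p; pose mu2 := @residue_prob R k B Q D2 p.
have tot D : \sum_(g : 'F_p) residue_prob R B Q D g = 1.
  have := sum_residue_prob B Q D (fun _ : 'F_p => 1 : R).
  rewrite mean_const //; under eq_bigr do rewrite mulr1; by [].
have e1 : residue_prob R B Q (D1 :|: D2) w = \sum_(g : 'F_p | g != 0) mu1 (w / g) * mu2 g.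
  rewrite /residue_prob -(mean_mix D1) //.
  rewrite [RHS]big_mkcond /=.
  rewrite (eq_bigr (fun g => residue_prob R B Q D2 g * (if g != 0 then mu1 (w / g) else 0))); last first.
    by move=> g _; case: ifP => _; rewrite ?mulr0 // mulrC.
  rewrite sum_residue_prob.
  apply: eq_mean => f _; case: ifPn => [g0|/negPn/eqP g0].
    apply: eq_mean => h _; rewrite prodonU // prodon_mix // prodon_mixC; last first.
      by rewrite disjoint_sym.
    by rewrite natrM; congr (nat_of_bool _)%:R; apply/eqP/eqP => [<-|->]; rewrite ?mulfK ?divfK.
  rewrite -[RHS](mean_const 0 Q0); apply: eq_mean => h _.
  rewrite prodonU // prodon_mix // prodon_mixC; last by rewrite disjoint_sym.
  by rewrite natrM g0 mulr0 eq_sym (negbTE w0).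
rewrite e1; pose A : R := p%:R^-1.
have A0 : 0 < A by rewrite invr_gt0.
pose d1 g := mu1 g - A; pose d2 g := mu2 g - A.
have nn1 g : 0 <= mu1 g := residue_prob_ge0 _ _ _ _ _.
have nn2 g : 0 <= mu2 g := residue_prob_ge0 _ _ _ _ _.
have cardFp : \sum_(g : 'F_p) A = 1.
  by rewrite sum_Fp // big_const_nat subn0 iter_addr addr0 -[A *+ p]mulr_natr mulVf // gt_eqF.
have cardFp0 : \sum_(g : 'F_p | g != 0) A ^+ 2 = A - A ^+ 2.
  have e : \sum_(g : 'F_p) A ^+ 2 = A.
    by under eq_bigr do rewrite expr2; rewrite -mulr_suml cardFp mul1r.
  by rewrite -{2}e [in RHS](bigD1 0) //= addrC addrK.
have sumd1 : \sum_(g : 'F_p) d1 g = 0 by rewrite sumrB cardFp tot subrr.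
have sumd2 : \sum_(g : 'F_p) d2 g = 0 by rewrite sumrB cardFp tot subrr.
have reidx (F : 'F_p -> R) : \sum_(g : 'F_p | g != 0) F (w / g) = \sum_(g : 'F_p | g != 0) F g.
  rewrite [RHS](reindex_onto (fun g => w / g) (fun g => w / g)) /=; last first.
    by move=> g g0; rewrite invf_div mulrCA mulfV ?mulr1.
  apply: eq_bigl => g; rewrite invf_div mulf_eq0 invr_eq0 (negbTE w0) /=.
  case: (eqVneq g 0) => [->|g0] //=.
  by rewrite mulrCA mulfV ?mulr1 ?eqxx.
have n1 : \sum_(g : 'F_p | g != 0) d1 (w / g) <= A.
  rewrite reidx; move: sumd1; rewrite (bigD1 0) //= => /eqP; rewrite addr_eq0 eq_sym.
  by rewrite eqr_oppLR => /eqP->; rewrite /d1 opprB lerBlDr lerDl.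
have n2 : \sum_(g : 'F_p | g != 0) d2 g <= A.
  move: sumd2; rewrite (bigD1 0) //= => /eqP; rewrite addr_eq0 eq_sym.
  by rewrite eqr_oppLR => /eqP->; rewrite /d2 opprB lerBlDr lerDl.
have q1 : p%:R * \sum_(g : 'F_p | g != 0) d1 g ^+ 2 <= eta.
  apply: le_trans c1; rewrite /chi2 ler_wpM2l ?(ltW p0) // [leRHS](bigID (fun g => g != 0)) /=.
  by rewrite lerDl sumr_ge0 // => g _; exact: sqr_ge0.
have q2 : p%:R * \sum_(g : 'F_p | g != 0) d2 g ^+ 2 <= eta.
  apply: le_trans c2; rewrite /chi2 ler_wpM2l ?(ltW p0) // [leRHS](bigID (fun g => g != 0)) /=.
  by rewrite lerDl sumr_ge0 // => g _; exact: sqr_ge0.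
(* Expand [(A + d1) * (A + d2)] and bound the product [d1 * d2] by half the sum of squares. *)
apply: le_trans (_ : \sum_(g : 'F_p | g != 0)
   (A ^+ 2 + A * d1 (w / g) + A * d2 g + (d1 (w / g) ^+ 2 / 2 + d2 g ^+ 2 / 2)) <= _).
  apply: ler_sum => g _.
  have -> : mu1 (w / g) = A + d1 (w / g) by rewrite /d1 addrC subrK.
  have -> : mu2 g = A + d2 g by rewrite /d2 addrC subrK.
  by have := sqr_ge0 (d1 (w / g) - d2 g); move: (d1 _) (d2 _) => x y h; nra.
rewrite !big_split /= cardFp0 -!mulr_sumr -!mulr_suml (reidx (fun g => d1 g ^+ 2)).
rewrite -/A.
move: q1 q2; set S1 := \sum_(g | _) d1 g ^+ 2; set S2 := \sum_(g | _) d2 g ^+ 2 => q1 q2.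
have s1 : S1 <= eta * A by rewrite ler_pdivlMr // mulrC.
have s2 : S2 <= eta * A by rewrite ler_pdivlMr // mulrC.
move: n1 n2; set N1 := \sum_(g | _) d1 (w / g); set N2 := \sum_(g | _) d2 g => n1 n2.
have m1 : A * N1 <= A * A by rewrite ler_wpM2l // ltW.
have m2 : A * N2 <= A * A by rewrite ler_wpM2l // ltW.
rewrite expr2; nra.
Qed.

(** * Subset products reach almost every residue *)

Lemma exists_subset_card (T : finType) (A : {set T}) (n : nat) : (n <= #|A|)%N ->
  exists2 D : {set T}, D \subset A & #|D| = n.
Proof.
move=> nA; exists [set x in take n (enum A)].
  by apply/fintype.subsetP => x; rewrite inE => /mem_take; rewrite mem_enum.
rewrite cardsE; have /card_uniqP -> : uniq (take n (enum A)) by rewrite take_uniq ?enum_uniq.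
by rewrite size_takel // -cardE.
Qed.

Lemma exists_two_quads (T : finType) (A : {set T}) : (8 <= #|A|)%N ->
  exists D1 D2 : {set T}, [/\ #|D1| = 4%N, #|D2| = 4%N, [disjoint D1 & D2] & D1 :|: D2 \subset A].
Proof.
move=> A8; have [|D1 D1A c1] := @exists_subset_card T A 4; first exact: leq_trans A8.
have c : (4 <= #|A :\: D1|)%N.
  by rewrite cardsD (finset.setIidPr D1A) c1 leq_subRL // (leq_trans _ A8).
have [D2 D2A c2] := exists_subset_card c.
exists D1, D2; split => //.
  rewrite disjoint_sym finset.disjoints_subset; apply: fintype.subset_trans D2A _.
  by rewrite finset.setDE finset.subsetIr.
rewrite finset.subUset D1A /=; exact: fintype.subset_trans D2A (finset.subsetDl _ _).
Qed.

Definition equidistributed (R : realFieldType) (k B : nat) (Q : 'I_k -> seq nat)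
    (eta : R) (p : nat) : Prop :=
  forall D : {set 'I_k}, #|D| = 4%N -> chi2 R B Q D p <= eta.

(** Condition on everything outside eight elements of [S] that are not in [T]: the
    product over [T] is then fixed and the one over [S] is an independent product of
    two quadruples times a constant. *)
Lemma octet_prob_le (R : realFieldType) (k B p : nat) (Q : 'I_k -> seq nat) (eta : R)
    (S T : {set 'I_k}) :
  (0 < #|in_box (B := B) Q|)%N -> prime p -> equidistributed B Q eta p -> 0 <= eta ->
  (8 <= #|S :\: T|)%N ->
  mean (B := B) Q (fun f => (((prodon S f)%:R == (prodon T f)%:R :> 'F_p) &&
      ((prodon S f)%:R != 0 :> 'F_p))%:R) <= (1 + p%:R^-1 + eta) / p%:R :> R.
Proof.
move=> Q0 pp eqd eta0 /exists_two_quads[D1 [D2 [c1 c2 dD DA]]].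
set D := D1 :|: D2 in DA.
have DS : D \subset S by apply: fintype.subset_trans DA _; exact: finset.subsetDl.
have DT : [disjoint T & D].
  rewrite disjoint_sym finset.disjoints_subset; apply: fintype.subset_trans DA _.
  by rewrite finset.setDE finset.subsetIr.
have b0 : 0 <= (1 + p%:R^-1 + eta) / p%:R.
  by rewrite divr_ge0 ?ler0n // !addr_ge0 // ?invr_ge0 ?ler0n.
have SE : S = D :|: (S :\: D) by rewrite finset.setUC -[LHS](finset.setID S D) (finset.setIidPr DS) finset.setUC.
have dDS : [disjoint D & S :\: D].
  by rewrite disjoint_sym finset.disjoints_subset finset.setDE finset.subsetIr.
rewrite -(mean_mix D) // -[leRHS](mean_const (B := B) (Q := Q)) //.
apply: ler_mean => f _.
set u : 'F_p := (prodon (S :\: D) f)%:R; set v : 'F_p := (prodon T f)%:R.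
have E h : ((prodon S (mix D h f))%:R == (prodon T (mix D h f))%:R :> 'F_p) &&
      ((prodon S (mix D h f))%:R != 0 :> 'F_p) =
    ((prodon D h)%:R * u == v) && ((prodon D h)%:R * u != 0).
  rewrite {1 2}SE prodonU // natrM (prodon_mix _ _ (subxx D)).
  by rewrite (prodon_mixC _ _ DT) prodon_mixC // disjoint_sym.
under eq_mean do rewrite E.
have [vu|vu] := boolP ((v != 0) && (u != 0)).
  case/andP: vu => v0 u0.
  have w0 : v / u != 0 by rewrite mulf_neq0 ?invr_eq0.
  apply: le_trans (product_prob_le Q0 pp dD (eqd D1 c1) (eqd D2 c2) w0).
  rewrite /residue_prob; apply: ler_mean => h _; rewrite ler_nat.
  case: eqP => [<-|_] //=; rewrite mulfK // eqxx; by case: (_ != 0).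
apply: le_trans b0; rewrite -[leRHS](mean_const (B := B) (Q := Q) 0) //.
apply: ler_mean => h _; case: eqP => //= uv.
move: vu; rewrite negb_and !negbK; case/orP => /eqP e; first by rewrite uv e eqxx.
by rewrite e mulr0 eqxx.
Qed.

Lemma bin_le_exp (n m : nat) : ('C(n, m) <= n ^ m)%N.
Proof.
have h : (n ^_ m <= n ^ m)%N.
  elim: m n => [|m IH] n //; case: n => [|n]; first by rewrite ffact0n.
  rewrite ffactSS expnS leq_mul2l /=; apply: leq_trans (IH n) _.
  exact: leq_expl.
by apply: leq_trans h; rewrite -bin_ffact leq_pmulr // fact_gt0.
Qed.

Lemma card_small_sets (k n : nat) : (#|[set D : {set 'I_k} | #|D| <= n]| <= k.+1 ^ n)%N.
Proof.
have -> : #|[set D : {set 'I_k} | (#|D| <= n)%N]| = (\sum_(i < n.+1) 'C(k, i))%N.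
  rewrite -sum1_card (partition_big (fun D : {set 'I_k} => inord #|D| : 'I_n.+1) xpredT) //=.
  apply: eq_bigr => i _; rewrite sum1_card -[X in 'C(X, _)](card_ord k) -card_draws.
  apply: eq_card => D; rewrite !inE; apply/andP/eqP => [[Dn /eqP <-]|Di].
    by move: Dn; rewrite inE => Dn; rewrite inordK.
  by split; rewrite ?inE Di ?inord_val // -ltnS ltn_ord.
rewrite -[k.+1]add1n expnDn; apply: leq_sum => i _.
rewrite exp1n mul1n; apply: leq_trans (bin_le_exp _ _) _.
by rewrite leq_pmull // bin_gt0 -ltnS.
Qed.

(** A pair is determined by its first set and the symmetric difference. *)
Lemma card_close_pairs (k : nat) (O : {set 'I_k}) :
  (#|[pred u : {set 'I_k} * {set 'I_k} | [&& u.1 \in powerset O, u.2 \in powerset O,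
      #|u.1 :\: u.2| <= 7 & #|u.2 :\: u.1| <= 7]]| <= 2 ^ #|O| * k.+1 ^ 14)%N.
Proof.
pose F (u : {set 'I_k} * {set 'I_k}) := (u.1, (u.1 :\: u.2) :|: (u.2 :\: u.1)).
have injF : injective F.
  move=> [A1 A2] [B1 B2] [-> e]; congr (_, _); apply/setP => x.
  move/setP: e => /(_ x); rewrite !inE; case: (x \in B1); case: (x \in A2); by case: (x \in B2).
rewrite -(fintype.card_image injF) -card_powerset.
apply: leq_trans (leq_mul (leqnn _) (card_small_sets k 14)).
rewrite -cardsX; apply: subset_leq_card; apply/fintype.subsetP => _ /fintype.imageP[[A1 A2] + ->].
rewrite inE /= => /and4P[A1O A2O h1 h2]; rewrite !inE /= -powersetE A1O /=.
by apply: leq_trans (leq_card_setU _ _) _; rewrite (leq_trans (leq_add h1 h2)).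
Qed.

Definition hits (k B : nat) (O : {set 'I_k}) (p : nat) (f : tuples k B) (g : 'F_p) : nat :=
  #|[set S in powerset O | (prodon S f)%:R == g]|.

(** Expand the square into pairs of subsets.  Pairs at large distance are nearly
    independent by [octet_prob_le]; the others are few. *)
Lemma second_moment (R : realFieldType) (k B p : nat) (Q : 'I_k -> seq nat) (eta : R)
    (O : {set 'I_k}) :
  (0 < #|in_box (B := B) Q|)%N -> prime p -> equidistributed B Q eta p -> 0 <= eta ->
  mean (B := B) Q (fun f => \sum_(g : 'F_p | g != 0) (hits O f g)%:R ^+ 2) <=
    (2 ^ #|O| * k.+1 ^ 14)%N%:R + (2 ^ #|O|)%N%:R ^+ 2 * ((1 + p%:R^-1 + eta) / p%:R) :> R.
Proof.
move=> Q0 pp eqd eta0; set b := (_ / _).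
have b0 : 0 <= b.
  by rewrite divr_ge0 ?ler0n // !addr_ge0 // ?invr_ge0 ?ler0n.
pose ev (u : {set 'I_k} * {set 'I_k}) (f : tuples k B) : R :=
  (((prodon u.1 f)%:R == (prodon u.2 f)%:R :> 'F_p) && ((prodon u.1 f)%:R != 0 :> 'F_p))%:R.
have E f : \sum_(g : 'F_p | g != 0) (hits O f g)%:R ^+ 2 =
   \sum_(u : {set 'I_k} * {set 'I_k} | (u.1 \in powerset O) && (u.2 \in powerset O)) ev u f.
  have hE g : (hits O f g)%:R = \sum_(S in powerset O) ((prodon S f)%:R == g)%:R :> R.
    by rewrite sum_indicator; congr (_%:R); apply: eq_card => S; rewrite !inE.
  transitivity (\sum_(g : 'F_p | g != 0) \sum_(S in powerset O) \sum_(T in powerset O)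
      (((prodon S f)%:R == g)%:R * ((prodon T f)%:R == g)%:R : R)).
    by apply: eq_bigr => g _; rewrite hE expr2 big_distrlr.
  rewrite exchange_big /=.
  under eq_bigr do rewrite exchange_big /=.
  rewrite pair_big /=; apply: eq_bigr => -[S T] _; rewrite /ev /=.
  rewrite big_mkcond (bigD1 (prodon S f)%:R) //= big1 ?addr0 => [|g gN].
    by rewrite eqxx mul1r; case: ((prodon S f)%:R != 0 :> 'F_p); rewrite ?andbT ?andbF // eq_sym.
  by case: ifP => // _; rewrite eq_sym (negbTE gN) mul0r.
under eq_mean do rewrite E.
rewrite mean_sum (bigID (fun u => (#|u.1 :\: u.2| <= 7) && (#|u.2 :\: u.1| <= 7))%N) /=.
apply: lerD.
  apply: le_trans (_ : \sum_(u : {set 'I_k} * {set 'I_k} | [&& u.1 \in powerset O, u.2 \in powerset O,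
      #|u.1 :\: u.2| <= 7 & #|u.2 :\: u.1| <= 7]%N) 1 <= _).
    rewrite (eq_bigl (fun u : {set 'I_k} * {set 'I_k} => [&& u.1 \in powerset O, u.2 \in powerset O,
      #|u.1 :\: u.2| <= 7 & #|u.2 :\: u.1| <= 7]%N)); last by move=> u; rewrite -andbA.
    apply: ler_sum => u _; rewrite -[leRHS](mean_const (B := B) 1 Q0); apply: ler_mean => f _.
    by rewrite /ev; case: (_ && _).
  by rewrite sumr_const ler_nat; exact: card_close_pairs.
apply: le_trans (_ : \sum_(u : {set 'I_k} * {set 'I_k} | (u.1 \in powerset O) && (u.2 \in powerset O)) b <= _).
  rewrite big_mkcondr; apply: ler_sum => -[S T] _ /=; case: ifP => // far.
  have : (8 <= #|S :\: T|)%N || (8 <= #|T :\: S|)%N.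
    by move: far; rewrite negb_and -!ltnNge.
  case/orP => h; first exact: octet_prob_le.
  apply: (le_trans _ (octet_prob_le Q0 pp eqd eta0 h)).
  apply: ler_mean => f _; rewrite /ev /= [X in X && _]eq_sym ler_nat.
  by case: eqP => //= ->.
rewrite -(pair_big (fun S => S \in powerset O) (fun T => T \in powerset O) (fun _ _ => b)) /=.
by rewrite !sumr_const card_powerset -!mulrnA -[leLHS]mulr_natl natrM.
Qed.

Definition missed (k B : nat) (O : {set 'I_k}) (p : nat) (f : tuples k B) : nat :=
  #|[set g : 'F_p | (g != 0) && (hits O f g == 0)%N]|.

Lemma sum_hits (R : realFieldType) (k B p : nat) (O : {set 'I_k}) (f : tuples k B) :
  (prodon O f)%:R != 0 :> 'F_p ->
  \sum_(g : 'F_p | g != 0) (hits O f g)%:R = (2 ^ #|O|)%N%:R :> R.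
Proof.
move=> nz.
have -> : (2 ^ #|O|)%N%:R = \sum_(S in powerset O) 1 :> R.
  by rewrite sumr_const card_powerset.
have hE (g : 'F_p) : (hits O f g)%:R = \sum_(S in powerset O) ((prodon S f)%:R == g)%:R :> R.
  by rewrite sum_indicator; congr (_%:R); apply: eq_card => S; rewrite !inE.
under eq_bigr do rewrite hE.
rewrite (exchange_big_dep (mem (powerset O))) //=; apply: eq_bigr => S SO.
have Snz : (prodon S f)%:R != 0 :> 'F_p.
  apply: contraNneq nz => S0.
  move: SO; rewrite powersetE => SO.
  have -> : O = S :|: (O :\: S).
    by rewrite finset.setUC -[LHS](finset.setID O S) (finset.setIidPr SO) finset.setUC.
  rewrite prodonU ?natrM ?S0 ?mul0r //.
  by rewrite disjoint_sym finset.disjoints_subset finset.setDE finset.subsetIr.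
rewrite (bigD1 ((prodon S f)%:R : 'F_p)) //= ?Snz ?SO // eqxx big1 ?addr0 // => g /andP[_ gN].
by rewrite eq_sym (negbTE gN).
Qed.

(** The right-hand side is at least the sum over the nonzero residues of the squared deviation
    of [hits] from [2 ^ #|O| / p], and a missed residue deviates by all of this. *)
Lemma missed_le (R : realFieldType) (k B p : nat) (O : {set 'I_k}) (f : tuples k B) :
  prime p -> (prodon O f)%:R != 0 :> 'F_p ->
  (missed O p f)%:R * ((2 ^ #|O|)%N%:R / p%:R) ^+ 2 <=
    \sum_(g : 'F_p | g != 0) (hits O f g)%:R ^+ 2 - (2 ^ #|O|)%N%:R ^+ 2 / p%:R :> R.
Proof.
move=> pp nz; set W : R := (2 ^ #|O|)%N%:R.
have p0 : 0 < p%:R :> R by rewrite ltr0n prime_gt0.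
have sH := sum_hits R nz; rewrite -/W in sH.
apply: le_trans (_ : \sum_(g : 'F_p | g != 0) ((hits O f g)%:R - W / p%:R) ^+ 2 <= _).
  rewrite [leRHS](bigID (fun g : 'F_p => hits O f g == 0)%N) /=.
  apply: le_trans (_ : \sum_(g : 'F_p | (g != 0) && (hits O f g == 0)%N) (W / p%:R) ^+ 2 <= _).
    by rewrite sumr_const -[leRHS]mulr_natl /missed cardsE.
  rewrite (eq_bigr (fun g : 'F_p => ((hits O f g)%:R - W / p%:R) ^+ 2)); last first.
    by move=> g /andP[_ /eqP->]; rewrite sub0r sqrrN.
  by rewrite lerDl sumr_ge0 // => g _; exact: sqr_ge0.
have c0 : \sum_(g : 'F_p | g != 0) (W / p%:R) ^+ 2 = (p%:R - 1) * (W / p%:R) ^+ 2.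
  have : \sum_(g : 'F_p) (W / p%:R) ^+ 2 = p%:R * (W / p%:R) ^+ 2.
    by rewrite sum_Fp // big_const_nat subn0 iter_addr addr0 -[LHS]mulr_natl.
  by rewrite (bigD1 0) //= mulrBl mul1r => <-; rewrite addrC addrK.
under eq_bigr do rewrite sqrrB.
rewrite big_split sumrB /= c0 sumrMnl -mulr_suml sH.
have -> : (p%:R - 1) * (W / p%:R) ^+ 2 = W ^+ 2 / p%:R - (W / p%:R) ^+ 2 by field; lra.
have := sqr_ge0 (W / p%:R).
have -> : W * (W / p%:R) = W ^+ 2 / p%:R by rewrite mulrA -expr2.
by rewrite mulr2n; lra.
Qed.

Lemma mean_missed (R : realFieldType) (k B p : nat) (Q : 'I_k -> seq nat) (eta zeta : R)
    (O : {set 'I_k}) :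
  (0 < #|in_box (B := B) Q|)%N -> prime p -> equidistributed B Q eta p -> 0 <= eta ->
  mean (B := B) Q (fun f => ((prodon O f)%:R == 0 :> 'F_p)%:R) <= zeta ->
  mean (B := B) Q (fun f => ((prodon O f)%:R != 0 :> 'F_p)%:R * (missed O p f)%:R) <=
    p%:R ^+ 2 * (k.+1 ^ 14)%N%:R / (2 ^ #|O|)%N%:R + p%:R * (p%:R^-1 + eta + zeta).
Proof.
move=> Q0 pp eqd eta0 hz; set W : R := (2 ^ #|O|)%N%:R.
have p0 : 0 < p%:R :> R by rewrite ltr0n prime_gt0.
have W0 : 0 < W by rewrite ltr0n expn_gt0.
have sm := second_moment O Q0 pp eqd eta0; rewrite natrM -/W in sm.
have h : mean (B := B) Q (fun f => (W / p%:R) ^+ 2 *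
      (((prodon O f)%:R != 0 :> 'F_p)%:R * (missed O p f)%:R)) <=
    mean (B := B) Q (fun f => \sum_(g : 'F_p | g != 0) (hits O f g)%:R ^+ 2 +
      (- (W ^+ 2 / p%:R) + W ^+ 2 / p%:R * ((prodon O f)%:R == 0 :> 'F_p)%:R)).
  apply: ler_mean => f _; case: eqP => [_|/eqP nz] /=.
    by rewrite mul0r !mulr0 mulr1 addNr addr0 sumr_ge0 // => g _; exact: sqr_ge0.
  by rewrite mul1r mulr0 addr0 mulrC; exact: missed_le.
rewrite meanMl meanD meanD mean_const // meanMl in h.
set m := mean Q _ in h *.
have {h} : (W / p%:R) ^+ 2 * m <= W * (k.+1 ^ 14)%N%:R +
    W ^+ 2 * ((1 + p%:R^-1 + eta) / p%:R) - W ^+ 2 / p%:R + W ^+ 2 / p%:R * zeta.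
  apply: (le_trans h); rewrite -[leRHS]addrA; apply: lerD sm _; rewrite lerD2l.
  by rewrite ler_wpM2l // divr_ge0 ?sqr_ge0 // ltW.
have WP : 0 < (W / p%:R) ^+ 2 by rewrite exprn_gt0 // divr_gt0.
rewrite -ler_pdivlMl // => h; apply: (le_trans h); rewrite le_eqVlt; apply/orP; left.
by apply/eqP; move: (k.+1 ^ 14)%N%:R => X; field; rewrite !gt_eqF.
Qed.

(** The eight coordinates in [G] are kept apart from [O] so that their product is
    independent of the set of residues hit from [O]. *)
Definition fails (k B : nat) (O G : {set 'I_k}) (p : nat) (f : tuples k B) : bool :=
  [forall S in powerset O, (prodon G f * prodon S f)%:R != 1 :> 'F_p].

(** Failure means that the inverse of the product over [G] is missed from [O] (or that a
    factor vanishes modulo [p]); the coordinates in [G] being independent of [O], each missed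
    residue is hit with probability about [1 / p]. *)
Lemma mean_fails (R : realFieldType) (k B p : nat) (Q : 'I_k -> seq nat) (eta zeta : R)
    (O D1 D2 : {set 'I_k}) :
  (0 < #|in_box (B := B) Q|)%N -> prime p -> equidistributed B Q eta p -> 0 <= eta ->
  #|D1| = 4%N -> #|D2| = 4%N -> [disjoint D1 & D2] -> [disjoint O & D1 :|: D2] ->
  mean (B := B) Q (fun f => ((prodon O f * prodon (D1 :|: D2) f)%:R == 0 :> 'F_p)%:R) <= zeta ->
  mean (B := B) Q (fun f => (fails O (D1 :|: D2) p f)%:R) <=
    zeta + (p%:R ^+ 2 * (k.+1 ^ 14)%N%:R / (2 ^ #|O|)%N%:R + p%:R * (p%:R^-1 + eta + zeta)) *
      ((1 + p%:R^-1 + eta) / p%:R).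
Proof.
move=> Q0 pp eqd eta0 c1 c2 dD dO hz; set G := D1 :|: D2 in dO hz *.
set b := (1 + p%:R^-1 + eta) / p%:R.
have b0 : 0 <= b.
  by rewrite divr_ge0 ?ler0n // !addr_ge0 // ?invr_ge0 ?ler0n.
pose miss (f : tuples k B) (g : 'F_p) := (g != 0) && (hits O f g == 0)%N.
pose bad (f : tuples k B) : R := (((prodon O f)%:R != 0 :> 'F_p) &&
   ((prodon G f)%:R != 0 :> 'F_p) && miss f (prodon G f)%:R^-1)%:R.
apply: le_trans (_ : mean (B := B) Q (fun f =>
   ((prodon O f * prodon G f)%:R == 0 :> 'F_p)%:R + bad f) <= _).
  apply: ler_mean => f _; rewrite natrM mulf_eq0 /bad.
  case: (eqVneq ((prodon O f)%:R : 'F_p) 0) => [_|Onz] /=.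
    by apply: ler_wpDr; rewrite ?ler0n // lern1 leq_b1.
  case: (eqVneq ((prodon G f)%:R : 'F_p) 0) => [_|Gnz] /=.
    by apply: ler_wpDr; rewrite ?ler0n // lern1 leq_b1.
  rewrite add0r; case: (boolP (fails O G p f)) => [fl|_]; last by rewrite ler0n.
  rewrite /miss invr_eq0 Gnz /= ler_nat lt0b; apply/eqP; apply: eq_card0 => S.
  apply/negP; rewrite finset.inE => /andP[SO /eqP e].
  by move/forallP: fl => /(_ S) /implyP /(_ SO) /eqP; apply; rewrite natrM e mulfV.
rewrite meanD; apply: (lerD hz).
apply: le_trans (_ : mean (B := B) Q (fun f =>
   ((prodon O f)%:R != 0 :> 'F_p)%:R * (missed O p f)%:R * b) <= _); last first.
  rewrite -(eq_mean (F := fun f => b * (((prodon O f)%:R != 0 :> 'F_p)%:R * (missed O p f)%:R))).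
    rewrite meanMl mulrC; apply: ler_wpM2r => //.
    apply: mean_missed => //; apply: le_trans hz; apply: ler_mean => f _.
    by rewrite ler_nat natrM mulf_eq0; case: eqP.
  by move=> f _; rewrite mulrC.
rewrite -(mean_mix G) //; apply: ler_mean => f _.
have mixO h : prodon O (mix G h f) = prodon O f by rewrite prodon_mixC.
have missE h : miss (mix G h f) =1 miss f.
  move=> g; rewrite /miss; congr (_ && (_ == _)); apply: eq_card => S; rewrite !inE.
  case SO: (S \subset O) => //=.
  rewrite prodon_mixC //; exact: disjointWl SO dO.
have [ Oz | Onz ] := eqVneq ((prodon O f)%:R : 'F_p) 0.
  rewrite !mul0r -[leRHS](mean_const (B := B) 0 Q0); apply: ler_mean => h _.
  by rewrite /bad mixO Oz eqxx.
rewrite mul1r.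
apply: le_trans (_ : mean (B := B) Q (fun h => \sum_(g : 'F_p | miss f g)
   ((prodon G h)%:R == g^-1 :> 'F_p)%:R) <= _).
  apply: ler_mean => h _; rewrite /bad (prodon_mix _ _ (subxx G)) missE.
  case: (boolP (_ && _)) => [/andP[_ mg]|_]; last by apply: sumr_ge0 => g _; rewrite ler0n.
  by rewrite (bigD1 ((prodon G h)%:R^-1 : 'F_p)) //= invrK eqxx lerDl sumr_ge0 // => g _; rewrite ler0n.
rewrite mean_sum; apply: le_trans (_ : \sum_(g : 'F_p | miss f g) b <= _).
  apply: ler_sum => g /andP[g0 _].
  apply: (product_prob_le Q0 pp dD (eqd D1 c1) (eqd D2 c2)).
  by rewrite invr_eq0.
by rewrite sumr_const -[leLHS]mulr_natl /missed cardsE.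
Qed.

(** * Most products of random primes are Sylow numbers *)

Lemma mean_eq_prime (R : realFieldType) (k B p q : nat) (Q : 'I_k -> seq nat) (i : 'I_k) :
  (0 < #|in_box (B := B) Q|)%N ->
  (forall i, uniq (Q i)) -> (forall i, all (fun r => r <= B)%N (Q i)) ->
  (forall i, all prime (Q i)) -> (0 < q)%N -> (q <= size (Q i))%N ->
  mean (B := B) Q (fun f => ((f i : nat) == p)%:R) <= q%:R^-1 :> R.
Proof.
move=> Q0 uQ QB pQ q0 qQ.
have Qp : (0 < size (Q i))%N by exact: leq_trans qQ.
have := @fibre_prodon k B 1 p Q (fun=> 0%N) [set i] uQ QB pQ (fun _ _ _ _ _ => erefl).
rewrite big_set1 cards1 exp1n mul1n => h.
apply: le_trans (_ : (size (Q i))%:R^-1 <= _); last by rewrite lef_pV2 ?posrE ?ltr0n ?ler_nat.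
rewrite /mean sum_indicator ler_pdivrMr ?ltr0n // mulrC ler_pdivlMr ?ltr0n //.
rewrite -natrM ler_nat; apply: leq_trans (h _).
  rewrite leq_mul2r; apply/orP; right; apply: subset_leq_card; apply/fintype.subsetP => f.
  by rewrite !inE /prodon big_set1.
move=> j; apply: leq_trans (_ : #|[set i]| <= 1)%N; last by rewrite cards1.
by apply: subset_leq_card; apply/fintype.subsetP => x; rewrite inE => /andP[].
Qed.

Definition equidistributedb (R : realFieldType) (k B : nat) (Q : 'I_k -> seq nat)
    (eta : R) (p : nat) : bool :=
  [forall D : {set 'I_k}, (#|D| == 4)%N ==> (chi2 R B Q D p <= eta)].

Lemma equidistributedP (R : realFieldType) (k B : nat) (Q : 'I_k -> seq nat) (eta : R) (p : nat) :
  reflect (equidistributed B Q eta p) (equidistributedb B Q eta p).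
Proof.
apply: (iffP forallP) => h D; last by apply/implyP => /eqP; exact: h.
by move=> /eqP c; exact: (implyP (h D)).
Qed.

(** Markov's inequality for the sum of the chi-square distances over all moduli and all
    quadruples. *)
Lemma card_exceptional (R : realFieldType) (k Y q : nat) (Q : 'I_k -> seq nat) (eta : R) :
  (0 < #|in_box (B := Y) Q|)%N -> (1 < Y)%N ->
  (forall i, uniq (Q i)) -> (forall i, all (fun r => r <= Y)%N (Q i)) ->
  (forall i, all prime (Q i)) -> (0 < q)%N -> (forall i, q <= size (Q i))%N -> 0 < eta ->
  (count (fun p => ~~ equidistributedb Y Q eta p) [seq p <- iota 0 Y.+1 | prime p])%:R * eta <=
    (k ^ 4)%N%:R * ((4 * Y ^ 4)%N%:R * 256 / q%:R ^+ 4) :> R.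
Proof.
move=> Q0 Y1 uQ QB pQ q0 qQ eta0; set Pl := [seq p <- _ | _].
have chi0 D p : 0 <= chi2 R Y Q D p.
  by rewrite mulr_ge0 ?ler0n // sumr_ge0 // => g _; exact: sqr_ge0.
apply: le_trans (_ : \sum_(p <- Pl) \sum_(D : {set 'I_k} | (#|D| == 4)%N) chi2 R Y Q D p <= _).
  rewrite -sum1_count natr_sum mulr_suml big_mkcond; apply: ler_sum => p _.
  case: ifPn => [|_]; last by apply: sumr_ge0 => D _.
  rewrite /equidistributedb negb_forall => /existsP[D].
  rewrite negb_imply -ltNge mul1r => /andP[cD lt].
  by rewrite (bigD1 D) //=; apply: ler_wpDr (ltW lt); apply: sumr_ge0.
rewrite exchange_big /=.
apply: le_trans (_ : \sum_(D : {set 'I_k} | (#|D| == 4)%N) ((4 * Y ^ 4)%N%:R * 256 / q%:R ^+ 4) <= _); last first.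
  rewrite sumr_const -[leLHS]mulr_natl ler_wpM2r ?divr_ge0 ?mulr_ge0 ?exprn_ge0 ?ler0n //.
  rewrite ler_nat; apply: leq_trans (bin_le_exp k 4).
  by rewrite -[X in 'C(X, _)](card_ord k) -card_draws cardsE.
(* Products of four primes up to [Y] are at most [Y ^ 4], the length used in the sieve. *)
apply: ler_sum => D /eqP cD.
apply: le_trans (@sum_chi2 R k Y (Y ^ 4) Y Q D Q0 uQ QB pQ _) _.
  move=> f fQ; rewrite -cD -prod_nat_const; apply: leq_prod => i _.
  by rewrite -ltnS ltn_ord.
rewrite cD -mulrA; apply: ler_pM; rewrite ?ler0n ?divr_ge0 ?ler0n //.
  rewrite ler_nat; have Y0 := ltnW Y1.
  have : (1 <= Y ^ 3)%N by rewrite expn_gt0 Y0.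
  have : (Y ^ 3 * 2 <= Y ^ 4)%N by rewrite [leqRHS]expnSr leq_mul2l Y1 orbT.
  have : (Y ^ 2 * 2 <= Y ^ 3)%N by rewrite [leqRHS]expnSr leq_mul2l Y1 orbT.
  have : (Y ^ 1 * 2 <= Y ^ 2)%N by rewrite [leqRHS]expnSr leq_mul2l Y1 orbT.
  rewrite expn1 mulSn -expnS.
  by move: (Y ^ 2)%N (Y ^ 3)%N (Y ^ 4)%N => a b c; lia.
rewrite [(4 ^ 4)%N%:R](_ : _ = 256) //.
rewrite ler_wpM2l ?ler0n // lef_pV2 ?posrE ?ltr0n ?exprn_gt0 ?ltr0n //; last first.
  by apply: prodn_cond_gt0 => i _; apply: leq_trans q0 (qQ i).
rewrite -natrX ler_nat -cD -prod_nat_const; apply: leq_prod => i _; exact: qQ.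
Qed.

Lemma zero_prodon (k B p : nat) (Q : 'I_k -> seq nat) (D : {set 'I_k}) (f : tuples k B) :
  prime p -> (forall i, all prime (Q i)) -> in_box Q f ->
  ((prodon D f)%:R == 0 :> 'F_p) = [exists j in D, (f j : nat) == p].
Proof.
move=> pp pQ fQ; rewrite -[0](mulr0n 1) Fp_natr_eq // mod0n -/(dvdn _ _).
rewrite /prodon Euclid_dvd_prod // big_has_cond.
apply/hasP/existsP => [[j _ /andP[jD pj]]|[j /andP[jD /eqP fj]]].
  exists j; rewrite jD eq_sym -dvdn_prime2 //.
  by apply: (allP (pQ j)); have /forallP := fQ.
by exists j; rewrite ?mem_index_enum //= jD fj dvdnn.
Qed.

Lemma mean_zero_prodon (R : realFieldType) (k B p q : nat) (Q : 'I_k -> seq nat)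
    (D : {set 'I_k}) :
  (0 < #|in_box (B := B) Q|)%N ->
  (forall i, uniq (Q i)) -> (forall i, all (fun r => r <= B)%N (Q i)) ->
  (forall i, all prime (Q i)) -> (0 < q)%N -> (forall i, q <= size (Q i))%N -> prime p ->
  mean (B := B) Q (fun f => ((prodon D f)%:R == 0 :> 'F_p)%:R) <= k%:R / q%:R :> R.
Proof.
move=> Q0 uQ QB pQ q0 qQ pp.
apply: le_trans (_ : mean (B := B) Q (fun f => \sum_(j < k) ((f j : nat) == p)%:R) <= _).
  apply: ler_mean => f fQ; rewrite (zero_prodon D pp pQ fQ).
  case: existsP => [[j /andP[_ fj]]|_]; last by apply: sumr_ge0 => j _; rewrite ler0n.
  by rewrite (bigD1 j) //= fj lerDl; apply: sumr_ge0 => i _; rewrite ler0n.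
rewrite mean_sum; apply: le_trans (_ : \sum_(j < k) (q%:R^-1 : R) <= _).
  by apply: ler_sum => j _; exact: mean_eq_prime.
by rewrite sumr_const card_ord -[leLHS]mulr_natl.
Qed.

(** If position [i] does not fail, the product over [G i] and some subset of [O i] is the
    divisor required at the prime [f i]. *)
Lemma sylow_of_not_fails (k B : nat) (Q : 'I_k -> seq nat) (f : tuples k B)
    (O G : 'I_k -> {set 'I_k}) :
  (forall i, all prime (Q i)) -> in_box Q f ->
  (forall i, (0 < #|G i|)%N /\ [disjoint O i & G i]) ->
  (forall i, ~~ fails (O i) (G i) (f i) f) -> is_sylow (\prod_i (f i : nat))%N.
Proof.
move=> pQ fQ HG ok; have pf i : prime (f i).
  by apply: (allP (pQ i)); have /forallP := fQ.
apply/asboolP; split; first by apply: prodn_cond_gt0 => i _; exact: prime_gt0.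
move=> p pp; rewrite Euclid_dvd_prod // big_has_cond => /hasP[i _ /andP[_ pi]].
have pE : p = f i :> nat by apply/eqP; rewrite -dvdn_prime2.
have [G0 dOG] := HG i.
move: (ok i); rewrite -pE negb_forall => /existsP[S]; rewrite negb_imply powersetE negbK.
case/andP=> SO /eqP e; exists (prodon (G i :|: S) f).
have dGS : [disjoint G i & S] by rewrite disjoint_sym; exact: disjointWl SO dOG.
split.
- rewrite [X in (_ %| X)%N](_ : _ = prodon finset.setT f); last by apply: eq_bigl => j; rewrite finset.inE.
  rewrite -(finset.setUCr (G i :|: S)) [X in (_ %| X)%N]prodonU ?dvdn_mulr //.
  by rewrite finset.disjoints_subset finset.setCK.
- move/card_gt0P: G0 => [j jG].
  have jGS : j \in G i :|: S by rewrite finset.inE jG.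
  apply: (@leq_trans (f j)); first by rewrite prime_gt1.
  rewrite /prodon (bigD1 j) //= leq_pmulr //.
  by apply: prodn_cond_gt0 => l _; exact: prime_gt0.
rewrite prodonU //; apply/eqP; rewrite -Fp_natr_eq //.
by rewrite e mulr1n.
Qed.

Lemma witness_positions (k : nat) (i : 'I_k) : (9 <= k)%N ->
  exists D1 D2 : {set 'I_k}, [/\ #|D1| = 4%N, #|D2| = 4%N, [disjoint D1 & D2],
    i \notin D1 :|: D2 & #|~: (i |: (D1 :|: D2))| = (k - 9)%N].
Proof.
move=> k9; have [|D1 [D2 [c1 c2 dD sub]]] := @exists_two_quads _ (~: [set i]).
  by rewrite cardsC1 card_ord; case: k i k9.
have iN : i \notin D1 :|: D2.
  by apply/negP => /(fintype.subsetP sub); rewrite !finset.inE eqxx.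
exists D1, D2; split => //.
rewrite cardsCs finset.setCK card_ord cardsU1 iN cardsU (eqP (_ : D1 :&: D2 == finset.set0)).
  by rewrite cards0 c1 c2.
by rewrite finset.setI_eq0.
Qed.

(** Union bound over the positions [i]: the prime [f i] is an exceptional modulus, or it is not
    and fails for the other coordinates.  The prime [f i] is drawn independently of
    these, so that it may be treated as a fixed modulus.  The numerical conditions say that
    every [Q i] offers at least [q] primes between [q] and [Y], that [Y] is below [q ^ (5 / 4)]
    by a power of [k], and that [2 ^ k] exceeds [Y] by a factor polynomial in [k]. *)
Lemma mean_not_sylow (R : realFieldType) (k Y q : nat) (Q : 'I_k -> seq nat) :
  (9 <= k)%N -> (1 < Y)%N ->
  (forall i, uniq (Q i)) -> (forall i, all (fun r => r <= Y)%N (Q i)) ->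
  (forall i, all prime (Q i)) -> (forall i, all (fun r => q <= r)%N (Q i)) ->
  (forall i, q <= size (Q i))%N ->
  (64 * k ^ 2 <= q)%N -> (64 * (k * Y * k.+1 ^ 14) <= 2 ^ (k - 9))%N ->
  (2 ^ 19 * (k ^ 6 * Y ^ 4) <= q ^ 5)%N ->
  mean (B := Y) Q (fun f => (~~ is_sylow (\prod_i (f i : nat))%N)%:R) <= 15 / 64 :> R.
Proof.
move=> k9 Y1 uQ QB pQ Qq qQ hq hW hX.
have k0 : (0 < k)%N by exact: leq_trans k9.
have q0 : (0 < q)%N by apply: leq_trans hq; rewrite muln_gt0 expn_gt0 k0.
have Q0 : (0 < #|in_box (B := Y) Q|)%N.
  by rewrite (card_in_box uQ QB); apply: prodn_cond_gt0 => i _; exact: leq_trans (qQ i).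
have kR : 0 < k%:R :> R by rewrite ltr0n.
have qR : 0 < q%:R :> R by rewrite ltr0n.
pose eta : R := (32 * k)%N%:R^-1.
have eta0 : 0 < eta by rewrite invr_gt0 ltr0n muln_gt0.
pose good p := equidistributedb Y Q eta p.
have pos i := witness_positions i k9.
have [D1 pos1] := boolp.choice pos; have [D2 {pos1}pos] := boolp.choice pos1.
pose G i := D1 i :|: D2 i; pose O i := ~: (i |: G i).
have dOG i : [disjoint O i & G i].
  rewrite finset.disjoints_subset finset.setCS; exact: finset.subsetUr.
have iO i : i \notin O i by rewrite !finset.inE eqxx.
have iG i : i \notin G i by case: (pos i).
have cO i : #|O i| = (k - 9)%N by case: (pos i).
pose bad i (f : tuples k Y) := ~~ good (f i).
pose fl i (f : tuples k Y) := good (f i) && fails (O i) (G i) (f i) f.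
pose W : R := (2 ^ (k - 9))%N%:R.
have W0 : 0 < W by rewrite ltr0n expn_gt0.
(* All error terms are small multiples of [u = 1 / (64 * k)], and there are [k] positions. *)
pose u : R := (64 * k%:R)^-1.
have u0 : 0 < u by rewrite invr_gt0 mulr_gt0.
have ku : 64 * k%:R * u = 1 by rewrite mulfV // gt_eqF // mulr_gt0.
have etaE : eta = 2 * u by rewrite /eta /u natrM; field; rewrite gt_eqF.
have k1 : 1 <= k%:R :> R by rewrite ler1n.
have hqR : 64 * k%:R ^+ 2 <= q%:R :> R by rewrite -natrX -natrM ler_nat.
have k64 : 0 < 64 * k%:R :> R by rewrite mulr_gt0.
have zeta_le : k%:R / q%:R <= u.
  by rewrite ler_pdivrMr // /u ler_pdivlMl // -mulrA -expr2.
have invq_le : q%:R^-1 <= u.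
  by apply: le_trans zeta_le; rewrite -[leLHS]mul1r ler_wpM2r // invr_ge0 ler0n.
have hWR : Y%:R * (k.+1 ^ 14)%N%:R / W <= u.
  rewrite ler_pdivrMr // /u ler_pdivlMl // /W -!natrM ler_nat.
  by apply: leq_trans hW; rewrite !mulnA.
have hflp i p : prime p -> (q <= p <= Y)%N -> good p ->
    mean (B := Y) Q (fun f => (fails (O i) (G i) p f)%:R) <= 11 * u :> R.
  move=> pp /andP[qp pY] gp; have [c1 c2 dD _ _] := pos i.
  have eqd : equidistributed Y Q eta p by exact/equidistributedP.
  have p0 : 0 < p%:R :> R by rewrite ltr0n prime_gt0.
  have z : mean (B := Y) Q (fun f =>
      ((prodon (O i) f * prodon (G i) f)%:R == 0 :> 'F_p)%:R) <= k%:R / q%:R :> R.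
    rewrite -(eq_mean (F := fun f => ((prodon (O i :|: G i) f)%:R == 0 :> 'F_p)%:R)).
      exact: mean_zero_prodon.
    by move=> f _; rewrite prodonU.
  apply: le_trans (mean_fails Q0 pp eqd (ltW eta0) c1 c2 dD (dOG i) z) _.
  rewrite (cO i) -/W.
  have ip : p%:R^-1 <= u.
    by apply: le_trans invq_le; rewrite lef_pV2 ?posrE // ler_nat.
  have -> : (p%:R ^+ 2 * (k.+1 ^ 14)%N%:R / W + p%:R * (p%:R^-1 + eta + k%:R / q%:R)) *
      ((1 + p%:R^-1 + eta) / p%:R) =
      (p%:R * (k.+1 ^ 14)%N%:R / W + (p%:R^-1 + eta + k%:R / q%:R)) * (1 + p%:R^-1 + eta) :> R.
    by move: (k.+1 ^ 14)%N%:R (k%:R / q%:R) => X Z; field; rewrite !gt_eqF.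
  have t2 : 1 + p%:R^-1 + eta <= 2 by rewrite etaE; nra.
  have ip0 : 0 < p%:R^-1 :> R by rewrite invr_gt0.
  have pW : p%:R * (k.+1 ^ 14)%N%:R / W <= u.
    apply: le_trans hWR; rewrite -!mulrA ler_wpM2r ?mulr_ge0 ?invr_ge0 ?ler0n ?(ltW W0) //.
    by rewrite ler_nat.
  have pW0 : 0 <= p%:R * (k.+1 ^ 14)%N%:R / W.
    by rewrite divr_ge0 ?mulr_ge0 ?ler0n // ltW.
  have z0 : 0 <= k%:R / q%:R :> R by rewrite divr_ge0 ?ler0n.
  move: zeta_le z0 pW pW0 t2 ip ip0 etaE eta0; move: (_ / W) (k%:R / q%:R) (p%:R^-1) => X Z P.
  move=> h1 h2 h3 h4 h5 h6 h7 h8 h9.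
  apply: le_trans (_ : Z + (X + (P + eta + Z)) * 2 <= _); last by lra.
  by rewrite lerD2l ler_wpM2l //; lra.
(* Resample the coordinate [i] alone; the sets [O i] and [G i] do not contain it. *)
have hfl i : mean (B := Y) Q (fun f => (fl i f)%:R) <= 11 * u :> R.
  rewrite -(mean_mix [set i]) //.
  rewrite -(eq_mean (F := fun f => mean (B := Y) Q (fun h =>
     (good (h i) && fails (O i) (G i) (h i) f)%:R))); last first.
    move=> f _; apply: eq_mean => h _; rewrite /fl ffunE finset.inE eqxx.
    congr (nat_of_bool (_ && _))%:R; apply: eq_forallb => S; case SO: (S \in powerset _) => //=.
    have dis (D : {set 'I_k}) : i \notin D -> [disjoint D & [set i]].
      by move=> iD; rewrite disjoint_sym disjoints1.
    rewrite !prodon_mixC //; apply: dis => //.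
    by move: SO; rewrite powersetE => /fintype.subsetP SO; apply/negP => /SO; exact/negP/iO.
  rewrite mean_exchange -[leRHS](mean_const (B := Y) (Q := Q)) //.
  apply: ler_mean => h hQ; have hi : (h i : nat) \in Q i by have /forallP := hQ.
  case: (boolP (good (h i))) => [gh|_] /=.
    apply: hflp => //; first exact: (allP (pQ i)).
    by rewrite (allP (Qq i)) // (allP (QB i)).
  by rewrite mean_const // mulr_ge0 // ltW.
have hbad i : mean (B := Y) Q (fun f => (bad i f)%:R) <= 4 * u :> R.
  pose Pl := [seq p <- iota 0 Y.+1 | prime p].
  apply: le_trans (_ : mean (B := Y) Q (fun f =>
     \sum_(p <- Pl | ~~ good p) ((f i : nat) == p)%:R) <= _).
    apply: ler_mean => f fQ; rewrite /bad; case: (boolP (good _)) => gf /=.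
      by apply: sumr_ge0 => p _; rewrite ler0n.
    have fi : (f i : nat) \in Q i by have /forallP := fQ.
    rewrite (big_rem (f i : nat)) /=; last first.
      by rewrite mem_filter mem_iota (allP (pQ i)) //= add0n ltn_ord.
    by rewrite gf eqxx /= lerDl sumr_ge0 // => p _; rewrite ler0n.
  rewrite mean_sum; apply: le_trans (_ : \sum_(p <- Pl | ~~ good p) (q%:R^-1 : R) <= _).
    by apply: ler_sum => p _; exact: mean_eq_prime.
  rewrite big_const_seq iter_addr addr0 -[leLHS]mulr_natl.
  have ce := card_exceptional Q0 Y1 uQ QB pQ q0 qQ eta0.
  rewrite -/Pl -/good in ce.
  have cE : count (fun p => ~~ good p) Pl = count (fun p => ~~ equidistributedb Y Q eta p) Pl by [].
  rewrite cE; move: ce; set c : R := (count _ _)%:R => ce.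
  have hXR : 2 ^+ 19 * (k%:R ^+ 6 * Y%:R ^+ 4) <= q%:R ^+ 5 :> R.
    by rewrite -!natrX -!natrM ler_nat.
  have {}ce : c <= (k ^ 4)%N%:R * ((4 * Y ^ 4)%N%:R * 256 / q%:R ^+ 4) / eta by rewrite ler_pdivlMr.
  rewrite ler_pdivrMr //; apply: (le_trans ce).
  rewrite natrM !natrX.
  have -> : k%:R ^+ 4 * (4 * Y%:R ^+ 4 * 256 / q%:R ^+ 4) / eta =
     2 ^+ 19 * (k%:R ^+ 6 * Y%:R ^+ 4) / q%:R ^+ 4 * (4 * u) :> R.
    by rewrite etaE /u; field; rewrite !gt_eqF.
  rewrite mulrC ler_wpM2l ?mulr_ge0 ?(ltW u0) // ler_pdivrMr ?exprn_gt0 //.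
apply: le_trans (_ : mean (B := Y) Q (fun f => \sum_(i < k) ((bad i f)%:R + (fl i f)%:R)) <= _).
  apply: ler_mean => f fQ; case: (boolP (is_sylow _)) => [_|ns].
    by apply: sumr_ge0 => i _; rewrite addr_ge0 ?ler0n.
  have : [exists i, fails (O i) (G i) (f i) f].
    apply: contraNT ns; rewrite negb_exists => /forallP ok.
    apply: (sylow_of_not_fails pQ fQ _ ok) => i; split => //.
    case: (pos i) => c1 _ _ _ _; apply: leq_trans (_ : #|D1 i| <= _)%N; first by rewrite c1.
    by apply: subset_leq_card; exact: finset.subsetUl.
  case/existsP => i fi; rewrite (bigD1 i) //=; apply: ler_wpDr.
    by apply: sumr_ge0 => j _; rewrite addr_ge0 ?ler0n.
  rewrite /bad /fl fi andbT; by case: (good _); rewrite /= ?addr0 ?add0r.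
rewrite mean_sum; apply: le_trans (_ : \sum_(i < k) 15 * u <= _).
  apply: ler_sum => i _; rewrite meanD; have := hfl i; have := hbad i.
  by move: (mean _ _) (mean _ _) => a b; lra.
rewrite sumr_const card_ord -[leLHS]mulr_natl le_eqVlt; apply/orP; left.
by apply/eqP; lra.
Qed.

Lemma half_sylow (k Y q : nat) (Q : 'I_k -> seq nat) :
  (9 <= k)%N -> (1 < Y)%N ->
  (forall i, uniq (Q i)) -> (forall i, all (fun r => r <= Y)%N (Q i)) ->
  (forall i, all prime (Q i)) -> (forall i, all (fun r => q <= r)%N (Q i)) ->
  (forall i, q <= size (Q i))%N ->
  (64 * k ^ 2 <= q)%N -> (64 * (k * Y * k.+1 ^ 14) <= 2 ^ (k - 9))%N ->
  (2 ^ 19 * (k ^ 6 * Y ^ 4) <= q ^ 5)%N ->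
  (#|in_box (B := Y) Q| <=
     2 * #|[pred f : tuples k Y | in_box Q f && is_sylow (\prod_i (f i : nat))%N]|)%N.
Proof.
move=> k9 Y1 uQ QB pQ Qq qQ hq hW hX.
have key := mean_not_sylow rat k9 Y1 uQ QB pQ Qq qQ hq hW hX.
have [c0|c0] := posnP #|in_box (B := Y) Q|; first by rewrite c0.
rewrite /mean sum_indicator ler_pdivrMr ?ltr0n // in key.
set a := #|[pred x | _]| in key; set b := #|[pred x | _]|.
have abE : (a + b = #|in_box (B := Y) Q|)%N.
  rewrite addnC -(cardID (fun f : tuples k Y => is_sylow (\prod_i (f i : nat))%N) (in_box (B := Y) Q)).
  by congr (_ + _)%N; apply: eq_card => f; rewrite !inE // andbC.
move: key; rewrite -abE mulrAC ler_pdivlMr // -natrM -natrM ler_nat; lia.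
Qed.

(** * Blocks of primes and the count from below *)

Definition primes_upto (n : nat) : seq nat := [seq p <- iota 0 n.+1 | prime p].

Lemma mem_primes_upto n p : (p \in primes_upto n) = prime p && (p <= n)%N.
Proof. by rewrite mem_filter mem_iota add0n ltnS. Qed.

Lemma divn_double_le1 (n q : nat) : (0 < q)%N -> (2 * n %/ q <= 2 * (n %/ q) + 1)%N.
Proof.
move=> q0; rewrite -ltnS ltn_divLR //.
have := divn_eq n q; have := ltn_pmod n q0.
move: (n %/ q)%N (n %% q)%N => a r; nia.
Qed.

(** By Legendre's formula the exponent is the sum over [j] of
    [2 * n %/ p ^ j - 2 * (n %/ p ^ j)], and each such term is at most one and vanishes once
    [p ^ j] exceeds [2 * n]. *)
Lemma logn_central_bin (n p : nat) : (0 < n)%N -> prime p ->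
  (p ^ logn p 'C(2 * n, n) <= 2 * n)%N.
Proof.
move=> n0 pp; have n20 : (0 < 2 * n)%N by rewrite muln_gt0.
have le : (logn p 'C(2 * n, n) <= trunc_log p (2 * n))%N.
  have nn : (n <= 2 * n)%N by rewrite leq_pmull.
  have := bin_fact nn; rewrite mul2n -addnn addnK addnn -mul2n => /(congr1 (logn p)).
  rewrite !lognM ?muln_gt0 ?fact_gt0 ?bin_gt0 ?nn // !logn_fact //.
  have ext : (\sum_(1 <= j < n.+1) n %/ p ^ j = \sum_(1 <= j < (2 * n).+1) n %/ p ^ j)%N.
    rewrite [RHS](@big_cat_nat _ _ _ n.+1) //= -[LHS]addn0; congr (_ + _)%N.
    rewrite big_nat big1 // => j /andP[nj _].
    by rewrite divn_small // (ltn_trans nj) // ltn_expl // prime_gt1.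
  rewrite ext => e.
  have : (\sum_(1 <= j < (2 * n).+1) (2 * n) %/ p ^ j <=
     \sum_(1 <= j < (2 * n).+1) (2 * (n %/ p ^ j) + (p ^ j <= 2 * n)))%N.
    apply: leq_sum => j _; case: (leqP (p ^ j) (2 * n)) => h; last by rewrite divn_small.
    by apply: divn_double_le1; rewrite expn_gt0 prime_gt0.
  rewrite big_split /= -big_distrr /= -e => h.
  apply: (@leq_trans (\sum_(1 <= j < (2 * n).+1) (p ^ j <= 2 * n)%N)).
    move: h; set S := (\sum_(_ <= _ < _) _ %/ _)%N; set C := (\sum_(_ <= _ < _) _)%N; lia.
  rewrite (eq_bigr (fun j => if (p ^ j <= 2 * n)%N then 1%N else 0%N)); last by move=> j _; case: ifP.
  rewrite -big_mkcond sum1_count -size_filter -[leqRHS](size_iota 1).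
  apply: uniq_leq_size; first by rewrite filter_uniq // iota_uniq.
  move=> j; rewrite mem_filter mem_iota mem_index_iota => /andP[pj /andP[j1 _]].
  by rewrite j1 /= add1n ltnS; apply: trunc_log_max => //; exact: prime_gt1.
apply: leq_trans (_ : p ^ trunc_log p (2 * n) <= _)%N; first by rewrite leq_pexp2l // prime_gt0.
by apply: trunc_logP => //; exact: prime_gt1.
Qed.

Lemma prime_dvd_fact_le (p n : nat) : prime p -> (p %| n`!)%N -> (p <= n)%N.
Proof.
move=> pp; elim: n => [|n IH].
  by rewrite fact0 dvdn1 => /eqP p1; move: pp; rewrite p1.
rewrite factS Euclid_dvdM // => /orP[/dvdn_leq -> //|/IH pn].
exact: leqW.
Qed.

Lemma exp2_le_central_bin (n : nat) : (2 ^ n <= 'C(2 * n, n))%N.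
Proof.
rewrite mul2n -addnn -binomial.Vandermonde -[2%N]/(1 + 1)%N expnDn; apply: leq_sum => i _.
rewrite !exp1n !muln1 leq_pmulr // bin_gt0 leq_subr //.
Qed.

(** Chebyshev's argument: the central binomial coefficient is at least [2 ^ n], and it is a
    product of prime powers that are at most [2 * n]. *)
Lemma primes_upto_lower (t : nat) : (2 ^ t <= t.+1 * size (primes_upto (2 ^ t.+1)))%N.
Proof.
set n := (2 ^ t)%N; have n0 : (0 < n)%N by rewrite expn_gt0.
have E : (2 ^ t.+1 = 2 * n)%N by rewrite expnS.
rewrite -(@leq_exp2l 2) // mulnC mulnC expnM E -E.
have := exp2_le_central_bin n; rewrite -/n => h; apply: (leq_trans h).
set c := 'C(2 * n, n); have c0 : (0 < c)%N by rewrite bin_gt0 leq_pmull.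
rewrite {1}(prod_prime_decomp c0) prime_decompE big_map /=.
apply: leq_trans (_ : \prod_(p <- primes c) (2 * n) <= _)%N.
  rewrite big_seq [leqRHS]big_seq; apply: leq_prod => p.
  by rewrite mem_primes => /and3P[pp _ _]; exact: logn_central_bin.
rewrite big_const_seq count_predT iter_muln_1 E leq_pexp2l ?muln_gt0 //.
apply: uniq_leq_size; first exact: primes_uniq.
move=> p; rewrite mem_primes mem_primes_upto => /and3P[pp _ pc]; rewrite pp /=.
have : (p %| (2 * n)`!)%N.
  have nn : (n <= 2 * n)%N by rewrite leq_pmull.
  by rewrite -(bin_fact nn) dvdn_mulr.
exact: prime_dvd_fact_le.
Qed.

Definition block (b h : nat) : seq nat :=
  [seq p <- primes_upto (2 ^ (b * h.+1)) | (2 ^ (b * h) < p)%N].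

Lemma mem_block b h p :
  (p \in block b h) = [&& prime p, (2 ^ (b * h) < p)%N & (p <= 2 ^ (b * h.+1))%N].
Proof. by rewrite mem_filter mem_primes_upto andbCA. Qed.

(** The primes up to the lower end of the block number at most [2 ^ (b * h)], at
    most half of Chebyshev's bound because [2 ^ b] is at least [4 * tt]. *)
Lemma size_block (b h tt : nat) : (0 < b)%N -> (b * h.+1 <= tt)%N -> (4 * tt <= 2 ^ b)%N ->
  (2 ^ (b * h.+1) <= 4 * tt * size (block b h))%N.
Proof.
move=> b0 bt tb; have t0 : (0 < b * h.+1)%N by rewrite muln_gt0 b0.
have E : (b * h.+1 = (b * h.+1).-1.+1)%N by rewrite prednK.
have low := primes_upto_lower (b * h.+1).-1; rewrite -E in low.
have pi_le : (size (primes_upto (2 ^ (b * h.+1))) <= size (block b h) + 2 ^ (b * h))%N.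
  rewrite -(count_predC (fun p => 2 ^ (b * h) < p)%N (primes_upto _)) -size_filter leq_add2l.
  rewrite -size_filter -[leqRHS](size_iota 1); apply: uniq_leq_size.
    by rewrite !filter_uniq // iota_uniq.
  move=> p; rewrite mem_filter mem_primes_upto mem_iota /= -leqNgt => /and3P[pb pp _].
  by rewrite prime_gt0 //= add1n ltnS.
have pw : (2 ^ (b * h.+1) = 2 ^ b * 2 ^ (b * h))%N by rewrite mulnS expnD.
have pw2 : (2 ^ (b * h.+1) = 2 * 2 ^ (b * h.+1).-1)%N by rewrite {1}E expnS.
have hb : (4 * tt * 2 ^ (b * h) <= 2 ^ (b * h.+1))%N by rewrite pw leq_mul2r tb orbT.
have low' := leq_trans low (leq_mul bt pi_le).
move: low' pw2 hb; move: (2 ^ (b * h))%N (2 ^ (b * h.+1))%N (2 ^ (b * h.+1).-1)%N => x y w.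
by move: (size (block b h)) => s; nia.
Qed.

Lemma size_block_ge (b h tt : nat) : (0 < b)%N -> (b * h.+1 <= tt)%N -> (4 * tt <= 2 ^ b)%N ->
  (2 ^ (b * h) <= size (block b h))%N.
Proof.
move=> b0 bt tb; have t0 : (0 < b * h.+1)%N by rewrite muln_gt0 b0.
have tt0 : (0 < 4 * tt)%N by rewrite muln_gt0 /= (leq_trans t0).
rewrite -(leq_pmul2l tt0); apply: leq_trans (size_block b0 bt tb).
by rewrite mulnS expnD leq_mul2r tb orbT.
Qed.

Lemma block_index_unique (b h h' p : nat) : p \in block b h -> p \in block b h' -> h = h'.
Proof.
rewrite !mem_block => /and3P[_ l1 u1] /and3P[_ l2 u2].
have aux x y : (2 ^ (b * x) < p)%N -> (p <= 2 ^ (b * y.+1))%N -> (x <= y)%N.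
  move=> l u; rewrite leqNgt; apply/negP => yx.
  have := leq_trans l u; rewrite ltnNge leq_exp2l //.
  by rewrite leq_mul2l yx orbT.
by apply/eqP; rewrite eqn_leq (aux _ _ l1 u2) (aux _ _ l2 u1).
Qed.

Lemma card_same_quotient (k m c : nat) : (0 < m)%N ->
  (#|[set j in [set: 'I_k] | j %/ m == c]| <= m)%N.
Proof.
move=> m0; rewrite -[leqRHS]card_ord.
pose F (j : 'I_k) : 'I_m := Ordinal (ltn_pmod j m0).
rewrite -(@card_in_imset _ _ F); first exact: max_card.
move=> i j; rewrite !finset.inE => /eqP ic /eqP jc /(congr1 val) /= e.
by apply: val_inj; rewrite /= (divn_eq i m) (divn_eq j m) ic jc e.
Qed.

Lemma sum_quotient (m H : nat) (F : nat -> nat) : (0 < m)%N ->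
  (\sum_(0 <= i < m * H) F (i %/ m) = m * \sum_(0 <= h < H) F h)%N.
Proof.
move=> m0; elim: H => [|H IH]; first by rewrite muln0 !big_geq // muln0.
have -> : (m * H.+1 = m * H + m)%N by rewrite mulnS addnC.
have tail : (\sum_(m * H <= i < m * H + m) F (i %/ m) = m * F H)%N.
  rewrite -{1}(add0n (m * H)%N) big_addn addKn.
  rewrite big_nat (eq_bigr (fun=> F H)) => [|i /andP[_ im]]; last first.
    by rewrite addnC mulnC divnMDl // divn_small // addn0.
  by rewrite -big_nat big_const_nat subn0 iter_addn_0 mulnC.
by rewrite (@big_cat_nat _ _ _ (m * H)) ?leq_addr //= IH tail big_nat_recr //= mulnDr.
Qed.

(** The positions are arranged in [H] blocks of [m] positions each.  Half of the tuples give
    Sylow numbers, and a product determines its tuple up to [m ^ k] rearrangements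
    inside the blocks.  The exponent on the left is the logarithm of the largest possible
    product. *)
Lemma sylow_count_ge (b m H H0 N : nat) :
  let k := (m * H)%N in let tt := (b * (H0 + H))%N in
  (0 < b)%N -> (9 <= k)%N -> (4 * tt <= 2 ^ b)%N ->
  (64 * k ^ 2 <= 2 ^ (b * H0))%N -> (64 * (k * 2 ^ tt * k.+1 ^ 14) <= 2 ^ (k - 9))%N ->
  (2 ^ 19 * (k ^ 6 * (2 ^ tt) ^ 4) <= (2 ^ (b * H0)) ^ 5)%N ->
  (2 ^ (b * m * (H * H0.+1 + 'C(H, 2))) <= N)%N ->
  (2 ^ (b * m * (H * H0.+1 + 'C(H, 2))) <=
     2 * (4 * tt * m) ^ k * \sum_(1 <= n < N.+1 | is_sylow n) 1)%N.
Proof.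
move=> k tt b0 k9 tb c1 c2 c3 EN.
have m0 : (0 < m)%N by rewrite lt0n; apply: contraTneq k9 => m0; rewrite /k m0.
have H0' : (0 < H)%N by rewrite lt0n; apply: contraTneq k9 => h0; rewrite /k h0 muln0.
have tt0 : (0 < tt)%N by rewrite /tt muln_gt0 b0 addn_gt0 H0' orbT.
pose Q (i : 'I_k) := block b (H0 + i %/ m).
have hi (i : 'I_k) : (i %/ m < H)%N by rewrite ltn_divLR // mulnC.
have bt (i : 'I_k) : (b * (H0 + i %/ m).+1 <= tt)%N by rewrite leq_mul2l -addnS leq_add2l hi orbT.
have uQ i : uniq (Q i) by rewrite !filter_uniq // iota_uniq.
have pQ i : all prime (Q i) by apply/allP => p; rewrite mem_block => /and3P[].
have QY i : all (fun r => r <= 2 ^ tt)%N (Q i).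
  apply/allP => p; rewrite mem_block => /and3P[_ _ h]; apply: (leq_trans h).
  by rewrite leq_exp2l.
have qle (i : 'I_k) : (2 ^ (b * H0) <= 2 ^ (b * (H0 + i %/ m)))%N.
  by rewrite leq_exp2l // leq_mul2l leq_addr orbT.
have Qq i : all (fun r => 2 ^ (b * H0) <= r)%N (Q i).
  apply/allP => p; rewrite mem_block => /and3P[_ h _]; apply: leq_trans (ltnW h); exact: qle.
have Qs i : (2 ^ (b * H0) <= size (Q i))%N.
  by apply: leq_trans (qle i) _; apply: size_block_ge tb.
have Y1 : (1 < 2 ^ tt)%N by rewrite -[1%N](expn0 2) ltn_exp2l.
have half := half_sylow k9 Y1 uQ QY pQ Qq Qs c1 c2 c3.
set S := (\sum_(1 <= n < N.+1 | is_sylow n) 1)%N.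
set Et := (b * m * _)%N in EN *.
have sumE : (\sum_(i < k) b * (H0 + i %/ m).+1 = Et)%N.
  rewrite -(big_mkord xpredT (fun i => b * (H0 + i %/ m).+1)%N) /k.
  rewrite (sum_quotient H (fun h => b * (H0 + h).+1)%N m0) -big_distrr /= mulnA [(m * b)%N]mulnC.
  rewrite /Et; congr (_ * _)%N.
  under eq_bigr do rewrite -addSn.
  by rewrite big_split /= big_const_nat subn0 iter_addn_0 mulnC -triangular_sum.
have boxE := card_in_box uQ QY.
have box0 : (0 < \prod_i size (Q i))%N.
  by apply: prodn_cond_gt0 => i _; apply: leq_trans (Qs i); rewrite expn_gt0.
have prod_le : (2 ^ Et <= (4 * tt) ^ k * \prod_i size (Q i))%N.
  rewrite -sumE expn_sum -[X in (_ <= _ ^ X * _)%N](card_ord k) -prod_nat_const -big_split /=.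
  by apply: leq_prod => i _; exact: size_block.
pose good := [pred f : tuples k (2 ^ tt) | in_box Q f && is_sylow (\prod_i (f i : nat))%N].
have fib n : (#|[pred f : tuples k (2 ^ tt) | in_box Q f && ((\prod_i (f i : nat))%N == n)]| <= m ^ k)%N.
  have := @fibre_prodon k (2 ^ tt) m n Q (fun i => i %/ m)%N [set: 'I_k] uQ QY pQ.
  have sep (i j : 'I_k) q : q \in Q i -> q \in Q j -> (i %/ m = j %/ m)%N.
    by move=> qi qj; have /eqP := block_index_unique qi qj; rewrite eqn_add2l => /eqP.
  move=> /(_ sep (fun i => card_same_quotient k (i %/ m)%N m0)).
  rewrite cardsT card_ord boxE (eq_bigl xpredT); last by move=> i; rewrite finset.inE.
  rewrite leq_pmul2r // => h; apply: leq_trans h; apply: subset_leq_card.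
  apply/fintype.subsetP => f; rewrite !inE /prodon.
  by rewrite [in X in _ -> X](eq_bigl xpredT) // => i; rewrite finset.inE.
have good_le : (#|good| <= m ^ k * S)%N.
  rewrite -sum1_card /S big_distrr /= muln1.
  apply: leq_trans (_ : \sum_(1 <= n < N.+1 | is_sylow n)
    \sum_(f | good f && ((\prod_i (f i : nat))%N == n)) 1 <= _)%N; last first.
    apply: leq_sum => n _; rewrite sum1_card; apply: leq_trans (fib n).
    by apply: subset_leq_card; apply/fintype.subsetP => f; rewrite !inE => /andP[/andP[-> _] ->].
  rewrite (exchange_big_dep good) /=; last by move=> n f _ /andP[].
  apply: leq_sum => f gf; have [fQ fS] := andP gf.
  have fN : (\prod_i (f i : nat) <= N)%N.
    apply: leq_trans EN; rewrite -sumE expn_sum; apply: leq_prod => i _.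
    have /forallP /(_ i) := fQ; by rewrite mem_block => /and3P[].
  have f0 : (0 < \prod_i (f i : nat))%N.
    apply: prodn_cond_gt0 => i _; apply: prime_gt0; apply: (allP (pQ i)).
    by have /forallP := fQ.
  rewrite (big_rem (\prod_i (f i : nat))%N) /=; last by rewrite mem_pos_iota f0.
  by rewrite fQ fS eqxx.
apply: (leq_trans prod_le); rewrite -boxE.
apply: leq_trans (leq_mul (leqnn _) half) _.
apply: leq_trans (leq_mul (leqnn _) (leq_mul (leqnn 2) good_le)) _.
by rewrite [((4 * tt * m) ^ k)%N]expnMn; move: ((4 * tt) ^ k)%N (m ^ k)%N => x y; nia.
Qed.

(** * Asymptotics of the upper bound *)

Lemma ln_ge_1BV (R : realType) (x : R) : 0 < x -> 1 - x^-1 <= ln x.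
Proof.
move=> x0; have := @le_ln1Dx R (x^-1 - 1).
rewrite addrCA subrr addr0 lnV ?posrE // => h.
have : - ln x <= x^-1 - 1 by apply: h; rewrite ltrBrDl subrr invr_gt0.
lra.
Qed.

Lemma ln2_bounds (R : realType) : 1 / 2 <= (ln 2 : R) <= 1.
Proof.
apply/andP; split; first by have := @ln_ge_1BV R 2 (ltr0Sn _ 1); lra.
have := @le_ln1Dx R 1; rewrite -[1 + 1]/2; apply; lra.
Qed.

Lemma sqrt_ln2_bounds (R : realType) :
  [/\ 1 / 2 <= Num.sqrt (ln 2 : R), Num.sqrt (ln 2 : R) <= 1
    & Num.sqrt (ln 2 : R) ^+ 2 = ln 2].
Proof.
have /andP[h1 h2] := ln2_bounds R.
have e : Num.sqrt (ln 2 : R) ^+ 2 = ln 2 by rewrite sqr_sqrtr //; lra.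
have s0 : 0 <= Num.sqrt (ln 2 : R) by exact: sqrtr_ge0.
by split=> //; nra.
Qed.

Lemma harm_le_ln (R : realType) (N : nat) : (0 < N)%N -> harm R N <= 1 + ln N%:R.
Proof.
elim: N => // N IH _; case: N IH => [|N] IH.
  by rewrite /harm /hmass big_nat1 invr1 ln1 addr0.
have -> : harm R N.+2 = harm R N.+1 + N.+2%:R^-1 by rewrite /harm /hmass big_nat_recr.
have {}IH := IH isT; apply: (le_trans (lerD IH (lexx _))); rewrite -addrA lerD2l.
have N0 : 0 < N.+1%:R :> R by rewrite ltr0n.
have M0 : 0 < N.+2%:R :> R by rewrite ltr0n.
have := @ln_ge_1BV R (N.+2%:R / N.+1%:R) (divr_gt0 M0 N0).
rewrite ln_div ?posrE // invf_div.
have -> : 1 - N.+1%:R / N.+2%:R = N.+2%:R^-1 :> R.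
  have -> : N.+2%:R = N.+1%:R + 1 :> R by rewrite natr1.
  move: (N.+1%:R) N0 => y y0; field; lra.
by rewrite lerBrDl.
Qed.

Lemma expR1_ge2 (R : realType) : 2 <= expR (1 : R).
Proof. by have := @expR_ge1Dx R 1; lra. Qed.

Lemma exists_nat_above_exp (R : realType) (r : R) : 0 <= r ->
  exists n : nat, expR r < n%:R <= expR (r + 1).
Proof.
move=> r0; exists (Num.truncn (expR r)).+1; rewrite truncnS_gt /=.
have e1 : 1 <= expR r by have := expR_ge1Dx r; lra.
have : (Num.truncn (expR r))%:R <= expR r by rewrite truncn_le expR_ge0.
by rewrite -natr1 expRD; have := expR1_ge2 R; nra.
Qed.

Lemma exists_nat_below_exp (R : realType) (r : R) : 0 <= r ->
  exists n : nat, (0 < n)%N /\ expR (r - 1) <= n%:R <= expR r.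
Proof.
move=> r0; exists (Num.truncn (expR r)).
have e1 : 1 <= expR r by have := expR_ge1Dx r; lra.
have n0 : (0 < Num.truncn (expR r))%N by rewrite truncn_gt0.
split => //; rewrite truncn_le expR_ge0 andbT expRD expRN.
have n1 : 1 <= (Num.truncn (expR r))%:R :> R by rewrite ler1n.
rewrite ler_pdivrMr ?expR_gt0 //.
have := truncnS_gt (expR r); rewrite -natr1.
by have := expR1_ge2 R; nra.
Qed.

Lemma exists_nat_above (R : realType) (r : R) : 0 <= r ->
  exists n : nat, r < n%:R <= r + 1.
Proof.
move=> r0; exists (Num.truncn r).+1; rewrite truncnS_gt /= -natr1 lerD2r.
by rewrite truncn_le.
Qed.

Lemma natr_le_exp (R : realType) (n : nat) : n%:R <= expR (n%:R : R).
Proof. by have := expR_ge1Dx (n%:R : R); lra. Qed.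

Lemma trunc_log_ln2 (R : realType) (n : nat) (r : R) : (0 < n)%N -> n%:R <= expR r ->
  (trunc_log 2 n)%:R * ln 2 <= r.
Proof.
move=> n0 nr; rewrite -ler_expR expRM_natl lnK ?posrE //.
by apply: le_trans nr; rewrite -natrX ler_nat; exact: trunc_logP.
Qed.

Lemma expR_mulrn_le (R : realType) (b r : R) (n : nat) : 0 <= b -> b <= expR r ->
  b ^+ n <= expR (n%:R * r).
Proof. by move=> b0 br; rewrite expRM_natl lerXn2r ?nnegrE ?expR_ge0. Qed.

Lemma expR_mulrn_ge (R : realType) (b r : R) (n : nat) : expR r <= b ->
  expR (n%:R * r) <= b ^+ n.
Proof.
move=> br; rewrite expRM_natl lerXn2r ?nnegrE ?expR_ge0 //.
exact: le_trans (expR_ge0 _) br.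
Qed.

(** With [T = expR ((1 - eps) * a * s)], [y = expR (a * s)], [z = expR (s * lam)] and
    [V = expR (eps * s ^ 2 / 8)], this says that a number above [expR (s ^ 2 - s * lam)] which
    is in none of the first three families has more than [d * L] primes above [y]: the primes
    up to [y] account for at most [(1 - eps) * s ^ 2]. *)
Lemma large_prime_budget (R : realType) (a eps K lam s tl d L : R) :
  1 / 2 <= a <= 1 -> 0 < eps -> eps * K = 9 -> 18 <= K -> 1 <= lam ->
  1000 * (K ^+ 5 * lam ^+ 4) <= s -> 0 <= tl -> a * tl <= (1 - eps) * s ->
  0 <= L <= K * lam -> 0 <= d <= 5 * (K * lam) ^+ 2 ->
  eps * s ^+ 2 / 4 + 2 + tl * (a * s + 1) + d * L * (s * lam + 1) <= s ^+ 2 - s * lam - 1.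
Proof.
move=> /andP[a1 a2] e0 eK K18 lam1 hs tl0 htl /andP[L0 LK] /andP[d0 dK].
pose P := K ^+ 3 * lam ^+ 4.
have K1 : 1 <= K by move: K18; clear; lra.
have lam40 : 1 <= lam ^+ 4 by rewrite exprn_ege1.
have K3 : 1 <= K ^+ 3 by rewrite exprn_ege1.
have lam4 : lam <= lam ^+ 4.
  by rewrite exprS ler_peMr ?exprn_ege1 //; move: lam1; clear; lra.
have P1 : 1 <= P by rewrite /P; move: (K ^+ 3) (lam ^+ 4) K3 lam40; clear => x0 x1; nra.
have Plam : lam <= P by rewrite /P; move: (K ^+ 3) (lam ^+ 4) K3 lam40 lam4; clear => x0 x1; nra.
have sP : 1000 * (K * K) * P <= s.
  by apply: le_trans hs; rewrite /P le_eqVlt; apply/orP; left; apply/eqP; ring.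
clear hs.
have P3 : 5 * (K * lam) ^+ 3 * (2 * (s * lam)) = 10 * (P * s) by rewrite /P; ring.
clearbody P.
have K0 : 0 <= K by move: K1; clear; lra.
have es : 9000 * P <= eps * s.
  have h : eps * (1000 * (K * K) * P) <= eps * s by rewrite ler_wpM2l // ltW.
  apply: le_trans h; have -> : eps * (1000 * (K * K) * P) = 1000 * (eps * K) * (K * P) by ring.
  by rewrite eK; move: P1 K1; clear; nra.
have KK : 1 <= K * K by move: K1; clear; nra.
have sP' : P <= s.
  by apply: le_trans sP; move: (K * K) P1 KK; clear => x0; nra.
have s1 : 1 <= s by exact: le_trans sP'.
have ess : 9000 * (P * s) <= eps * s ^+ 2.
  by rewrite expr2 !mulrA ler_wpM2r //; exact: le_trans s1.
have tl2 : tl <= 2 * s.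
  have h : a * tl <= s by apply: (le_trans htl); move: e0 s1; clear; nra.
  by move: a1 tl0 h; clear; nra.
have h1 : tl * (a * s + 1) <= s ^+ 2 - eps * s ^+ 2 + 2 * s.
  have -> : tl * (a * s + 1) = a * tl * s + tl by ring.
  have h : a * tl * s <= (1 - eps) * s * s by rewrite ler_wpM2r // (le_trans _ s1).
  by move: h tl2; rewrite expr2; clear; nra.
have dL : d * L <= 5 * (K * lam) ^+ 3.
  have -> : 5 * (K * lam) ^+ 3 = 5 * (K * lam) ^+ 2 * (K * lam) by ring.
  by rewrite ler_pM.
have q1 : 1 <= s * lam by move: s1 lam1; clear; nra.
have q2 : s * lam + 1 <= 2 * (s * lam) by move: (s * lam) q1; clear => x0; lra.
have h2 : d * L * (s * lam + 1) <= 10 * (P * s).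
  rewrite -P3.
  by rewrite ler_pM // ?mulr_ge0 // addr_ge0 // (le_trans _ q1).
have h3 : s * lam <= P * s by rewrite mulrC ler_wpM2r // (le_trans _ s1).
have h5 : s <= P * s by rewrite ler_peMl // (le_trans _ s1).
have h4 : 1 <= P * s by exact: le_trans h5.
move: ess h1 h2 h3 h4 h5; clear.
move: (P * s) (eps * s ^+ 2) (s ^+ 2) (s * lam) (tl * _) (d * L * _) => x1 x2 x3 x4 x5 x6; lra.
Qed.

(** The moment of order [j], where [2 ^ j] is about [eps * s] and so [j * a ^ 2] about
    [lam / 2], bounds the first family by [expR (4 * eps * s * lam)] divided by [T ^ j]; here
    [ln (T ^ j)] is about [(lam / (2 * a)) * s]. *)
Lemma tau_budget (R : realType) (a A eps K lam s j : R) :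
  A * a = 1 -> 1 <= A <= 2 -> 0 < eps <= 1 / 2 -> eps * K = 9 -> 18 <= K -> K ^+ 3 <= lam ->
  1 <= s -> lam <= s -> a <= 1 -> 1 <= a * s / 2 -> lam / 2 - K <= (j + 1) * a ^+ 2 ->
  4 * (eps * (s * lam)) - j * ((1 - eps) * (a * s) - 1) <= - (A / 2 - 6 * eps) * (s * lam).
Proof.
move=> Aa /andP[A1 A2] /andP[e0 e1] eK K18 Kl s1 ls a1 as1 hj.
have K2lam : K * K <= lam.
  have h : K ^+ 3 = K * K * K by ring.
  by move: Kl; rewrite h; move: K18; clear; nra.
have Klam : 18 * K <= lam by move: K2lam K18; clear; nra.
have l0 : 0 <= lam by move: K2lam K18; clear; nra.
have s0 : 0 <= s by exact: le_trans ler01 s1.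
pose w := lam / 2 - K - 1; pose r := (1 - eps) * (a * s) - 1.
have w0 : 0 <= w by rewrite /w; move: Klam K18; clear; lra.
have a0 : 0 <= a by move: Aa A1; clear; nra.
have as0 : 2 <= a * s by move: as1; clear; lra.
have r0 : 0 <= r by rewrite /r; move: as0 e1; clear; nra.
have wj : w <= j * a ^+ 2.
  have h : a ^+ 2 <= 1 by move: a0 a1; clear; nra.
  by rewrite /w; move: hj h; clear; nra.
have jr : A * (w * ((1 - eps) * s - A)) <= j * r.
  have -> : A * (w * ((1 - eps) * s - A)) = w * r * A ^+ 2.
    rewrite /r; have -> : w * ((1 - eps) * (a * s) - 1) * A ^+ 2 =
      w * ((1 - eps) * s * A * (A * a) - A ^+ 2) by ring.
    by rewrite Aa; ring.
  have -> : j * r = j * a ^+ 2 * r * A ^+ 2.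
    have -> : j * a ^+ 2 * r * A ^+ 2 = j * r * (A * a) ^+ 2 by ring.
    by rewrite Aa expr1n mulr1.
  by rewrite ler_wpM2r ?sqr_ge0 // ler_wpM2r.
have es : (2 * K + 4) * s <= eps * (s * lam).
  have h : eps * (K * K) <= eps * lam by rewrite ler_wpM2l // ltW.
  have h' : 9 * K <= eps * lam by apply: le_trans h; rewrite mulrA eK.
  by move: h' s1 K18; clear; nra.
apply: (@le_trans _ _ (4 * (eps * (s * lam)) - A * (w * ((1 - eps) * s - A)))).
  by rewrite lerD2l lerN2.
have -> : A * (w * ((1 - eps) * s - A)) = A / 2 * (s * lam) - A / 2 * (eps * (s * lam))
    - A * A * (lam / 2) - A * (1 - eps) * ((K + 1) * s) + A * A * (K + 1).
  by rewrite /w; field.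
have h1 : A / 2 * (eps * (s * lam)) <= eps * (s * lam).
  have e : 0 <= eps * (s * lam) by rewrite !mulr_ge0 // ltW.
  by move: e A2; clear; nra.
have h2 : A * A * (lam / 2) <= 2 * s.
  have AA : A * A <= 4 by move: A1 A2; clear; nra.
  by move: AA ls l0; clear; nra.
have h3 : A * (1 - eps) * ((K + 1) * s) <= 2 * ((K + 1) * s).
  have k : 0 <= (K + 1) * s by move: K18 s1; clear; nra.
  by rewrite ler_wpM2r //; move: A1 A2 e0 e1; clear; nra.
have h4 : 0 <= A * A * (K + 1) by rewrite !mulr_ge0; move: A1 K18; clear; lra.
move: h1 h2 h3 h4 es; clear; move: (A * (1 - eps) * _) (A * A * (lam / 2)) (A * A * (K + 1)) => X Y Z.
have -> : - (A / 2 - 6 * eps) * (s * lam) = 6 * (eps * (s * lam)) - A / 2 * (s * lam) by ring.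
move: (A / 2 * (s * lam)) (A / 2 * (eps * (s * lam))) (eps * (s * lam)) => U W Q.
have -> : (2 * K + 4) * s = 2 * ((K + 1) * s) + 2 * s by ring.
move: ((K + 1) * s) => V; lra.
Qed.

(** The constant [K] is [9 / eps]; it measures how large [lam] has to be. *)
Lemma sylow_count_upper (R : realType) (eps K lam s x : R) :
  0 < eps <= 1 / 2 -> eps * K = 9 -> K ^+ 3 <= lam -> 1000 * (K ^+ 5 * lam ^+ 4) <= s ->
  s ^+ 2 = expR lam -> x = expR (s ^+ 2) ->
  (sylow_count x)%:R <=
    x * expR (- ((2 * Num.sqrt (ln 2))^-1 - 7 * eps) * (s * lam)).
Proof.
move=> /andP[e0 e1] eK Kl hs sE xE.
have [a1 a2 aE] := sqrt_ln2_bounds R; set a := Num.sqrt (ln 2) in a1 a2 aE *.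
pose A := a^-1.
have a0 : 0 < a by lra.
have a_ge0 : 0 <= a by exact: ltW.
have e_ge0 : 0 <= eps by exact: ltW.
have Aa : A * a = 1 by rewrite mulVf // gt_eqF.
have A1 : 1 <= A by rewrite -(ler_pM2r a0) Aa mul1r.
have A2 : A <= 2 by rewrite -(ler_pM2r a0) Aa; move: a1; clear; lra.
have -> : (2 * a)^-1 = A / 2 by rewrite invfM mulrC.
have K18 : 18 <= K by move: eK e0 e1; clear; nra.
have K1 : 1 <= K by move: K18; clear; lra.
have K0 : 0 <= K by move: K18; clear; lra.
have lamK : 300 * K <= lam.
  have h : K ^+ 3 = K * K * K by ring.
  by move: Kl; rewrite h; move: K18; clear; nra.
have lam1 : 5400 <= lam by move: lamK K18; clear; lra.
have lam0 : 0 <= lam by move: lam1; clear; lra.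
have lam_ge1 : 1 <= lam by move: lam1; clear; lra.
have sl : 1000 * (K * K * lam) <= s.
  apply: (le_trans _ hs).
  have h4 : lam <= lam ^+ 4.
    by rewrite exprS ler_peMr ?exprn_ege1.
  have h5 : K * K <= K ^+ 5.
    have -> : K ^+ 5 = K * K * K ^+ 3 by ring.
    by rewrite ler_peMr ?mulr_ge0 // exprn_ege1.
  apply: ler_wpM2l; first by rewrite ler0n.
  by apply: (ler_pM _ lam0 h5 h4); rewrite mulr_ge0.
have KKl : lam <= K * K * lam by rewrite ler_peMl // mulr_ege1.
have ls : lam <= s.
  by move: sl KKl lam0; clear; move: (K * K * lam) => X; lra.
have s1 : 1 <= s by exact: le_trans ls.
have s0 : 0 <= s by exact: le_trans ler01 s1.
have es : 9000 * (K * lam) <= eps * s.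
  have h : eps * (1000 * (K * K * lam)) <= eps * s by rewrite ler_wpM2l // ltW.
  apply: (le_trans _ h); have -> : eps * (1000 * (K * K * lam)) = eps * K * 1000 * (K * lam) by ring.
  by rewrite eK; move: (K * lam); clear => X; lra.
have Kl1 : 18 <= K * lam by move: K18 lam_ge1; clear; nra.
pose q := s * lam.
have q0 : 0 <= q by rewrite mulr_ge0.
have qs : s <= q by rewrite /q ler_peMr.
have ql : lam <= q by rewrite /q ler_peMl.
have q1 : 1 <= q by exact: le_trans s1 qs.
have as1 : 1 <= a * s / 2.
  have s4 : 4 <= s by apply: (le_trans _ ls); move: lam1; clear; lra.
  by move: a1 s4; clear; nra.
have as0 : 0 <= a * s by rewrite mulr_ge0.
(* Besides [y], [T], [z], [V] and [E = y ^ L] there are [M], which is [x / z], the length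
   [L] of about [4 * lam / (eps * a)], so that [(T / y) ^ L] is below [1 / z ^ 4], and
   [m] with [z <= y ^ m]. *)
have [y /andP[y_gt y_le]] := exists_nat_above_exp as0.
have eas0 : 0 <= (1 - eps) * (a * s) by rewrite mulr_ge0 // subr_ge0; move: e1; clear; lra.
have [T [T0 /andP[T_ge T_le]]] := exists_nat_below_exp eas0.
have [z /andP[z_gt z_le]] := exists_nat_above_exp q0.
have ess0 : 0 <= eps * s ^+ 2 / 8 by rewrite divr_ge0 // mulr_ge0 ?sqr_ge0.
have [V /andP[V_gt V_le]] := exists_nat_above_exp ess0.
have sq0 : 0 <= s ^+ 2 - q.
  by rewrite subr_ge0 expr2 /q ler_wpM2l.
have [M [M0 /andP[M_ge M_le]]] := exists_nat_below_exp sq0.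
have kl0 : 0 <= 4 * A * K * lam / 9 by rewrite !mulr_ge0 //; move: A1; clear; lra.
have [L /andP[L_gt L_le]] := exists_nat_above kl0.
have ml0 : 0 <= 2 * A * lam by rewrite !mulr_ge0 //; move: A1; clear; lra.
have [m /andP[m_gt m_le]] := exists_nat_above ml0.
have Kl0 : 0 <= K * lam by move: Kl1; clear; lra.
have LK : L%:R <= K * lam.
  have h : A * (K * lam) <= 2 * (K * lam) by rewrite ler_wpM2r.
  apply: (le_trans L_le); have -> : 4 * A * K * lam / 9 = 4 / 9 * (A * (K * lam)) by ring.
  by move: h Kl1; clear; lra.
have mK : m%:R <= K * lam.
  have h : A * lam <= 2 * lam by rewrite ler_wpM2r.
  apply: (le_trans m_le); rewrite -mulrA; move: h K18 lam_ge1; clear; nra.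
have LepsA : 4 * lam <= L%:R * (eps * a).
  have h : 4 * A * K * lam / 9 * (eps * a) <= L%:R * (eps * a).
    by rewrite ler_wpM2r ?mulr_ge0 ?(ltW e0) ?(ltW a0) // ltW.
  apply: (le_trans _ h).
  have -> : 4 * A * K * lam / 9 * (eps * a) = 4 * lam * (A * a) * (eps * K) / 9 by field.
  by rewrite Aa eK mulr1; clear; lra.
pose D := (2 * m * L + L + L * L)%N.
pose E := (y ^ L)%N.
have y1 : (1 < y)%N.
  rewrite -(@ltr_nat R); apply: le_lt_trans y_gt; have := expR_ge1Dx (a * s).
  by move: as1; clear; lra.
have y0 : (0 < y)%N by exact: ltnW.
have E0 : (0 < E)%N by rewrite expn_gt0 y0.
have z0 : (0 < z)%N by rewrite -(@ltr_nat R); apply: le_lt_trans z_gt; exact: expR_ge0.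
have V0 : (0 < V)%N by rewrite -(@ltr_nat R); apply: le_lt_trans V_gt; exact: expR_ge0.
have y_ge : expR (a * s) <= y%:R by exact: ltW.
have zy : (z <= y ^ m)%N.
  rewrite -(@ler_nat R) natrX; apply: (le_trans z_le).
  apply: le_trans (expR_mulrn_ge m y_ge); rewrite ler_expR.
  have h : 2 * A * lam * (a * s) <= m%:R * (a * s) by rewrite ler_wpM2r // ltW.
  apply: (le_trans _ h); have -> : 2 * A * lam * (a * s) = 2 * q * (A * a) by rewrite /q; ring.
  by rewrite Aa mulr1; move: q1; clear; lra.
have ZD : (z ^ L * (E * (z * E) ^ L) < y ^ D.+1)%N.
  apply: (@leq_ltn_trans (y ^ D)%N); last by rewrite ltn_exp2l.
  have -> : (y ^ D = (y ^ m) ^ L * (E * (y ^ m * E) ^ L))%N.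
    rewrite /E -!expnD -!expnM -!expnD; congr (y ^ _)%N; rewrite /D; ring.
  by apply: leq_mul; [exact: leq_expl | rewrite leq_mul2l leq_expl ?orbT // leq_mul2r zy orbT].
have dK : (D.+2)%:R <= 5 * (K * lam) ^+ 2.
  rewrite -[D.+2]addn2 /D !natrD !natrM.
  have h1 : m%:R * L%:R <= (K * lam) * (K * lam) by rewrite ler_pM.
  have h2 : L%:R * L%:R <= (K * lam) * (K * lam) by rewrite ler_pM.
  have h3 : K * lam <= K * lam * (K * lam) by rewrite ler_peMr //; move: Kl1; clear; lra.
  rewrite expr2; move: h1 h2 h3 LK Kl1; clear; move: (K * lam) (L%:R) (m%:R) => X l' m'.
  move=> h1 h2 h3 h4 h5; have -> : 2 * m' * l' = 2 * (m' * l') by ring.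
  by lra.
have tl := trunc_log_ln2 T0 T_le; rewrite -aE in tl.
set t := (trunc_log 2 T)%:R in tl.
have t0 : 0 <= t by rewrite ler0n.
have VM : (V ^ 2 * (y ^ trunc_log 2 T * z ^ (D.+2 * L)) <= M)%N.
  rewrite -(@ler_nat R); apply: (le_trans _ M_ge).
  rewrite !natrM !natrX.
  have h1 := expR_mulrn_le 2 (ler0n _ _) V_le.
  have h2 := expR_mulrn_le (trunc_log 2 T) (ler0n _ _) y_le.
  have h3 := expR_mulrn_le (D.+2 * L) (ler0n _ _) z_le.
  apply: le_trans (ler_pM _ _ h1 (ler_pM _ _ h2 h3)) _; rewrite ?mulr_ge0 ?exprn_ge0 //.
  rewrite -!expRD ler_expR natrM -/t.
  have atl : a * t <= (1 - eps) * s.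
    have : a * (a * t) <= a * ((1 - eps) * s).
      by rewrite mulrA -expr2 mulrC; apply: (le_trans tl); rewrite mulrCA.
    by rewrite ler_pM2l.
  have a12 : 1 / 2 <= a <= 1 by rewrite a1.
  have Lb : 0 <= (L%:R : R) <= K * lam by rewrite ler0n.
  have Db : 0 <= (D.+2%:R : R) <= 5 * (K * lam) ^+ 2 by rewrite ler0n.
  have := large_prime_budget a12 e0 eK K18 lam_ge1 hs t0 atl Lb Db.
  rewrite -/q; clear; move: (t * _) (_ * _ * (q + 1)) (s ^+ 2) => X1 X2 X3 h.
  have -> : 2 * (eps * X3 / 8 + 1) = eps * X3 / 4 + 2 by field.
  by move: (eps * X3 / 4) h => X4; lra.
have x0 : 0 < x by rewrite xE expR_gt0.
have x1 : 1 <= x by rewrite xE; have := expR_ge1Dx (s ^+ 2); have := sqr_ge0 s; clear; lra.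
set N := Num.truncn x.
have N0 : (0 < N)%N by rewrite truncn_gt0.
have Nx : N%:R <= x by rewrite truncn_le ltW.
have lnN : ln N%:R <= s ^+ 2.
  by rewrite -[leRHS]expRK -xE ler_ln ?posrE // ltr0n.
have exp_lam1 : 1 + s ^+ 2 <= expR (lam + 1).
  have h1 : 1 <= expR lam by have := expR_ge1Dx lam; move: lam0; clear; lra.
  by rewrite sE expRD; have := expR1_ge2 R; move: h1; clear; nra.
have lam_2lam : expR (lam + 1) <= expR (2 * lam).
  by rewrite ler_expR; move: lam_ge1; clear; lra.
have HN : harm R N <= expR (2 * lam).
  apply: (le_trans _ lam_2lam); apply: (le_trans _ exp_lam1); apply: (le_trans (harm_le_ln R N0)).
  by rewrite lerD2l.
have lN : (trunc_log 2 N)%:R <= expR (2 * lam) :> R.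
  have h : N%:R <= expR (s ^+ 2) by rewrite -xE.
  have := trunc_log_ln2 N0 h; have /andP[l1 _] := ln2_bounds R => h'.
  apply: (le_trans _ lam_2lam); rewrite expRD -sE.
  have h2 : (trunc_log 2 N)%:R <= 2 * s ^+ 2.
    have t' : 0 <= (trunc_log 2 N)%:R :> R by rewrite ler0n.
    by move: h' l1 t'; clear; nra.
  by apply: (le_trans h2); rewrite mulrC ler_wpM2l ?sqr_ge0 // expR1_ge2.
set H := harm R N in HN *; set l := (trunc_log 2 N)%:R in lN *.
have H0 : 0 <= H := harm_ge0 R N.
have l0 : 0 <= l by rewrite ler0n.
(* The order [j] of the moment is limited by [2 ^ j <= eps * s], as the harmonic sum enters
   with this exponent. *)
pose n0 := Num.truncn (eps * s).
have lam_le_Kl : lam <= K * lam by rewrite ler_peMl.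
have es1 : 1 <= eps * s by move: es Kl1; clear; lra.
have n00 : (0 < n0)%N by rewrite truncn_gt0.
pose j := trunc_log 2 n0.
have j_le : ((2 ^ j)%N%:R : R) <= eps * s.
  apply: le_trans (_ : (n0%:R : R) <= _); last by rewrite truncn_le mulr_ge0.
  by rewrite ler_nat; exact: trunc_logP.
have j_ge : lam / 2 - K <= (j%:R + 1) * a ^+ 2.
  have h : eps * s <= 2 ^+ j.+1.
    apply: ltW; apply: (lt_le_trans (truncnS_gt _)).
    by rewrite -natrX ler_nat; exact: trunc_log_ltn.
  have : ln (eps * s) <= (j%:R + 1) * a ^+ 2.
    have es_gt0 : 0 < eps * s by exact: lt_le_trans es1.
    by rewrite aE natr1 -ler_expR expRM_natl (lnK es_gt0) lnK // posrE.
  apply: le_trans; rewrite lnM ?posrE ?(lt_le_trans _ s1) //.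
  have lns : ln s = lam / 2.
    have : ln (s ^+ 2) = lam by rewrite sE expRK.
    by rewrite lnXn ?(lt_le_trans _ s1) // mulr2n; clear; lra.
  rewrite lns; have := ln_ge_1BV e0.
  have -> : eps^-1 = K / 9.
    apply: (mulfI (lt0r_neq0 e0)); rewrite mulfV ?lt0r_neq0 // mulrA eK divff //.
  by move: K1; clear; lra.
have cnt := @sylow_count_le R N M y z V T E L D j y1 E0 z0 T0 V0 ZD VM.
rewrite sylow_countE ?(ltW x0) // -/N; apply: (le_trans cnt).
rewrite -/H -/l.
pose Bd : R := expR (- (A / 2 - 6 * eps) * q).
have b1 : M%:R <= x * Bd.
  apply: (le_trans M_le); rewrite xE -expRD ler_expR lerD2l.
  rewrite mulNr lerN2; have h : (A / 2 - 6 * eps) <= 1 by move: A2 e0; clear; lra.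
  by rewrite -[leRHS]mul1r ler_wpM2r.
have le_q : - q <= - (A / 2 - 6 * eps) * q.
  rewrite mulNr lerN2 -[leRHS]mul1r ler_wpM2r //; move: A2 e0; clear; lra.
have b2 : H ^+ (2 ^ j) * H ^+ (2 ^ j) / T%:R ^+ j <= Bd.
  have h1 : H ^+ (2 ^ j) <= expR (eps * s * (2 * lam)).
    apply: (le_trans (expR_mulrn_le _ H0 HN)); rewrite ler_expR ler_wpM2r //.
    by rewrite mulr_ge0.
  have h2 := expR_mulrn_ge j T_ge.
  have Tj : 0 < (T%:R : R) ^+ j by rewrite exprn_gt0 // ltr0n.
  rewrite ler_pdivrMr //.
  apply: (le_trans (ler_pM _ _ h1 h1)); rewrite ?exprn_ge0 //.
  apply: (@le_trans _ _ (Bd * expR (j%:R * ((1 - eps) * (a * s) - 1)))); last first.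
    by rewrite ler_wpM2l ?expR_ge0.
  rewrite /Bd -!expRD ler_expR.
  have A12 : 1 <= A <= 2 by rewrite A1.
  have e01 : 0 < eps <= 1 / 2 by rewrite e0.
  have := tau_budget Aa A12 e01 eK K18 Kl s1 ls a2 as1 j_ge; rewrite -/q.
  have -> : eps * s * (2 * lam) = 2 * (eps * q) by rewrite /q; ring.
  by clear; move: (- _ * q) (j%:R * _) (eps * q) => X Y Z; lra.
have Hl : 4 * lam + 2 <= eps * s * (a / 2).
  have h : 9000 * lam <= eps * s by move: es lam_le_Kl; clear; lra.
  by move: h lam_ge1 a1; clear; nra.
have b3 : 2 / V%:R * H <= Bd.
  have V_ge := ltW V_gt.
  have V0R : 0 < (V%:R : R) by rewrite ltr0n.
  rewrite mulrAC ler_pdivrMr //.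
  apply: le_trans (ler_pM _ H0 (expR1_ge2 R) HN) _ => //.
  apply: (@le_trans _ _ (Bd * expR (eps * s ^+ 2 / 8))); last by rewrite ler_wpM2l ?expR_ge0.
  rewrite /Bd -!expRD ler_expR.
  have h : 9000 * (lam * s) <= eps * s ^+ 2.
    have -> : 9000 * (lam * s) = 9000 * lam * s by ring.
    have -> : eps * s ^+ 2 = eps * s * s by ring.
    by rewrite ler_wpM2r //; move: es lam_le_Kl; clear; lra.
  move: le_q h ql q1 lam0; rewrite [lam * s]mulrC -/q; clear.
  by move: (- _ * q) (eps * s ^+ 2) => X Y; lra.
have gain : - q + (4 * lam + 2) <= - (A / 2 - 6 * eps) * q.
  have h : 4 * lam + 2 <= eps * q.
    have h9 : 9000 <= eps * s by apply: (le_trans _ es); move: Kl1; clear; lra.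
    have -> : eps * q = eps * s * lam by rewrite /q; ring.
    by move: h9 lam_ge1; clear; nra.
  have h2 : A / 2 * q <= q by rewrite -[leRHS]mul1r ler_wpM2r //; move: A2; clear; lra.
  have -> : - (A / 2 - 6 * eps) * q = - (A / 2 * q) + 6 * (eps * q) by ring.
  have eq0 : 0 <= eps * q by rewrite mulr_ge0.
  by move: h h2 eq0; clear; move: (A / 2 * q) (eps * q) => X Y; lra.
have b4 : 2 / z.+1%:R * H ^+ 2 <= Bd.
  have z_ge : expR q <= z.+1%:R by apply: ltW; apply: (lt_trans z_gt); rewrite ltr_nat.
  rewrite mulrAC ler_pdivrMr ?ltr0n //.
  apply: le_trans (ler_pM _ _ (expR1_ge2 R) (expR_mulrn_le 2 H0 HN)) _; rewrite ?exprn_ge0 //.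
  apply: (@le_trans _ _ (Bd * expR q)); last by rewrite ler_wpM2l ?expR_ge0.
  rewrite /Bd -!expRD ler_expR; move: gain lam0; clear.
  by move: (- _ * q) => X; lra.
have yV : (y%:R : R)^-1 <= expR (- (a * s)).
  by rewrite expRN lef_pV2 ?posrE ?expR_gt0 // ltr0n.
have yV0 : 0 <= (y%:R : R)^-1 by rewrite invr_ge0 ler0n.
have T0R : 0 <= (T%:R : R) by rewrite ler0n.
have Ls : 4 * q <= L%:R * (eps * (a * s)).
  have -> : L%:R * (eps * (a * s)) = L%:R * (eps * a) * s by ring.
  have -> : 4 * q = 4 * lam * s by rewrite /q; ring.
  by rewrite ler_wpM2r.
have b5 : H * (T%:R * l / y%:R) ^+ L <= Bd.
  have h : T%:R * l / y%:R <= expR ((1 - eps) * (a * s) + 2 * lam - a * s).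
    rewrite !expRD; apply: ler_pM => //; first by rewrite mulr_ge0.
    by rewrite ler_pM.
  have h0 : 0 <= T%:R * l / y%:R by rewrite !mulr_ge0.
  apply: le_trans (ler_pM _ _ HN (expR_mulrn_le L h0 h)) _; rewrite ?exprn_ge0 //.
  rewrite /Bd -expRD ler_expR; apply: (le_trans _ gain).
  have -> : L%:R * ((1 - eps) * (a * s) + 2 * lam - a * s) =
     L%:R * (2 * lam - eps * s * (a / 2)) - L%:R * (eps * (a * s)) / 2 by field.
  have h1 : L%:R * (2 * lam - eps * s * (a / 2)) <= 0.
    by rewrite mulr_ge0_le0 // subr_le0; move: Hl lam0; clear; lra.
  by move: h1 Ls q0 lam0; clear; move: (L%:R * (2 * lam - _)) (L%:R * (eps * _)) => X Y; lra.
have b6 : T%:R ^+ L * 2 ^+ (L * L) * (H ^+ 2 *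
     ((l / y%:R) ^+ L + L%:R * (2 / E%:R) * H ^+ L)) <= Bd.
  have h1 : (l / y%:R) ^+ L <= expR (L%:R * (2 * lam - a * s)).
    by apply: expR_mulrn_le; rewrite ?mulr_ge0 // expRD ler_pM.
  have EV : (E%:R : R)^-1 <= expR (- (L%:R * (a * s))).
    rewrite expRN lef_pV2 ?posrE ?expR_gt0 ?ltr0n // /E natrX.
    exact: expR_mulrn_ge.
  have h2 : L%:R * (2 / E%:R) * H ^+ L <= expR (L%:R + 1 + L%:R * (2 * lam - a * s)).
    have -> : L%:R + 1 + L%:R * (2 * lam - a * s) =
      L%:R + (1 + - (L%:R * (a * s))) + L%:R * (2 * lam) by ring.
    rewrite !expRD; apply: ler_pM; rewrite ?exprn_ge0 ?mulr_ge0 ?invr_ge0 ?ler0n //; last first.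
      exact: expR_mulrn_le.
    apply: ler_pM; rewrite ?divr_ge0 ?ler0n //; first exact: natr_le_exp.
    by apply: ler_pM; rewrite ?invr_ge0 ?ler0n // expR1_ge2.
  have h3 : (l / y%:R) ^+ L + L%:R * (2 / E%:R) * H ^+ L <=
      expR (L%:R + 2 + L%:R * (2 * lam - a * s)).
    have h12 : (l / y%:R) ^+ L <= expR (L%:R + 1 + L%:R * (2 * lam - a * s)).
      by apply: (le_trans h1); rewrite ler_expR lerDr addr_ge0.
    apply: (le_trans (lerD h12 h2)).
    have -> : L%:R + 2 + L%:R * (2 * lam - a * s) =
       (L%:R + 1 + L%:R * (2 * lam - a * s)) + 1 by ring.
    rewrite [leRHS]expRD; move: (expR (L%:R + 1 + _)) (expR_ge0 (L%:R + 1 + L%:R * (2 * lam - a * s))) (expR1_ge2 R).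
    by clear => X X0 h; nra.
  have h4 := expR_mulrn_le 2 H0 HN.
  have h5 := expR_mulrn_le L T0R T_le.
  have h6 : (2 : R) ^+ (L * L) <= expR ((L * L)%:R * 1).
    by apply: expR_mulrn_le => //; exact: expR1_ge2.
  have nn : 0 <= (l / y%:R) ^+ L + L%:R * (2 / E%:R) * H ^+ L.
    by rewrite addr_ge0 ?mulr_ge0 ?exprn_ge0 ?mulr_ge0 ?invr_ge0 ?ler0n.
  apply: le_trans (ler_pM _ _ (ler_pM _ _ h5 h6) (ler_pM _ _ h4 h3)) _;
    rewrite ?mulr_ge0 ?exprn_ge0 //.
  rewrite -!expRD /Bd ler_expR natrM; apply: (le_trans _ gain).
  have -> : L%:R * ((1 - eps) * (a * s)) + L%:R * L%:R * 1 + (2%:R * (2 * lam) +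
       (L%:R + 2 + L%:R * (2 * lam - a * s))) =
     L%:R * (L%:R + 1 + 2 * lam - eps * s * (a / 2)) - L%:R * (eps * (a * s)) / 2 +
      (4 * lam + 2) by field.
  have h7 : L%:R * (L%:R + 1 + 2 * lam - eps * s * (a / 2)) <= 0.
    rewrite mulr_ge0_le0 // subr_le0.
    have h8 : 4500 * (K * lam) <= eps * s * (a / 2) * 2.
      by move: es a1 Kl1; clear; nra.
    by move: h8 lam_le_Kl LK Kl1; clear; lra.
  by move: h7 Ls q0; clear; move: (L%:R * (L%:R + 1 + _ - _)) (L%:R * (eps * _)) => X Y; lra.
have total : M%:R + N%:R * (H ^+ (2 ^ j) * H ^+ (2 ^ j) / T%:R ^+ j + 2 / V%:R * H
      + 2 / z.+1%:R * H ^+ 2 + H * (T%:R * l / y%:R) ^+ L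
      + T%:R ^+ L * 2 ^+ (L * L) * (H ^+ 2 *
          ((l / y%:R) ^+ L + L%:R * (2 / E%:R) * H ^+ L))) <= x * (6 * Bd).
  have B0 : 0 <= Bd by exact: expR_ge0.
  apply: (@le_trans _ _ (x * Bd + x * (5 * Bd))); last first.
    by rewrite -mulrDr ler_wpM2l ?(ltW x0) //; move: B0; clear; lra.
  apply: lerD b1 _.
  apply: (@le_trans _ _ (N%:R * (5 * Bd))).
    rewrite ler_wpM2l ?ler0n //.
    by move: b2 b3 b4 b5 b6; clear; move: (_ / T%:R ^+ j) (_ * H) (_ * H ^+ 2) (H * _) (_ * (H ^+ 2 * _)) => X1 X2 X3 X4 X5; lra.
  by rewrite ler_wpM2r // mulr_ge0.
apply: (le_trans total); rewrite ler_wpM2l ?(ltW x0) //.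
have -> : - (A / 2 - 7 * eps) * (s * lam) = eps * q + - (A / 2 - 6 * eps) * q by rewrite /q; ring.
rewrite expRD ler_wpM2r ?expR_ge0 //.
have h9 : 9000 * 18 <= eps * q.
  have h : 9000 * 18 <= eps * s by apply: (le_trans _ es); move: Kl1; clear; lra.
  by apply: (le_trans h); rewrite ler_wpM2l // ltW.
by have := expR_ge1Dx (eps * q); move: h9; clear; lra.
Qed.

(** * Asymptotics of the lower bound *)

Lemma double_bin2 (n : nat) : (2 * 'C(n, 2) + n = n * n)%N.
Proof. by elim: n => // n IH; rewrite binS bin1; lia. Qed.

(** For [r = e * H] the quadratic form [H * r + 'C(H, 2)] changes only by terms of order
    [i ^ 2] under [H := H + i], [r := r - e.+1 * i], because its derivative in this direction
    vanishes.  So a coarse choice of [H] followed by [i] of order [sqrt H] meets a given [g]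
    up to an error of order [sqrt H]. *)
Lemma quadratic_hit (e g : nat) : (0 < e)%N -> exists H i : nat,
  [/\ (g < e * (H * H) + 'C(H, 2))%N,
      (e * (H * H) + 'C(H, 2) <= g + (2 * e + 1) * H)%N,
      (e * (H * H) + 'C(H, 2) + 'C(i, 2) <= g + e.+1 * (i * i))%N,
      (g + e.+1 * (i * i) <=
         e * (H * H) + 'C(H, 2) + 'C(i, 2) + (2 * e + 2) * i)%N
    & (i.-1 * i.-1 <= 2 * H)%N].
Proof.
move=> e0.
have exH : exists H, (g < e * (H * H) + 'C(H, 2))%N.
  exists g.+1; nia.
case: (ex_minnP exH) => H HP Hmin; exists H.
have exi : exists i, (e * (H * H) + 'C(H, 2) + 'C(i, 2) <= g + e.+1 * (i * i))%N.
  exists (e * (H * H) + 'C(H, 2))%N.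
  move: (_ + 'C(H, 2))%N => n; have := double_bin2 n; move: ('C(n, 2)) => c h.
  nia.
case: (ex_minnP exi) => i iP imin; exists i.
have H0 : (0 < H)%N by case: H HP {Hmin exi iP imin} => //; rewrite !mul0n muln0.
have hH : (e * (H * H) + 'C(H, 2) <= g + (2 * e + 1) * H)%N.
  case: H H0 HP Hmin {exi iP imin} => // H _ _ Hmin.
  have : ~~ (g < e * (H * H) + 'C(H, 2))%N by apply/negP => /Hmin; rewrite ltnn.
  rewrite -leqNgt binS bin1; move: ('C(H, 2)) => c h; nia.
have i0 : (0 < i)%N.
  case: i iP {imin} => // iP; move: HP iP; rewrite bin0n; lia.
have hi : (g + e.+1 * (i.-1 * i.-1) < e * (H * H) + 'C(H, 2) + 'C(i.-1, 2))%N.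
  rewrite ltnNge; apply/negP => /imin; lia.
split=> //.
- case: i i0 hi {iP imin} => // i _ /=; rewrite binS bin1.
  move: (_ + 'C(H, 2))%N ('C(i, 2)) => n c h; nia.
- case: i i0 hi {iP imin} => // i _ /=.
  have := double_bin2 i; move: ('C(i, 2)) => c.
  move: hH; move: (_ + 'C(H, 2))%N => n h1 h2 h3; nia.
Qed.

(** The case [m = b * (e + 2)] with [H + i] blocks starting at [H0 = e * H - e.+1 * i - 1].
    Then there are about [b * (e + 2) * H] positions with primes below
    [2 ^ (b * (e + 1) * H)]: the excess [b * H] of the first number over the logarithm of the
    second pays for the polynomial losses in [k]. *)
Lemma sylow_count_ge_blocks (b e H i N : nat) :
  let F := (e * (H * H) + 'C(H, 2) + 'C(i, 2) - e.+1 * (i * i))%N in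
  (0 < b)%N -> (6 <= e)%N -> (30 <= H)%N -> ((e + 5) * i <= H)%N ->
  (8 * (b * (e + 2) * H) + 1 <= 2 ^ b)%N ->
  (2 ^ (b * (b * (e + 2)) * F) <= N)%N ->
  (2 ^ (b * (b * (e + 2)) * F) <=
     2 * (4 * (b * e.+1 * H) * (b * (e + 2))) ^ (b * (e + 2) * (H + i)) *
     \sum_(1 <= n < N.+1 | is_sylow n) 1)%N.
Proof.
move=> F b0 e6 H30 iH Hb.
pose H0 := (e * H - e.+1 * i).-1; pose k := (b * (e + 2) * (H + i))%N.
pose tt := (b * (H0 + (H + i)))%N.
have i_le : (11 * i <= H)%N.
  by apply: leq_trans iH; rewrite leq_mul2r; apply/orP; right; lia.
have ei : (e.+1 * i + 4 * i <= H)%N by rewrite -mulnDl addSn -addnS.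
have eH : (6 * H <= e * H)%N by rewrite leq_mul2r e6 orbT.
have H0e : (H0.+1 + e.+1 * i = e * H)%N by rewrite /H0; move: ei eH H30; clear; lia.
have H0_ge : (4 * (H + i) + 25 <= H0)%N by move: ei eH H30 H0e; clear; lia.
have sum_le : (H0 + (H + i) <= e.+1 * H)%N by rewrite mulSn; move: H0e; clear; nia.
have tt_le : (tt <= b * e.+1 * H)%N by rewrite /tt -mulnA leq_mul2l sum_le orbT.
have k_ge : (tt + b * H <= k)%N.
  rewrite /tt /k -mulnDr -mulnA leq_mul2l; apply/orP; right.
  by move: sum_le; rewrite mulSn mulnDr !mulnDl; clear; lia.
have k_lt : (k.+1 <= 2 ^ b)%N.
  by apply: leq_trans Hb; rewrite /k; move: (b * (e + 2))%N i_le; clear; nia.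
have FE : ((H + i) * H0.+1 + 'C(H + i, 2) = F)%N.
  have h1 := double_bin2 H; have h2 := double_bin2 i; have h3 := double_bin2 (H + i).
  have hF : (e * (H * H) + 'C(H, 2) + 'C(i, 2) = F + e.+1 * (i * i))%N.
    rewrite /F subnK // -addnA; apply: leq_trans (leq_addr _ _).
    by rewrite [leqLHS]mulnA [leqRHS]mulnA; apply: leq_mul; move: ei i_le eH; clear; lia.
  have h4 : (e.+1 * i * (H + i) + (H + i) * H0.+1 = e * H * (H + i))%N by rewrite -H0e; ring.
  move: h1 h2 h3 hF h4; rewrite -(addn1 e).
  by move: (F) (H0.+1) ('C(H, 2)) ('C(i, 2)) ('C(H + i, 2)); clear; nia.
have bH : (30 * b <= b * H)%N by rewrite mulnC leq_mul2l H30 orbT.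
have H0b : (b * (4 * (H + i) + 25) <= b * H0)%N by rewrite leq_mul2l H0_ge orbT.
have k2b : (k <= 2 ^ b)%N by exact: ltnW.
have cnt := @sylow_count_ge b (b * (e + 2)) (H + i) H0 N b0.
rewrite -/k -/tt FE in cnt.
move=> FN; apply: leq_trans (cnt _ _ _ _ _ FN) _.
- by move: k_ge bH b0; clear; lia.
- apply: leq_trans Hb.
  have : (b * e.+1 * H <= b * (e + 2) * H)%N.
    by rewrite leq_mul2r leq_mul2l addn2 leqnSn !orbT.
  by move: tt_le; clear; lia.
- apply: (@leq_trans (2 ^ (6 + b * 2))); last first.
    by rewrite leq_exp2l //; move: H0b b0; clear; nia.
  by rewrite expnD expnM leq_mul // leq_exp2r.
- apply: (@leq_trans (2 ^ (6 + (b + tt + b * 14)))); last first.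
    by rewrite leq_exp2l //; move: k_ge bH b0; clear; nia.
  rewrite !expnD [(2 ^ (b * 14))%N]expnM leq_mul // !leq_mul // leq_exp2r //.
- apply: (@leq_trans (2 ^ (19 + (b * 6 + tt * 4)))); last first.
    by rewrite -expnM leq_exp2l // /tt; move: H0b b0; clear; nia.
  rewrite expnD; apply: leq_mul; first exact: leqnn.
  by rewrite expnD !expnM; apply: leq_mul; [rewrite leq_exp2r | exact: leqnn].
- rewrite leq_mul2r; apply/orP; right; rewrite leq_mul2l /=.
  by apply: leq_expl; rewrite leq_mul2r leq_mul2l tt_le !orbT.
Qed.

(** Here [u] is [a] times the number of positions, and the hypothesis says that the total
    exponent is within [s ^ 2] up to a linear error term. *)
Lemma block_length_le (R : realType) (e a b u s : R) :
  6 <= e -> 0 <= a <= 1 -> 0 <= b -> 0 < s -> (2 * e + 2) * (e + 2) * b <= s -> 0 <= u ->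
  (e + 1 / 2) * u ^+ 2 - (2 * e + 2) * (e + 2) * b * a * u <= (e + 2) * s ^+ 2 ->
  u <= (1 + 4 * e^-1) * s.
Proof.
move=> e6 /andP[a0 a1] b0 s0 hb u0 h.
have e0 : 0 < e by lra.
have V0 : 0 < e^-1 by rewrite invr_gt0.
have V1 : e^-1 * e = 1 by rewrite mulVf ?lt0r_neq0.
rewrite leNgt; apply/negP => hu.
have su : s <= u by apply: ltW; apply: le_lt_trans hu; move: V0 s0; clear; nra.
have h1 : (2 * e + 2) * (e + 2) * b * a * u <= u ^+ 2.
  rewrite expr2 ler_wpM2r //; apply: le_trans su; apply: le_trans hb.
  by rewrite ler_piMr // !mulr_ge0 //; move: e6; clear; lra.
have h2 : (e - 1 / 2) * u ^+ 2 <= (e + 2) * s ^+ 2.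
  by move: h h1; clear; move: (_ * a * u) (u ^+ 2) => X Y; lra.
have h3 : (1 + 8 * e^-1) * s ^+ 2 <= u ^+ 2.
  apply: (@le_trans _ _ (((1 + 4 * e^-1) * s) ^+ 2)); last first.
    by rewrite ler_sqr ?nnegrE ?(ltW hu) // mulr_ge0 ?(ltW s0) // addr_ge0 ?mulr_ge0 ?(ltW V0).
  rewrite exprMn ler_wpM2r ?sqr_ge0 //; have := sqr_ge0 e^-1.
  by clear; move: e^-1 => V; nra.
have h4 : (e + 5) * s ^+ 2 <= (e - 1 / 2) * u ^+ 2.
  apply: (@le_trans _ _ ((e - 1 / 2) * ((1 + 8 * e^-1) * s ^+ 2))); last first.
    by rewrite ler_wpM2l //; move: e6; clear; lra.
  rewrite [leRHS]mulrA ler_wpM2r ?sqr_ge0 //; move: V0 V1 e6; clear; nra.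
have : 0 < s ^+ 2 by rewrite exprn_gt0.
by move: h2 h4; clear; move: (s ^+ 2) (_ * u ^+ 2) => X Y; lra.
Qed.

(** The base [b] of the blocks is about [4 * lam], so that [2 ^ b] exceeds all powers of [s]
    needed.  A multiple of [b * k] in the exponent would be as large as the main term; the
    exponent is therefore fitted to [log_2 x] by [quadratic_hit]. *)
Lemma sylow_count_lower (R : realType) (e : nat) (lam t s x : R) :
  (6 <= e)%N -> 100 * e%:R ^+ 2 <= lam -> 2000 * e%:R ^+ 3 * lam <= t ->
  s = t ^+ 2 -> s ^+ 2 = expR lam -> x = expR (s ^+ 2) ->
  x * expR (- ((2 * Num.sqrt (ln 2))^-1 + 11 / e%:R) * (s * lam)) <=
    (sylow_count x)%:R.
Proof.
move=> e6; set E : R := e%:R => lamE tE st sE xE.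
have E6 : 6 <= E by rewrite ler_nat.
have E0 : 0 < E by move: E6; clear; lra.
have d0 : 0 < E^-1 by rewrite invr_gt0.
have dE : E^-1 * E = 1 by rewrite mulVf ?lt0r_neq0.
have d6 : E^-1 <= 1 / 6 by move: d0 dE E6; clear; nra.
have E2 : 36 <= E ^+ 2 by move: E6; clear; nra.
have E3 : 6 * E ^+ 2 <= E ^+ 3 by rewrite exprS ler_wpM2r ?sqr_ge0.
have lam1 : 3600 <= lam by move: lamE E2; clear; lra.
have lam0 : 0 <= lam by move: lam1; clear; lra.
have El : 0 <= E ^+ 3 * lam by rewrite mulr_ge0 // exprn_ge0 // ltW.
have E2l : 6 * (E ^+ 2 * lam) <= E ^+ 3 * lam by rewrite mulrA ler_wpM2r.
have El1 : 36 * lam <= E ^+ 2 * lam by rewrite ler_wpM2r.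
have tE' : 2000 * (E ^+ 3 * lam) <= t by rewrite mulrA.
have t1 : 1000 <= t by move: tE' E2l El1 lam1; clear; lra.
have t0 : 0 < t by move: t1; clear; lra.
have s0 : 0 < s by rewrite st exprn_gt0.
have s1 : 1000 * t <= s by rewrite st expr2 ler_wpM2r // ltW.
have ts : 2000 * (E ^+ 3 * lam) * t <= s by rewrite st expr2 ler_wpM2r // ltW.
have [a1 a2 aE] := sqrt_ln2_bounds R.
set a := Num.sqrt (ln 2 : R) in a1 a2 aE *.
have a0 : 0 < a by move: a1; clear; lra.
have sl : s = expR (lam / 2).
  have : s ^+ 2 = (expR (lam / 2)) ^+ 2.
    by rewrite sE -expRM_natl; congr expR; field.
  by move/eqP; rewrite eqrXn2 ?expR_ge0 ?(ltW s0) // => /eqP.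
have [b /andP[b_gt b_le]] : exists b : nat, 4 * lam < b%:R <= 4 * lam + 1.
  by apply: exists_nat_above; move: lam0; clear; lra.
have b1 : 1 <= (b%:R : R) by move: b_gt lam1; clear; lra.
have b0 : (0 < b)%N by rewrite -(ltr0n R); move: b1; clear; lra.
have b5 : b%:R <= 5 * lam by move: b_le lam1; clear; lra.
have x0 : 0 < x by rewrite xE expR_gt0.
have x1 : 1 <= x by rewrite xE; have := expR_ge1Dx (s ^+ 2); have := sqr_ge0 s; clear; lra.
pose N := Num.truncn x.
have N0 : (0 < N)%N by rewrite truncn_gt0.
pose L := trunc_log 2 N.
have LN : (2 ^ L <= N)%N by exact: trunc_logP.
have sL : s ^+ 2 <= (L.+1)%:R * ln 2.
  rewrite -ler_expR -xE expRM_natl lnK ?posrE //.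
  apply: ltW; apply: (lt_le_trans (truncnS_gt _)).
  by rewrite -natrX ler_nat; exact: trunc_log_ltn.
have Ls : L%:R * ln 2 <= s ^+ 2.
  by apply: trunc_log_ln2; rewrite // -xE truncn_le ltW.
pose P := (b * (b * (e + 2)))%N; pose g := (L %/ P)%N.
have P0 : (0 < P)%N by rewrite !muln_gt0 b0 addn2.
have [H [i [gH Hg iF iG iH]]] := quadratic_hit g (ltn_trans (ltn0Sn 4) e6).
have PL : (P * g <= L)%N by rewrite mulnC leq_trunc_div.
have LP : (L < P * g.+1)%N by rewrite mulnC ltn_ceil.
pose kap : R := b%:R * (E + 2) * H%:R.
have PR : (P%:R : R) = b%:R * (b%:R * (E + 2)) by rewrite !natrM natrD.
have k0 : 0 <= kap by rewrite !mulr_ge0 ?ler0n // addr_ge0 // ltW.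
have bin2H := double_bin2 H.
have bPos : 0 <= (b%:R : R) by rewrite ler0n.
have Eb : (2 * E + 2) * (E + 2) * b%:R <= s.
  apply: (@le_trans _ _ (20 * (E ^+ 2 * lam))); last first.
    by move: ts E2l t1 El; clear; move: (E ^+ 2 * lam) (E ^+ 3 * lam) => X Y; nra.
  apply: (@le_trans _ _ (4 * E ^+ 2 * (5 * lam))); last by rewrite mulrACA; clear; lra.
  by apply: ler_pM; rewrite ?mulr_ge0 //; move: E6; clear; nra.
(* [kap] is the number of positions for [i = 0]; it lies between [s] and [(1 + 4 / e) * s / a]. *)
have kap_le : a * kap <= (1 + 4 * E^-1) * s.
  apply: (@block_length_le R E a b%:R) => //; rewrite ?a2 ?(ltW a0) //.
    by rewrite mulr_ge0 ?(ltW a0).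
  have Hg' : (2 * E + 1) * H%:R ^+ 2 <= 2 * g%:R + (4 * E + 3) * H%:R.
    have : (((2 * e + 1) * (H * H))%N%:R : R) <= (2 * g + (4 * e + 3) * H)%N%:R.
      by rewrite ler_nat; move: Hg bin2H; clear; lia.
    by rewrite !(natrD, natrM) -expr2.
  have Pg : P%:R * g%:R * a ^+ 2 <= s ^+ 2.
    apply: le_trans Ls; rewrite -aE -natrM.
    by apply: ler_wpM2r; [exact: sqr_ge0 | rewrite ler_nat].
  have w0 : 0 <= P%:R * a ^+ 2 by rewrite mulr_ge0 ?sqr_ge0.
  have := ler_wpM2l w0 Hg'.
  have E20 : 0 <= E + 2 by move: E0; clear; lra.
  move=> h.
  have -> : (E + 1 / 2) * (a * kap) ^+ 2 - (2 * E + 2) * (E + 2) * b%:R * a * (a * kap) =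
    (E + 2) / 2 * (P%:R * a ^+ 2 * ((2 * E + 1) * H%:R ^+ 2)
       - (4 * E + 4) * (P%:R * a ^+ 2 * H%:R)) by rewrite PR /kap; field.
  have -> : (E + 2) * s ^+ 2 = (E + 2) / 2 * (2 * s ^+ 2) by field.
  rewrite ler_wpM2l ?divr_ge0 //.
  have w1 : 0 <= P%:R * a ^+ 2 * H%:R by rewrite mulr_ge0.
  move: h Pg w1; clear; rewrite mulrDr.
  have -> : P%:R * a ^+ 2 * (2 * g%:R) = 2 * (P%:R * g%:R * a ^+ 2) by ring.
  have -> : P%:R * a ^+ 2 * ((4 * E + 3) * H%:R) =
     (4 * E + 4) * (P%:R * a ^+ 2 * H%:R) - P%:R * a ^+ 2 * H%:R by ring.
  move: (P%:R * a ^+ 2 * H%:R) => X4.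
  move: (P%:R * a ^+ 2 * _) (_ * g%:R * _) (_ * X4) => X1 X2 X3.
  by lra.
have kap_ge : s <= kap.
  rewrite -ler_sqr ?nnegrE ?(ltW s0) //; apply: (le_trans sL).
  apply: (@le_trans _ _ (L.+1%:R * 1)).
    by rewrite ler_wpM2l -?aE // expr_le1 // ltW.
  apply: (@le_trans _ _ (P * (e.+1 * (H * H)))%N%:R).
    rewrite mulr1 ler_nat; apply: (leq_trans LP); rewrite leq_mul2l; apply/orP; right.
    by move: gH bin2H; clear; nia.
  rewrite natrM PR !natrM -(natr1 e) -/E /kap !exprMn.
  have -> : b%:R * (b%:R * (E + 2)) * ((E + 1) * (H%:R * H%:R)) =
    b%:R ^+ 2 * ((E + 2) * (E + 1)) * H%:R ^+ 2 by ring.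
  rewrite ler_wpM2r ?sqr_ge0 // ler_wpM2l ?sqr_ge0 // expr2 ler_wpM2l //; move: E6; clear; lra.
have kap4 : kap <= 4 * s by move: kap_le kap_ge a1 d6 d0 s0; clear; nra.
have Ht : 100 * (E ^+ 2 * t) <= H%:R.
  have lE : 0 < lam * E by rewrite mulr_gt0 //; move: lam1; clear; lra.
  rewrite -(ler_pM2l lE); apply: (@le_trans _ _ (s / 10)).
    have -> : lam * E * (100 * (E ^+ 2 * t)) = 2000 * (E ^+ 3 * lam) * t / 20 by field.
    by move: ts s0; clear; lra.
  have bE : b%:R * (E + 2) <= 5 * lam * (2 * E).
    by apply: ler_pM => //; move: E6; clear; lra.
  have : kap <= 5 * lam * (2 * E) * H%:R by rewrite ler_wpM2r.
  have -> : 5 * lam * (2 * E) * H%:R = 10 * (lam * E * H%:R) by ring.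
  by move: kap_ge; clear; lra.
have Hs : 2 * H%:R <= s.
  have : 8 * H%:R <= kap.
    rewrite ler_wpM2r ?ler0n //; move: b1 E6; clear; nra.
  by move: kap4; clear; lra.
have it : i%:R <= 2 * t.
  have h : (i.-1%:R : R) <= t.
    rewrite -ler_sqr ?nnegrE ?(ltW t0) // -st; apply: le_trans Hs.
    by rewrite expr2 -natrM -natrM ler_nat.
  have : (i%:R : R) <= i.-1%:R + 1 by rewrite natr1 ler_nat leqSpred.
  by move: h t1; clear; lra.
have Ei : E * i%:R <= H%:R.
  apply: le_trans Ht; apply: (@le_trans _ _ (2 * (E * t))).
    by rewrite mulrCA ler_wpM2l // ltW.
  have EEt : E * t <= E ^+ 2 * t.
    by rewrite ler_wpM2r ?(ltW t0) // expr2; move: E6; clear; nra.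
  have Et0 : 0 <= E * t by rewrite mulr_ge0 // ltW.
  by move: EEt Et0; clear; move: (E * t) (_ * t) => X Y; lra.
have [H30 e5iH Hb] : [/\ (30 <= H)%N, ((e + 5) * i <= H)%N
    & (8 * (b * (e + 2) * H) + 1 <= 2 ^ b)%N].
  have EEt : 6 * (E * t) <= E ^+ 2 * t.
    by rewrite mulrA ler_wpM2r ?(ltW t0) // expr2 ler_wpM2r // ltW.
  have Et : 6 * t <= E * t by rewrite ler_wpM2r // ltW.
  split.
  - by rewrite -(ler_nat R); move: Ht EEt Et t1; clear; lra.
  - rewrite -(ler_nat R) natrM natrD; apply: le_trans Ht.
    apply: (@le_trans _ _ (2 * E * (2 * t))).
      by apply: ler_pM; rewrite ?addr_ge0 ?(ltW E0) //; move: E6; clear; lra.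
    by move: EEt Et t0; clear; lra.
  - rewrite -(ler_nat R) natrD !natrM natrD -/kap natrX.
    apply: (@le_trans _ _ (s ^+ 2)).
      by move: kap4 s1 t1; clear; nra.
    rewrite sE; apply: (le_trans _ (expR_mulrn_ge b _)); last first.
      by rewrite -[leRHS]lnK ?posrE.
    rewrite ler_expR -aE.
    have : 1 / 4 <= a ^+ 2 by move: a1; clear; nra.
    by move: b_gt lam0; clear; nra.
have FN : (2 ^ (b * (b * (e + 2)) *
    (e * (H * H) + 'C(H, 2) + 'C(i, 2) - e.+1 * (i * i))) <= N)%N.
  apply: leq_trans LN; rewrite leq_exp2l //; apply: leq_trans PL.
  by rewrite -/P leq_mul2l leq_subLR [leqRHS]addnC iF orbT.
have cnt := sylow_count_ge_blocks b0 e6 H30 e5iH Hb FN.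
rewrite sylow_countE ?(ltW x0) // -/N.
set C := (\sum_(1 <= n < N.+1 | is_sylow n) 1)%N in cnt *.
set F := (e * (H * H) + 'C(H, 2) + 'C(i, 2) - e.+1 * (i * i))%N in FN cnt.
set k := (b * (e + 2) * (H + i))%N in cnt.
pose B : R := lam / 2 * (1 + E^-1).
have B0 : 0 <= B by rewrite !mulr_ge0 ?addr_ge0 ?(ltW d0).
have base : ((4 * (b * e.+1 * H) * (b * (e + 2)))%N%:R : R) <= expR B.
  have E1 : E + 1 <= 2 * E by move: E6; clear; lra.
  have -> : (4 * (b * e.+1 * H) * (b * (e + 2)))%N%:R = 4 * b%:R * (E + 1) * kap :> R.
    by rewrite !natrM natrD -(natr1 e) /kap /E; ring.
  apply: (@le_trans _ _ (4 * (5 * lam) * (2 * E) * (4 * s))).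
    by repeat (apply: ler_pM; rewrite ?mulr_ge0 ?addr_ge0 ?(ltW E0) //).
  have -> : B = lam / 2 + lam * E^-1 / 2 by rewrite /B; field; rewrite lt0r_neq0.
  rewrite expRD -sl; have -> : 4 * (5 * lam) * (2 * E) * (4 * s) = s * (160 * (E * lam)) by ring.
  rewrite ler_wpM2l ?(ltW s0) //.
  have ld0 : 0 <= lam * E^-1 by rewrite mulr_ge0 // ltW.
  have y0 : 0 <= lam * E^-1 / 2 by rewrite divr_ge0.
  apply: le_trans (expR_ge1Dxn 2 y0).
  have ld : 100 * E <= lam * E^-1.
    have -> : 100 * E = 100 * E ^+ 2 * E^-1 by field; rewrite lt0r_neq0.
    by rewrite ler_wpM2r // ltW.
  have ld2 : 10000 * E ^+ 2 <= (lam * E^-1) ^+ 2.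
    have -> : 10000 * E ^+ 2 = (100 * E) ^+ 2 by ring.
    by rewrite ler_sqr ?nnegrE ?mulr_ge0 // ltW.
  have ld3 : 10000 * (E * lam) <= (lam * E^-1) ^+ 3.
    have -> : 10000 * (E * lam) = 10000 * E ^+ 2 * (lam * E^-1) by field; rewrite lt0r_neq0.
    by rewrite [leRHS]exprSr ler_wpM2r.
  have -> : (lam * E^-1 / 2) ^+ 3 / 3`!%:R = (lam * E^-1) ^+ 3 / 48.
    have -> : 3`!%:R = 6 :> R by [].
    by move: (lam * E^-1) => Y; field.
  have : 0 <= E * lam by rewrite mulr_ge0 // ltW.
  by move: ld3; clear; move: (_ ^+ 3) (E * lam) => X Y; lra.
have cntR : (2 : R) ^+ (P * F) <= expR (1 + k%:R * B) * C%:R.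
  have h : ((2 ^ (P * F))%N%:R : R) <=
      (2 * (4 * (b * e.+1 * H) * (b * (e + 2))) ^ k * C)%N%:R by rewrite ler_nat.
  rewrite natrX in h; apply: (le_trans h); rewrite natrM ler_wpM2r // natrM expRD.
  apply: ler_pM; rewrite ?ler0n ?expR1_ge2 // natrX.
  exact: (expR_mulrn_le k (ler0n _ _) base).
have xF : x <= 2 ^+ (P * F) * expR (P%:R * ((2 * E + 2) * i%:R + 1)).
  have gF : (P * g.+1 <= P * F + P * ((2 * e + 2) * i + 1))%N.
    rewrite -mulnDr leq_mul2l; apply/orP; right.
    by rewrite /F; move: iG; clear; lia.
  have l0 : 0 <= (ln 2 : R) by rewrite -aE sqr_ge0.
  have l1 : (ln 2 : R) <= 1 by rewrite -aE expr_le1 // ltW.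
  have E2F : 2 ^+ (P * F) = expR ((P * F)%N%:R * ln 2) :> R by rewrite expRM_natl lnK ?posrE.
  have iR : (((2 * e + 2) * i + 1)%N%:R : R) = (2 * E + 2) * i%:R + 1.
    by rewrite !(natrD, natrM).
  rewrite E2F -expRD xE ler_expR.
  apply: (le_trans sL).
  apply: (@le_trans _ _ ((P * F + P * ((2 * e + 2) * i + 1))%N%:R * ln 2)).
    by rewrite ler_wpM2r // ler_nat; exact: leq_trans gF.
  rewrite natrD mulrDl lerD2l [(P * (_ + 1))%N%:R]natrM iR -[leRHS]mulr1 ler_wpM2l //.
  by rewrite mulr_ge0 ?addr_ge0 ?mulr_ge0 ?addr_ge0 ?(ltW E0) // ?mulr_ge0 ?(ltW E0).
have kB : k%:R * B <= (a^-1 / 2 + 10 * E^-1) * (s * lam).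
  have bE0 : 0 <= b%:R * (E + 2) by rewrite mulr_ge0 ?addr_ge0 ?(ltW E0).
  have id : i%:R <= H%:R * E^-1 by rewrite ler_pdivlMr // mulrC.
  have k_le : k%:R <= kap * (1 + E^-1).
    rewrite /k !natrM !natrD -/E /kap -[leRHS]mulrA ler_wpM2l //.
    by move: id; clear; lra.
  have V0 : 0 < a^-1 by rewrite invr_gt0.
  have aV : a^-1 * a = 1 by rewrite mulVf ?lt0r_neq0.
  have V2 : a^-1 <= 2 by move: aV a1 V0; clear; nra.
  have kap_le' : kap <= a^-1 * ((1 + 4 * E^-1) * s).
    have -> : kap = a^-1 * (a * kap) by rewrite mulrA aV mul1r.
    by rewrite ler_wpM2l // ltW.
  have d1 : 0 <= 1 + E^-1 by rewrite addr_ge0 // ltW.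
  apply: (@le_trans _ _ (a^-1 * ((1 + 4 * E^-1) * s) * (1 + E^-1) * B)).
    rewrite ler_wpM2r //; apply: (le_trans k_le); rewrite ler_wpM2r //.
  have -> : a^-1 * ((1 + 4 * E^-1) * s) * (1 + E^-1) * B =
    a^-1 / 2 * ((1 + 4 * E^-1) * (1 + E^-1) ^+ 2) * (s * lam).
    by rewrite /B; field; rewrite !lt0r_neq0.
  rewrite ler_wpM2r ?mulr_ge0 ?(ltW s0) //.
  have : (1 + 4 * E^-1) * (1 + E^-1) ^+ 2 <= 1 + 10 * E^-1.
    move: d0 d6; clear; move: E^-1 => d d0 d6.
    have dd : d * d <= d / 6 by nra.
    have ddd : d * d * d <= d / 36 by nra.
    by rewrite expr2; nra.
  move: V0 V2 d0; clear; move: a^-1 E^-1 (_ * _ ^+ 2) => Y Z X Y0 Y2 Z0 h; nra.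
have rest : P%:R * ((2 * E + 2) * i%:R + 1) + 1 <= E^-1 * (s * lam).
  have P_le : P%:R <= 50 * (E * lam ^+ 2).
    have -> : 50 * (E * lam ^+ 2) = 5 * lam * (5 * lam * (2 * E)) by ring.
    rewrite PR; apply: ler_pM; rewrite ?mulr_ge0 ?addr_ge0 ?(ltW E0) //.
    by apply: ler_pM; rewrite ?addr_ge0 ?(ltW E0) //; move: E6; clear; lra.
  have i_le : (2 * E + 2) * i%:R + 1 <= 7 * (E * t).
    have h : (2 * E + 2) * i%:R <= 3 * E * (2 * t).
      by apply: ler_pM; rewrite ?addr_ge0 ?mulr_ge0 ?(ltW E0) //; move: E6; clear; lra.
    have : 6 * t <= E * t by rewrite ler_wpM2r // ltW.
    by move: h t1; clear; lra.
  have h : P%:R * ((2 * E + 2) * i%:R + 1) <= 50 * (E * lam ^+ 2) * (7 * (E * t)).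
    by apply: ler_pM; rewrite ?addr_ge0 ?mulr_ge0 ?addr_ge0 ?mulr_ge0 ?(ltW E0).
  have h2 : 2000 * (E ^+ 2 * lam ^+ 2 * t) <= E^-1 * (s * lam).
    have -> : 2000 * (E ^+ 2 * lam ^+ 2 * t) = E^-1 * (2000 * (E ^+ 3 * lam) * t * lam).
      by field; rewrite lt0r_neq0.
    by rewrite ler_wpM2l ?(ltW d0) // ler_wpM2r.
  have h3 : 1 <= E ^+ 2 * lam ^+ 2 * t.
    have E21 : 1 <= E ^+ 2 by move: E2; clear; lra.
    have l21 : 1 <= lam ^+ 2 by rewrite exprn_ege1 //; move: lam1; clear; lra.
    apply: mulr_ege1; first exact: mulr_ege1.
    by move: t1; clear; lra.
  have h4 : 50 * (E * lam ^+ 2) * (7 * (E * t)) = 350 * (E ^+ 2 * lam ^+ 2 * t) by ring.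
  rewrite h4 in h; move: h h2 h3; clear.
  move: (E ^+ 2 * lam ^+ 2 * t) (P%:R * _) (E^-1 * _) => X Y Z h h2 h3.
  lra.
rewrite mulNr expRN ler_pdivrMr ?expR_gt0 //.
apply: (le_trans xF).
apply: (le_trans (ler_wpM2r (expR_ge0 _) cntR)).
rewrite mulrAC -expRD mulrC ler_wpM2l ?ler0n // ler_expR.
have -> : (2 * a)^-1 = a^-1 / 2 by rewrite invfM mulrC.
by move: kB rest; clear; move: (P%:R * _) (k%:R * B) (s * lam) => X Y Z; lra.
Qed.

(** * The limit *)

(** The parameters of both bounds depend only on [eta], and the growth conditions on [s] hold
    from some point on because [s = expR (lam / 2)] outgrows every power of [lam]. *)
Lemma sylow_count_bounds (R : realType) (eta : R) : 0 < eta ->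
  exists X0 : R, forall x, X0 <= x ->
    let c := 1 / (2 * Num.sqrt (ln 2)) in
    let q := Num.sqrt (ln x) * ln (ln x) in
    [/\ 0 < x, 0 < q,
        x * expR (- (c + eta) * q) <= (sylow_count x)%:R
      & (sylow_count x)%:R <= x * expR (- (c - eta) * q)].
Proof.
move=> eta0.
pose eps : R := Num.min (1 / 2) (eta / 7).
have eps0 : 0 < eps by rewrite lt_min !divr_gt0.
have eps1 : eps <= 1 / 2 by rewrite ge_min lexx.
have eps7 : 7 * eps <= eta.
  by have : eps <= eta / 7; [rewrite ge_min lexx orbT | lra].
pose K := 9 / eps.
have eK : eps * K = 9 by rewrite mulrC divfK ?lt0r_neq0.
have K0 : 0 < K by rewrite divr_gt0.
have [e0 /andP[e0_gt _]] : exists n : nat, 11 / eta < n%:R <= 11 / eta + 1.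
  by apply: exists_nat_above; rewrite divr_ge0 // ltW.
pose e := (e0 + 6)%N; have e6 : (6 <= e)%N by rewrite leq_addl.
have e11 : 11 / e%:R <= eta.
  have ee : 0 < (e%:R : R) by rewrite ltr0n; exact: leq_trans e6.
  rewrite ler_pdivrMr // mulrC -ler_pdivrMr //; apply: (le_trans (ltW e0_gt)).
  by rewrite ler_nat leq_addr.
(* The constants come from comparing [expR (lam / 2)] with [(lam / 2) ^ 5 / 5`!] and
   [expR (lam / 4)] with [(lam / 4) ^ 2 / 2]. *)
pose l0 : R := Num.max (Num.max (K ^+ 3) (1000 * (4000 * K ^+ 5)))
  (Num.max (100 * e%:R ^+ 2) (1000 * (64 * e%:R ^+ 3))).
exists (expR (expR l0)) => x xX c q.
have x0 : 0 < x by exact: lt_le_trans (expR_gt0 _) xX.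
have lx : expR l0 <= ln x by rewrite -[leLHS]expRK ler_ln ?posrE ?expR_gt0.
have lx0 : 0 < ln x by exact: lt_le_trans (expR_gt0 _) lx.
rewrite /q; set lam := ln (ln x); set s := Num.sqrt (ln x).
have lam_ge : l0 <= lam by rewrite -[leLHS]expRK ler_ln ?posrE ?expR_gt0.
move: lam_ge; rewrite !ge_max => /andP[/andP[h1 h2] /andP[h3 h4]].
have lam0 : 0 < lam by apply: lt_le_trans h1; rewrite exprn_gt0.
have s2 : s ^+ 2 = ln x by rewrite sqr_sqrtr // ltW.
have sE : s ^+ 2 = expR lam by rewrite s2 lnK.
have xE : x = expR (s ^+ 2) by rewrite s2 lnK.
have s0 : 0 < s by rewrite sqrtr_gt0.
have sl : s = expR (lam / 2).
  have : s ^+ 2 = (expR (lam / 2)) ^+ 2.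
    by rewrite sE -expRM_natl; congr expR; field.
  by move/eqP; rewrite eqrXn2 ?expR_ge0 ?(ltW s0) // => /eqP.
pose t := expR (lam / 4).
have st : s = t ^+ 2 by rewrite sl -expRM_natl; congr expR; field.
have cE : c = (2 * Num.sqrt (ln 2))^-1 by rewrite /c div1r.
have q0 : 0 < s * lam by rewrite mulr_gt0.
split=> //.
- have tE : 2000 * e%:R ^+ 3 * lam <= t.
    have y0 : 0 <= lam / 4 by rewrite divr_ge0 // ltW.
    apply: le_trans (expR_ge1Dxn 1 y0).
    have -> : 1 + (lam / 4) ^+ 2 / 2`!%:R = 1 + lam / 32 * lam.
      by have -> : 2`!%:R = 2 :> R by []; move: (lam); clear => l; field.
    have : 2000 * e%:R ^+ 3 * lam <= lam / 32 * lam.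
      by rewrite ler_wpM2r ?(ltW lam0) //; move: h4; clear; lra.
    by clear; lra.
  apply: le_trans (sylow_count_lower e6 h3 tE st sE xE).
  rewrite ler_wpM2l ?(ltW x0) // ler_expR ler_wpM2r ?(ltW q0) // lerN2 cE.
  by rewrite lerD2l.
- have sK : 1000 * (K ^+ 5 * lam ^+ 4) <= s.
    have y0 : 0 <= lam / 2 by rewrite divr_ge0 // ltW.
    rewrite sl; apply: le_trans (expR_ge1Dxn 4 y0).
    have -> : (lam / 2) ^+ 5 / 5`!%:R = lam / 3840 * lam ^+ 4.
      by have -> : 5`!%:R = 120 :> R by []; move: (lam); clear => l; field.
    have K5 : 0 <= K ^+ 5 by rewrite exprn_ge0 ?(ltW K0).
    have : 1000 * K ^+ 5 * lam ^+ 4 <= lam / 3840 * lam ^+ 4.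
      by rewrite ler_wpM2r ?exprn_ge0 ?(ltW lam0) //; move: h2 K5; clear; lra.
    rewrite [1000 * (_ * _)]mulrA; clear.
    by move: (1000 * _ * _) (_ / 3840 * _) => X Y; lra.
  have eps01 : 0 < eps <= 1 / 2 by rewrite eps0.
  apply: le_trans (sylow_count_upper eps01 eK h1 sK sE xE) _.
  rewrite ler_wpM2l ?(ltW x0) // ler_expR ler_wpM2r ?(ltW q0) // lerN2 cE.
  by rewrite lerD2l lerN2.
Qed.

Lemma sylow_exponent_near (R : realType) (eta : R) : 0 < eta ->
  \forall x \near (+oo)%R,
    `|1 / (2 * Num.sqrt (ln 2)) -
      ln (x / (sylow_count x)%:R) / (Num.sqrt (ln x) * ln (ln x))| <= eta.
Proof.
move=> eta0; have [X0 hX] := sylow_count_bounds eta0.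
apply: filterS (nbhs_pinfty_ge (num_real X0)) => x /hX.
set c := 1 / _; set q := _ * ln _ => /= -[x0 q0 lo hi].
have n0 : 0 < (sylow_count x)%:R :> R.
  by apply: lt_le_trans lo; rewrite mulr_gt0 ?expR_gt0.
set n := (sylow_count x)%:R in n0 lo hi *.
have lnE : ln (x / n) = ln x - ln n by rewrite ln_div ?posrE.
have lo' : ln x + - (c + eta) * q <= ln n.
  rewrite -[- (c + eta) * q]expRK -lnM ?posrE ?expR_gt0 //.
  by rewrite ler_ln ?posrE ?mulr_gt0 ?expR_gt0.
have hi' : ln n <= ln x + - (c - eta) * q.
  rewrite -[- (c - eta) * q]expRK -lnM ?posrE ?expR_gt0 //.
  by rewrite ler_ln ?posrE ?mulr_gt0 ?expR_gt0.
rewrite distrC ler_distl lnE; apply/andP; split.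
  by rewrite ler_pdivlMr //; move: hi'; clear; lra.
by rewrite ler_pdivrMr //; move: lo'; clear; lra.
Qed.

Local Open Scope classical_set_scope.

Theorem theorem1p1 (R : realType) :
  ((ln (x / (sylow_count x)%:R) / (Num.sqrt (ln x) * ln (ln x)) : R)
     @[x --> +oo] --> (1 / (2 * Num.sqrt (ln 2)) : R))
  /\
  (exists eps : R -> R,
     (eps x @[x --> +oo] --> (0 : R)) /\
     (\forall x \near +oo,
        (sylow_count x)%:R =
        x * expR (- (1 / (2 * Num.sqrt (ln 2)) + eps x) *
                  (Num.sqrt (ln x) * ln (ln x))))).
Proof.
split.
  by apply/cvgrPdist_le => eta eta0; exact: sylow_exponent_near.
exists (fun x => ln (x / (sylow_count x)%:R) / (Num.sqrt (ln x) * ln (ln x)) -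
  1 / (2 * Num.sqrt (ln 2))); split.
  apply/cvgrPdist_le => eta eta0; near=> x.
  rewrite sub0r opprB; near: x; exact: sylow_exponent_near.
have [X0 hX] := @sylow_count_bounds R 1 ltr01.
apply: filterS (nbhs_pinfty_ge (num_real X0)) => x /hX /= [x0 q0 lo _].
have n0 : 0 < (sylow_count x)%:R :> R.
  by apply: lt_le_trans lo; rewrite mulr_gt0 ?expR_gt0.
rewrite addrC subrK mulNr divfK ?lt0r_neq0 // expRN lnK ?posrE ?divr_gt0 //.
by rewrite invf_div mulrCA divff ?mulr1 ?lt0r_neq0.
Unshelve. all: by end_near.
Qed.
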